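(* Let $(X,d,\omega)$ be an unbounded complete $2$-PI space. Fix a Sobolev–Poincaré exponent $\kappa>1$ (with a dilation $\lambda_S\ge1$) for which $$\Big(\frac1{\omega(B)}\int_B|u-u_{B,\omega}|^{2\kappa}\,d\omega\Big)^{1/(2\kappa)}\le Cr_B\Big(\frac1{\omega(\lambda_SB)}\int_{\lambda_SB}g_u^2\,d\omega\Big)^{1/2}$$ for all balls $B$ and all $u\in N^{1,2}_{\mathrm{loc}}(X)$. Let $d\pi=V\,d\omega$ with $V\in RH_q(d\omega)$ and $q'\le\kappa$, where $1/q+1/q'=1$. Then for every ball $B$ and every $u\in N^{1,2}_{\mathrm{loc}}(X)$, $$\int_B|\widetilde u-u_{B,\omega}|^2\,d\pi\le C\frac{r_B^2\pi(B)}{\omega(B)}\int_{\lambda_SB}g_u^2\,d\omega.$$ Consequently, on balls satisfying $\pi(B)\simeq\omega(B)/r_B^2$, the mixed Poincaré estimate (recalled in the context) follows directly. For compact $K\subset B$, one also has $$\pi(K)\le C\frac{r_B^2\pi(\Lambda B)}{\omega(\Lambda B)}\operatorname{cap}_{2,\omega}(K;\Lambda B),$$ where $\Lambda$ is the fixed structural dilation specified in the context. Thus a uniform normalized capacity estimate (that is, $\pi(K)\le C\operatorname{cap}_{2,\omega}(K;\Lambda B)$ with $C$ uniform in $B$ and in compact $K\subset B$) additionally requires uniform control of the fixed-dilate ratio $r_B^2\pi(\Lambda B)/\omega(\Lambda B)$; it is not inferred from the normalization $\pi(B)\simeq\omega(B)/r_B^2$ on $B$ alone. The constants $C$ in the displayed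 estimates do not depend on $B$, $u$ or $K$.
   Context: Balls are open and carry a designated centre and radius; $\lambda B$ is the concentric dilate; $r_B$ is the radius of $B$; $u_{B,\omega}=\frac1{\omega(B)}\int_B u\,d\omega$. The measure $\omega$ is a Borel regular measure with full support on the metric space $(X,d)$. $2$-PI space: $\omega$ is doubling, i.e. $0<\omega(B(x,2r))\le C_D\,\omega(B(x,r))<\infty$ for all $x\in X$, $r>0$, and there are $C_P>0$, $\lambda_P\ge1$ such that $$\frac1{\omega(B)}\int_B|u-u_{B,\omega}|\,d\omega\le C_P r_B\Big(\frac1{\omega(\lambda_PB)}\int_{\lambda_PB}g^2\,d\omega\Big)^{1/2}$$ for every ball $B$, every locally integrable $u$ and every $2$-weak upper gradient $g$ of $u$. $N^{1,2}_{\mathrm{loc}}(X)$ and $N_0^{1,2}(\Omega)$ are the standard local and zero-boundary-value Newtonian spaces, $g_u$ the minimal $2$-weak upper gradient, $\widetilde u$ a quasicontinuous representative. For $\Omega\subset X$ open and $K\subset\Omega$, $$\operatorname{cap}_{2,\omega}(K;\Omega)=\inf\Big\{\int_\Omega g_v^2\,d\omega:\ v\in N_0^{1,2}(\Omega),\ \widetilde v\ge1\text{ quasieverywhere on }K\Big\}.$$ $V\in RH_q(d\omega)$, $1<q<\infty$, means $V\ge0$ is locally integrable and $\big(\frac1{\omega(B)}\int_BV^q\,d\omega\big)^{1/q}\le C\frac1{\omega(B)}\int_BV\,d\omega$ for every ball $B$. Fixed dilation $\Lambda$: $\lambda_2\ge1$ is a constant depending only on the $2$-PI data with $\int_B|u-u_{B,\omega}|^2\,d\omega\le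 C_2'r_B^2\int_{\lambda_2B}g_u^2\,d\omega$ for all balls $B$ and $u\in N^{1,2}_{\mathrm{loc}}(X)$; one fixes, in this order, $\Lambda_0>8\lambda_2+8$, then $1<\tau<\Lambda_0$ and $\Lambda\ge\max\{\Lambda_0,\lambda_2\tau\}$, the precise values being irrelevant. Mixed Poincaré estimate on $B$: for $u\in N^{1,2}_{\mathrm{loc}}(X)$, $$\int_B\int_B|u(x)-\widetilde u(y)|^2\,d\omega(x)\,d\pi(y)\le Cr_B^2\pi(B)\int_{\Lambda B}g_u^2\,d\omega.$$ *)

(* Defs.v *)
From HB Require Import structures.
From mathcomp Require Import all_boot all_order all_algebra.
From mathcomp Require Import all_classical all_reals all_analysis.
From mathcomp Require Import measurable_realfun.

Set Implicit Arguments.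
Unset Strict Implicit.
Unset Printing Implicit Defensive.

Import Order.TTheory GRing.Theory Num.Theory.
Import numFieldNormedType.Exports.

Local Open Scope classical_set_scope.
Local Open Scope ring_scope.
Local Open Scope ereal_scope.

(* A metric space with a sigma-algebra.  The sigma-algebra and the topology are
   tied together only by [borel_regular] below. *)
#[short(type="metricMeasurableType")]
HB.structure Definition MetricMeasurable (d : measure_display) (R : realType) :=
  {T of Metric R T & Measurable d T}.

Section metric.
Context {R : realType} (X : metricType R).

Definition metric_complete : Prop :=
  forall F : set_system X, ProperFilter F -> cauchy F -> exists x : X, F --> x.

Definition metric_unbounded : Prop :=
  forall M : R, exists x y : X, (M < mdist x y)%R.

Definition curve_length (c : R -> X) (a b : R) : \bar R :=
  ereal_sup [set (\sum_(i < size s)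
    mdist (c (nth b (a :: s) i)) (c (nth b s i)))%:E | s in itv_partition a b].

(* Nonconstant compact rectifiable curves.  Each one is represented by its
   arc-length parametrization on `[0, l], where l > 0 is its length; the values
   of the map outside `[0, l] are junk and are never used. *)
Record curve := Curve {
  curve_end : R ;
  curve_map :> R -> X ;
  curve_end_gt0 : (0 < curve_end)%R ;
  curve_arc_length : forall s t : R, (0 <= s)%R -> (s <= t)%R ->
    (t <= curve_end)%R -> curve_length curve_map s t = (t - s)%:E }.

Definition curve_image (c : curve) : set X := c @` `[0%R, curve_end c].

Definition line_integral (c : curve) (g : X -> \bar R) : \bar R :=
  \int[lebesgue_measure]_(t in `[0%R, curve_end c]) g (c t).

Definition upper_gradient_ineq (u : X -> R) (g : X -> \bar R) (c : curve) :=
  `|u (c 0%R) - u (c (curve_end c))|%:E <= line_integral c g.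

End metric.

Section measure_metric.
Context {d : measure_display} {R : realType} {X : metricMeasurableType d R}.
Variable omega : {measure set X -> \bar R}.
Implicit Types (u v : X -> R) (g : X -> \bar R) (U K E : set X).

Definition borel : set (set X) := <<s [set U : set X | open U] >>.

(* A Borel regular (outer) measure, restricted to its measurable sets. *)
Definition borel_regular : Prop :=
  [/\ (forall U, open U -> measurable U),
      (forall A : set X, measurable A -> exists B : set X,
        [/\ borel B, A `<=` B & omega B = omega A]) &
      measure_is_complete omega].

Definition full_support : Prop :=
  forall U, open U -> U !=set0 -> 0 < omega U.

Definition eavg E (f : X -> \bar R) : \bar R :=
  (omega E)^-1 * \int[omega]_(x in E) f x.

Definition mean E u : R := fine (eavg E (EFin \o u)).

Definition loc_integrable u : Prop :=
  forall x : X, exists2 r : R, (0 < r)%R &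
    omega.-integrable (ball x r) (EFin \o u).

Definition loc_L2 g : Prop :=
  forall x : X, exists2 r : R, (0 < r)%R &
    \int[omega]_(y in ball x r) (g y) ^+ 2 < +oo.

Definition borel_nonneg g : Prop :=
  (forall x, 0 <= g x) /\
  forall Y : set (\bar R), measurable Y -> borel (g @^-1` Y).

(* The 2-modulus of a family of curves. *)
Definition modulus2 (Gamma : set (curve X)) : \bar R :=
  ereal_inf [set \int[omega]_x (rho x) ^+ 2 | rho in
    [set rho : X -> \bar R | borel_nonneg rho /\
      forall c, Gamma c -> 1 <= line_integral c rho]].

Definition upper_gradient U u g : Prop :=
  borel_nonneg g /\
  forall c : curve X, curve_image c `<=` U -> upper_gradient_ineq u g c.

Definition weak_upper_gradient u g : Prop :=
  borel_nonneg g /\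
  modulus2 [set c : curve X | ~ upper_gradient_ineq u g c] = 0.

(* N^{1,2}(U) for U open; functions are real-valued and defined at every
   point. *)
Definition newtonian U u : Prop :=
  [/\ measurable_fun U u,
      \int[omega]_(x in U) ((u x) ^+ 2)%:E < +oo &
      exists2 g, upper_gradient U u g & \int[omega]_(x in U) (g x) ^+ 2 < +oo].

Definition newtonian_loc u : Prop :=
  forall x : X, exists2 r : R, (0 < r)%R & newtonian (ball x r) u.

Definition newtonian0 U u : Prop :=
  newtonian setT u /\ forall x, ~ U x -> u x = 0%R.

Definition minimal_weak_upper_gradient u g : Prop :=
  [/\ weak_upper_gradient u g, loc_L2 g &
      forall g', weak_upper_gradient u g' -> loc_L2 g' ->
        {ae omega, forall x, g x <= g' x}].

(* The Sobolev capacity C_2, which defines quasieverywhere and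
   quasicontinuity. *)
Definition sobolev_capacity E : \bar R :=
  ereal_inf [set e | exists v g,
    [/\ newtonian setT v, (forall x, E x -> (1 <= v x)%R),
        upper_gradient setT v g &
        e = \int[omega]_x ((v x) ^+ 2)%:E + \int[omega]_x (g x) ^+ 2]].

Definition quasicontinuous u : Prop :=
  forall e : R, (0 < e)%R -> exists G : set X,
    [/\ open G, sobolev_capacity G < e%:E & {within ~` G, continuous u}].

Definition quasicontinuous_representative u ut : Prop :=
  quasicontinuous ut /\ {ae omega, forall x, ut x = u x}.

(* cap_{2,omega}(K; U) *)
Definition capacity K U : \bar R :=
  ereal_inf [set e | exists v vt g,
    [/\ newtonian0 U v, quasicontinuous_representative v vt,
        sobolev_capacity [set x | K x /\ (vt x < 1)%R] = 0,
        minimal_weak_upper_gradient v g &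
        e = \int[omega]_(x in U) (g x) ^+ 2]].

Definition doubling : Prop :=
  exists CD : R, forall (x : X) (r : R), (0 < r)%R ->
    [/\ 0 < omega (ball x (2 * r)%R),
        omega (ball x (2 * r)%R) <= CD%:E * omega (ball x r) &
        CD%:E * omega (ball x r) < +oo].

Definition poincare12 (CP lambdaP : R) : Prop :=
  forall (x : X) (r : R) u g, (0 < r)%R ->
    loc_integrable u -> weak_upper_gradient u g ->
    eavg (ball x r) (fun y => `|u y - mean (ball x r) u|%:E) <=
    (CP * r)%:E *
      (eavg (ball x (lambdaP * r)%R) (fun y => (g y) ^+ 2)) `^ (2^-1).

Definition two_PI : Prop :=
  doubling /\
  exists CP lambdaP : R, [/\ (0 < CP)%R, (1 <= lambdaP)%R &
                            poincare12 CP lambdaP].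

Definition poincare22 (C2 lambda2 : R) : Prop :=
  forall (x : X) (r : R) u g, (0 < r)%R ->
    newtonian_loc u -> minimal_weak_upper_gradient u g ->
    \int[omega]_(y in ball x r) ((u y - mean (ball x r) u) ^+ 2)%:E <=
    (C2 * r ^+ 2)%:E * \int[omega]_(y in ball x (lambda2 * r)%R) (g y) ^+ 2.

Definition sobolev_poincare (kappa CS lambdaS : R) : Prop :=
  forall (x : X) (r : R) u g, (0 < r)%R ->
    newtonian_loc u -> minimal_weak_upper_gradient u g ->
    (eavg (ball x r)
       (fun y => (`|u y - mean (ball x r) u| `^ (2 * kappa))%:E))
      `^ ((2 * kappa)^-1) <=
    (CS * r)%:E *
      (eavg (ball x (lambdaS * r)%R) (fun y => (g y) ^+ 2)) `^ (2^-1).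

Definition reverse_holder (q : R) (V : X -> R) : Prop :=
  [/\ (forall x, (0 <= V x)%R), loc_integrable V &
      exists C : R, forall (x : X) (r : R), (0 < r)%R ->
        (eavg (ball x r) (fun y => ((V y) `^ q)%:E)) `^ (q^-1) <=
        C%:E * eavg (ball x r) (EFin \o V)].

End measure_metric.

(* Main.v *)
Require Import Defs.
From HB Require Import structures.
From mathcomp Require Import all_boot all_order all_algebra.
From mathcomp Require Import all_classical all_reals all_analysis.
From mathcomp Require Import measurable_realfun.
From mathcomp Require Import ring lra.

Import Order.TTheory GRing.Theory Num.Theory.
Import numFieldNormedType.Exports.

Local Open Scope classical_set_scope.
Local Open Scope ring_scope.
Local Open Scope ereal_scope.

(* Young's inequality with the reverse Hoelder condition and q' <= kappa turns a
   bound on the omega-average of f^kappa over a ball B into one for the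
   pi-integral of f over B; with f = (u - c)^2 the Sobolev-Poincare inequality
   gives the weighted estimate.

   For the mixed estimate the dilation of g must be Lambda even if
   lambdaS > Lambda, so B is covered by boundedly many balls of radius
   r / lambdaS, whose averages of u are compared with that over 2B by the
   (2,2)-Poincare inequality.

   For the capacity, a function v vanishing off U = ball x R also vanishes on a
   ball of radius R inside ball x (5 * R) (annuli are nonempty by the Poincare
   inequality), which bounds its mean there; and its minimal weak upper
   gradient vanishes a.e. off U, because cutting a curve at its first and last
   exit from U shows that g restricted to U is again a weak upper gradient.

   Conversely, the ratio is controlled by testing the capacity of a closed ball
   with a Lipschitz cutoff.  The capacity is an infimum over functions that have
   a minimal weak upper gradient, so one must be produced: weak upper gradients
   are closed under minima (by outer regularity on each curve) and under
   decreasing limits, hence the infimum of a minimizing sequence is minimal. *)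

(** The hypotheses are local (a radius at each point), while the estimates concern arbitrary balls.
    Doubling and completeness make closed balls compact, which turns local measurability and
    finiteness into statements on every ball and also supplies the compact sets that test the
    capacity estimate. The energy in the capacity is taken over U alone, but the Sobolev-Poincare
    inequality on a ball that meets the zero set of v brings in a larger dilated ball; this is why
    the minimal gradient has to vanish off U. Locality and minimality are both settled on curves.
    The inequality at the endpoints survives neither cutting nor minima, so it is first strengthened
    to all subarcs of almost every curve. Minimality must be tested against competitors that are
    only locally square integrable; the minimum with such a competitor is still a weak upper
    gradient because almost every curve has finite line integrals for both. *)

(** * Doubling metric measure spaces *)

(* No measurability is needed: the integral of a nonnegative function is a
   supremum over the simple functions below it. *)
Lemma le_integral_ge0 {d} {T : measurableType d} {R : realType}
    (mu : {measure set T -> \bar R}) (D : set T) (f g : T -> \bar R) :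
  (forall x, D x -> 0 <= f x) -> (forall x, D x -> f x <= g x) ->
  \int[mu]_(x in D) f x <= \int[mu]_(x in D) g x.
Proof.
move=> f0 fg.
have g0 x : D x -> 0 <= g x by move=> Dx; exact: le_trans (f0 _ Dx) (fg _ Dx).
rewrite (ge0_integralE _ f0) (ge0_integralE _ g0).
apply: ge_ereal_sup => _ [h hf <-]; apply: ereal_sup_ubound; exists h => // x.
apply: (le_trans (hf x)); rewrite /patch; case: ifPn => //.
by rewrite inE => /fg.
Qed.

Section geometry.
Context {d : measure_display} {R : realType} {X : metricMeasurableType d R}.
Context (omega : {measure set X -> \bar R}).
Context (openm : forall U : set X, open U -> measurable U).
Context (CD : R) (dbl : forall (x : X) (r : R), (0 < r)%R ->
    [/\ 0 < omega (ball x (2 * r)%R),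
        omega (ball x (2 * r)%R) <= CD%:E * omega (ball x r) &
        CD%:E * omega (ball x r) < +oo]).

(** Real-valued, so that the arithmetic takes place in [R]; nothing is lost for r > 0, since
    doubling makes the measure of such balls positive and finite. *)
Definition ball_volume (x : X) (r : R) : R := fine (omega (ball x r)).
Local Notation vol := ball_volume.

Lemma open_ball (x : X) (r : R) : open (ball x r).
Proof.
rewrite openE => y /=; rewrite ballEmdist /= => xy.
apply/nbhs_ballP; exists (r - mdist x y)%R; first by rewrite /= subr_gt0.
move=> z /=; rewrite !ballEmdist /= => yz.
by rewrite (le_lt_trans (metric_triangle _ y _))// -ltrBrDl.
Qed.

Lemma ball_measurable (x : X) (r : R) : measurable (ball x r : set X).
Proof. exact/openm/open_ball. Qed.

Lemma subset_ball (x y : X) (r s : R) :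
  (mdist y x + r <= s)%R -> (ball x r : set X) `<=` ball y s.
Proof.
move=> h z; rewrite !ballEmdist /= => xz.
by rewrite (le_lt_trans (metric_triangle _ x _))// (lt_le_trans _ h)// ltrD2l.
Qed.

Lemma vol_gt0_fin (x : X) (r : R) : (0 < r)%R ->
  omega (ball x r) = (vol x r)%:E /\ (0 < vol x r)%R.
Proof.
move=> r0.
have [] := dbl x (r / 2)%R; first by rewrite divr_gt0.
rewrite (_ : 2 * (r / 2) = r)%R; last by field.
move=> p0 le1 lt1.
have fin : omega (ball x r) \is a fin_num.
  by rewrite ge0_fin_numE//; exact: le_lt_trans lt1.
by rewrite /vol fineK//; split => //; rewrite -lte_fin fineK.
Qed.

Lemma volE (x : X) (r : R) : (0 < r)%R -> omega (ball x r) = (vol x r)%:E.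
Proof. by move=> /(vol_gt0_fin x)[]. Qed.

Lemma vol_gt0 (x : X) (r : R) : (0 < r)%R -> (0 < vol x r)%R.
Proof. by move=> /(vol_gt0_fin x)[]. Qed.

Lemma le_vol (x y : X) (r s : R) : (0 < r)%R ->
  (mdist y x + r <= s)%R -> (vol x r <= vol y s)%R.
Proof.
move=> r0 h; have s0 : (0 < s)%R by have := mdist_ge0 y x; lra.
rewrite -lee_fin -!volE// le_measure ?inE//; [exact: ball_measurable..|].
exact: subset_ball.
Qed.

Lemma vol_doubling (x : X) (r : R) : (0 < r)%R ->
  (vol x (2 * r) <= CD * vol x r)%R.
Proof.
move=> r0; have [_ + _] := dbl x r r0.
by rewrite !volE//; lra.
Qed.

Lemma doubling_gt0 (x : X) : (0 < CD)%R.
Proof.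
have := vol_doubling x 1 ltr01.
have := vol_gt0 x 1 ltr01.
have := vol_gt0 x (2 * 1) ltac:(lra).
by move=> h1 h2 h3; rewrite -(pmulr_lgt0 _ h2); lra.
Qed.

Lemma vol_iter (x : X) (r : R) n : (0 < r)%R ->
  (vol x (2 ^+ n * r) <= CD ^+ n * vol x r)%R.
Proof.
move=> r0; elim: n => [|n ih]; first by rewrite !expr0 !mul1r.
rewrite exprS -mulrA (le_trans (vol_doubling _ _ _))//.
  by rewrite mulr_gt0 ?exprn_gt0.
by rewrite exprS -mulrA ler_pM2l// doubling_gt0.
Qed.

(** Doubling for balls with different centres: C depends on [k] and [CD] only, through the number n
    of doublings with k <= 2 ^ n. *)
Lemma vol_compare (k : R) : exists2 C : R, (0 < C)%R &
  forall (x y : X) (r s : R), (0 < r)%R -> (0 < s)%R ->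
    (mdist y x + s <= k * r)%R -> (vol x s <= C * vol y r)%R.
Proof.
have [n kn] : exists n, (k <= 2 ^+ n)%R.
  exists (Num.truncn k).+1; apply: le_trans (ltW (truncnS_gt k)) _.
  by rewrite -natrX ler_nat ltnW// ltn_expl.
(* The sign of [CD] is known only once a point of X is given, hence the absolute value and the 1. *)
exists (`|CD| ^+ n + 1)%R; first by rewrite ltr_wpDl// exprn_ge0.
move=> x y r s r0 s0 h.
have CD0 := doubling_gt0 x.
apply: (@le_trans _ _ (vol y (2 ^+ n * r))).
  by apply: le_vol => //; rewrite (le_trans h)// ler_wpM2r// ltW.
apply: (le_trans (vol_iter _ _ n r0)).
by rewrite gtr0_norm// mulrDl mul1r lerDl ltW// vol_gt0.
Qed.

(** Packing: the balls of radius rho * r / 2 about the points are disjoint, lie in ball x (2 * r),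
    and each carries at least a fixed fraction of its measure. *)
Lemma separated_size_bound (rho : R) : (0 < rho)%R -> (rho <= 1)%R ->
  exists N : nat, forall (x : X) (r : R) (s : seq X), (0 < r)%R ->
    all (fun p => mdist x p < r)%R s ->
    pairwise (fun p q => rho * r <= mdist p q)%R s -> (size s <= N)%N.
Proof.
(* ball x (2 * r) lies in the ball of radius 3 * r about each point, and 3 * r is 6 / rho times the
   small radius rho * r / 2. *)
move=> rho0 rho1; have [C C0 hC] := vol_compare (6 / rho)%R.
exists (Num.truncn C) => x r s r0 sx sep.
have rr0 : (0 < rho * r / 2)%R by rewrite divr_gt0// mulr_gt0.
pose U t : set X := \big[setU/set0]_(p <- t) ball p (rho * r / 2)%R.
have mU t : measurable (U t).
  by apply: bigsetU_measurable => p _; exact: ball_measurable.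
have sub : U s `<=` ball x (2 * r)%R.
  rewrite /U; elim: (s) sx => [_|p t ih /=]; first by rewrite big_nil.
  move=> /andP[xp tx]; rewrite big_cons => z [|]; last exact: ih.
  apply: subset_ball; have : (rho * r <= r)%R by rewrite ler_piMl// ltW.
  lra.
have low : ((size s)%:R * (C^-1 * vol x (2 * r)))%:E <= omega (U s).
  elim: s sx sep {sub} => [|p t ih]; first by rewrite mul0r.
  move=> /andP[xp tx] /andP[pt sep].
  rewrite /U big_cons measureU //=; last 3 first.
  - exact: ball_measurable.
  - exact: mU.
  - apply/seteqP; split => // z [pz]; rewrite -/(U t) /U.
    elim: t pt {ih tx sep} => [_|q t ih /=]; first by rewrite big_nil.
    move=> /andP[pq pt]; rewrite big_cons => -[|]; last exact: ih.
    move: pz; rewrite !ballEmdist /= => pz qz.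
    have := metric_triangle p z q; rewrite (metric_sym z q); lra.
  rewrite -natr1 mulrDl mul1r EFinD addeC leeD//; last exact: ih.
  rewrite volE// lee_fin ler_pdivrMl//; apply: hC => //; first by rewrite mulr_gt0.
  rewrite (_ : 6 / rho * (rho * r / 2) = 3 * r)%R; last by field; rewrite gt_eqF.
  by rewrite metric_sym; lra.
have v0 : (0 < vol x (2 * r))%R by rewrite vol_gt0// mulr_gt0.
have : ((size s)%:R * (C^-1 * vol x (2 * r)) <= vol x (2 * r))%R.
  rewrite -lee_fin -[leRHS]volE ?mulr_gt0//; apply: (le_trans low).
  by apply: le_measure; rewrite ?inE//; exact: ball_measurable.
rewrite mulrA -[leRHS]mul1r ler_pM2r// ler_pdivrMr// mul1r => sC.
by rewrite truncn_ge_nat// ltW.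
Qed.

Lemma ball_cover (rho : R) : (0 < rho)%R -> (rho <= 1)%R ->
  exists N : nat, forall (x : X) (r : R), (0 < r)%R ->
    exists s : seq X, [/\ (size s <= N)%N,
      all (fun p => mdist x p < r)%R s &
      forall y, ball x r y -> exists2 p, p \in s & ball p (rho * r)%R y].
Proof.
move=> rho0 rho1; have [N hN] := separated_size_bound _ rho0 rho1.
exists N => x r r0.
pose cov s := [/\ all (fun p => mdist x p < r)%R s &
      forall y, ball x r y -> exists2 p, p \in s & ball p (rho * r)%R y].
(* Greedy choice, by induction on the allowed size: either some list of at most N points covers, or
   there are N + 1 separated points, which the packing bound excludes. *)
suff [[s [sN [sx sc]]]|[s [sn sx sep]]] :
   (exists s, (size s <= N)%N /\ cov s) \/
   (exists s, [/\ size s = N.+1, all (fun p => mdist x p < r)%R s &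
     pairwise (fun p q => rho * r <= mdist p q)%R s]).
- by exists s; split.
- by have := hN x r s r0 sx sep; rewrite sn ltnn.
elim: N {hN} => [|n [[s [sn cs]]|[s [sn sx sep]]]].
- by right; exists [:: x]; rewrite /= mdistxx r0.
- by left; exists s; split => //; exact: leq_trans sn _.
have [[y xy ny]|h] := pselect (exists2 y, ball x r y &
    forall p, p \in s -> ~ ball p (rho * r)%R y).
  right; exists (y :: s); split => //=; first by rewrite sn.
    by rewrite sx andbT; move: xy; rewrite ballEmdist.
  rewrite sep andbT; apply/allP => p ps.
  by have := ny p ps; rewrite ballEmdist /= metric_sym => /negP; rewrite -leNgt.
left; exists s; split; first by rewrite sn.
split => // y xy; apply: contrapT => hy; apply: h; exists y => // p ps py.
by apply: hy; exists p.
Qed.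

(** * Compactness of closed balls and the passage from local to global *)

Lemma closed_closed_ball_mdist (x : X) (r : R) :
  closed [set y | (mdist x y <= r)%R].
Proof.
rewrite -openC openE => y /= /negP; rewrite -ltNge => ry.
apply/nbhs_ballP; exists (mdist x y - r)%R; first by rewrite /= subr_gt0.
move=> z /=; rewrite ballEmdist /= => yz; apply/negP; rewrite -ltNge.
have := metric_triangle x z y; rewrite (metric_sym z y); lra.
Qed.

(** An ultrafilter on the closed ball contains one ball of every finite cover by small balls, so it
    is Cauchy and completeness provides its limit. *)
Lemma compact_closed_ball_mdist (complete_X : metric_complete X) (x : X) (r : R) :
  compact [set y | (mdist x y <= r)%R].
Proof.
have [r0|r0] := ltP r 0%R.
  rewrite (_ : mkset _ = set0); first exact: compact0.
  by apply/seteqP; split => // y /= xy; have := mdist_ge0 x y; lra.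
rewrite compact_ultra => F FU FK; have FP : ProperFilter F := @ultra_proper _ _ FU.
have FC : cauchy F.
  rewrite cauchyP => e e0.
  (* The cover is taken of the open ball of radius r + 1, which contains the closed one; its balls
     have radius rho * (r + 1) <= e. *)
  pose rho := (Num.min 1 (e / (r + 1)))%R.
  have rho0 : (0 < rho)%R by rewrite lt_min ltr01/= divr_gt0// ltr_wpDl.
  have [|N /(_ x (r + 1)%R ltac:(lra))[s [_ _ sc]]] := ball_cover _ rho0.
    by rewrite ge_min lexx.
  have : F [set y | exists2 p, p \in s & ball p e y].
    apply: filterS FK => y /= xy; have [|p ps py] := sc y.
      by rewrite ballEmdist /=; lra.
    exists p => //; apply: le_ball py.
    apply: (@le_trans _ _ (e / (r + 1) * (r + 1))%R).
      by rewrite ler_wpM2r ?addr_ge0// ge_min lexx orbT.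
    by rewrite divfK// gt_eqF// ltr_wpDl.
  elim: s {sc} => [F0|p s ih FU'].
    exfalso; apply: (@filter_not_empty _ F _).
    by apply: filterS F0 => y /= [p].
  have [Fp|Fn] := in_ultra_setVsetC (ball p e) FU; first by exists p.
  apply: ih; apply: filterS (filterI FU' Fn) => y [[q]].
  by rewrite inE => /orP[/eqP->//|qs qy _]; exists q.
have [p Fp] := complete_X F (@ultra_proper _ _ FU) FC.
exists p; split => //.
apply: contrapT => nKp; have : nbhs p (~` [set y | (mdist x y <= r)%R]).
  by apply: open_nbhs_nbhs; split => //; rewrite openC; exact: closed_closed_ball_mdist.
by move=> /Fp Fn; have := @filterI _ F FP _ _ FK Fn; rewrite setICr;
  exact: (@filter_not_empty _ F FP).
Qed.

Lemma bounded_finite_cover (complete_X : metric_complete X)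
    (rad : X -> R) (x : X) (r : R) : (forall y, (0 < rad y)%R) ->
  exists s : seq X, ball x r `<=` \big[setU/set0]_(p <- s) ball p (rad p).
Proof.
move=> rad0; have := compact_closed_ball_mdist complete_X x r.
rewrite compact_cover => /(_ _ setT (fun p => ball p (rad p))).
case=> [p _|y _|D _ Dc]; first exact: open_ball.
  by exists y => //; exact: ball_center_subproof.
exists (finmap.enum_fset D) => y; rewrite ballEmdist /= => /ltW /Dc [p pD py].
rewrite -bigcup_seq; exists p => //.
Qed.

(** By compactness finitely many of the given balls cover any ball, and countably many balls exhaust
    X; an empty X offers no centre and is treated apart. *)
Lemma measurable_fun_local {d'} {T : measurableType d'} (complete_X : metric_complete X)
  (f : X -> T) : (forall x, exists2 r : R, (0 < r)%R & measurable_fun (ball x r) f) ->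
  measurable_fun setT f.
Proof.
move=> loc.
have [rad hrad] : {rad : X -> R & forall x, (0 < rad x)%R /\ measurable_fun (ball x (rad x)) f}.
  apply: (@boolp.choice _ _ (fun x s => (0 < s)%R /\ measurable_fun (ball x s) f)) => x.
  by have [r r0 mr] := loc x; exists r.
have ballm (x : X) (r : R) : measurable_fun (ball x r) f.
  have [s sc] := bounded_finite_cover complete_X rad x r (fun y => (hrad y).1).
  have ms : measurable (\big[setU/set0]_(p <- s) ball p (rad p) : set X).
    by apply: bigsetU_measurable => p _; exact: ball_measurable.
  apply: (measurable_funS ms sc); elim: s {ms sc} => [|p s ih].
    by rewrite big_nil; exact: measurable_fun_set0.
  rewrite big_cons measurable_funU//; first by split => //; have [] := hrad p.
    exact: ball_measurable.
  by apply: bigsetU_measurable => q _; exact: ball_measurable.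
have [[x0]|nX] := pselect (inhabited X).
  rewrite (_ : setT = \bigcup_n ball x0 n%:R).
    by apply/measurable_fun_bigcup => // n; exact: ball_measurable.
  apply/seteqP; split => // y _; exists (Num.truncn (mdist x0 y)).+1 => //.
  by rewrite ballEmdist /= truncnS_gt.
rewrite (_ : setT = set0); first exact: measurable_fun_set0.
by apply/seteqP; split => // x _; apply: nX; exact: inhabits.
Qed.

Lemma ge0_integral_setU_le (mu : {measure set X -> \bar R}) (A B : set X) (h : X -> \bar R) :
  measurable A -> measurable B -> measurable_fun setT h -> (forall x, 0 <= h x) ->
  \int[mu]_(x in A `|` B) h x <= \int[mu]_(x in A) h x + \int[mu]_(x in B) h x.
Proof.
move=> mA mB mh h0; have mBA : measurable (B `\` A) by exact: measurableD.
rewrite (_ : A `|` B = A `|` (B `\` A)); last first.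
  apply/seteqP; split => x [Ax|]; [by left| |by left|by move=> []; right].
  by move=> Bx; have [Ax|nAx] := pselect (A x); [left|right].
rewrite ge0_integral_setU//.
- apply: leeD => //; apply: ge0_subset_integral => //; exact: measurable_funTS.
- exact: measurable_funTS.
- by rewrite disj_set2E setDIK.
Qed.

Lemma integral_ball_lty (complete_X : metric_complete X) (h : X -> \bar R) :
  measurable_fun setT h -> (forall x, 0 <= h x) ->
  (forall x, exists2 r : R, (0 < r)%R & \int[omega]_(y in ball x r) h y < +oo) ->
  forall x r, \int[omega]_(y in ball x r) h y < +oo.
Proof.
move=> mh h0 loc x r.
have [rad hrad] : {rad : X -> R & forall x, (0 < rad x)%R /\
    \int[omega]_(y in ball x (rad x)) h y < +oo}.
  apply: (@boolp.choice _ _ (fun x s => (0 < s)%R /\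
    \int[omega]_(y in ball x s) h y < +oo)) => y.
  by have [s s0 ms] := loc y; exists s.
have [s sc] := bounded_finite_cover complete_X rad x r (fun y => (hrad y).1).
have mU t : measurable (\big[setU/set0]_(p <- t) ball p (rad p) : set X).
  by apply: bigsetU_measurable => p _; exact: ball_measurable.
apply: (@le_lt_trans _ _ (\int[omega]_(y in \big[setU/set0]_(p <- s) ball p (rad p)) h y)).
  apply: ge0_subset_integral => //; first exact: ball_measurable.
  exact: measurable_funTS.
elim: s {sc} => [|p s ih]; first by rewrite big_nil integral_set0.
rewrite big_cons; apply: (le_lt_trans (ge0_integral_setU_le _ _ _ _ _ _ mh h0)) => //.
  exact: ball_measurable.
by apply: lte_add_pinfty => //; have [] := hrad p.
Qed.
End geometry.

(** * Integral inequalities on an interval *)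

Section line.
Context {R : realType}.
Local Notation leb := (@lebesgue_measure R).

(** Continuous induction: at the supremum S of the points where P holds, the local hypothesis
    carries P from a point just before S to S, and then past S unless S = b. *)
Lemma itv_induction (a b : R) (P : R -> Prop) : (a <= b)%R -> P a ->
  (forall t, (a <= t <= b)%R -> exists2 e : R, (0 < e)%R &
     forall s t', (a <= s)%R -> (s < t')%R -> (t' <= b)%R ->
       (`|s - t| < e)%R -> (`|t' - t| < e)%R -> P s -> P t') ->
  P b.
Proof.
move=> ab Pa loc.
pose T := [set t | (a <= t <= b)%R /\ P t].
have Ta : T a by split => //; rewrite lexx.
have hsT : has_sup T.
  by split; [exists a|exists b => t [/andP[_]]].
pose S := sup T.
have aS : (a <= S)%R by apply: ub_le_sup => //; exact: hsT.2.
have Sb : (S <= b)%R by apply: ge_sup; [exact: hsT.1|move=> t [/andP[]]].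
have [e e0 he] := loc S (introT andP (conj aS Sb)).
have [s [/andP[ass sb] Ps] Ss] : exists2 s, T s & (S - e < s)%R.
  by apply: sup_adherent.
have sS : (s <= S)%R by apply: ub_le_sup; [exact: hsT.2|split => //; rewrite ass].
have PS : P S.
  have [<-//|sneq] := eqVneq s S.
  apply: (he s S) => //; [by rewrite lt_neqAle sneq| |by rewrite subrr normr0].
  by rewrite ltr_norml; apply/andP; split; lra.
have [<-//|Sneq] := eqVneq S b.
have Slt : (S < b)%R by rewrite lt_neqAle Sneq.
pose t := Num.min b (S + e / 2)%R.
have St : (S < t)%R by rewrite lt_min Slt/= ltrDl divr_gt0.
have tb : (t <= b)%R by rewrite ge_min lexx.
have tS : (t <= S + e / 2)%R by rewrite ge_min lexx orbT.
have : (t <= S)%R.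
  apply: ub_le_sup; first exact: hsT.2.
  split; first by rewrite (le_trans aS (ltW St)).
  apply: (he S t) => //; first by rewrite subrr normr0.
  by rewrite ltr_norml; apply/andP; split; lra.
by rewrite leNgt St.
Qed.

Lemma lebesgue_measure_shift (a : R) (A : set R) : measurable A ->
  pushforward leb ((fun x => x + a)%R : _ -> measurableTypeR R) A = leb A.
Proof.
move=> mA.
have mf : measurable_fun [set: measurableTypeR R]
  ((fun x => x + a)%R : measurableTypeR R -> measurableTypeR R).
  exact: measurable_funD.
apply/esym/lebesgue_measure_unique => //= _ [[s t]] _ <-.
rewrite /pushforward (_ : _ @^-1` _ = `](s - a)%R, (t - a)%R]%classic); last first.
  by apply/seteqP; split => x /=; rewrite !in_itv /= ltrBlDr lerBrDr.
rewrite !lebesgue_measure_itv/= !lte_fin ltrD2r.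
by case: ifP => // _; congr (_%:E); lra.
Qed.

Lemma ge0_integral_itv_shift (f : R -> \bar R) (a s t : R) :
  measurable_fun `[(s + a)%R, (t + a)%R] f ->
  (forall x, 0 <= f x) ->
  \int[leb]_(x in `[(s + a)%R, (t + a)%R]) f x =
  \int[leb]_(x in `[s, t]) f (x + a)%R.
Proof.
move=> mf f0.
rewrite (_ : `[s, t]%classic =
    ((fun x => x + a)%R : _ -> measurableTypeR R) @^-1` `[(s + a)%R, (t + a)%R]); last first.
  by apply/seteqP; split => x /=; rewrite !in_itv /= !lerD2r.
have mphi : measurable_fun [set: measurableTypeR R]
  ((fun x => x + a)%R : measurableTypeR R -> measurableTypeR R).
  exact: measurable_funD.
rewrite -(@ge0_integral_pushforward _ _ _ _ _ _ mphi leb _ f)//=.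
apply: eq_measure_integral => A mA AS; exact/esym/lebesgue_measure_shift.
Qed.

Lemma ge0_integral_itv_split (f : R -> \bar R) (a b c : R) :
  (a <= b)%R -> (b <= c)%R -> measurable_fun `[a, c] f -> (forall x, 0 <= f x) ->
  \int[leb]_(x in `[a, c]) f x =
  \int[leb]_(x in `[a, b]) f x + \int[leb]_(x in `[b, c]) f x.
Proof.
move=> ab bc mf f0.
have E : `[a, c]%classic = `[a, b]%classic `|` `]b, c]%classic.
  apply/seteqP; split => x /=; rewrite !in_itv/=; [|case].
  - by move=> /andP[ax xc]; case: (lerP x b) => xb; [left; rewrite ax|right; rewrite xc].
  - by move=> /andP[ax xb]; apply/andP; split => //; exact: le_trans xb bc.
  - by move=> /andP[bx xc]; apply/andP; split => //; exact: le_trans ab (ltW bx).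
rewrite E ge0_integral_setU//=; last 2 first.
- by rewrite -E.
- by apply/disj_setPS => x /= []; rewrite !in_itv/= => /andP[_ xb] /andP[+ _]; lra.
congr (_ + _); apply: integral_itv_obnd_cbnd.
by apply: measurable_funS mf => //; rewrite E; exact: subsetUr.
Qed.

(** Continuous induction on the bound over [a, t]: additivity of the integral and the triangle
    inequality chain the local bounds. *)
Lemma le_itv_of_local (f : R -> R) (h : R -> \bar R) (a b : R) : (a <= b)%R ->
  measurable_fun `[a, b] h -> (forall x, 0 <= h x) ->
  (forall t, (a <= t <= b)%R -> exists2 e : R, (0 < e)%R &
     forall s t', (a <= s)%R -> (s < t')%R -> (t' <= b)%R ->
       (`|s - t| < e)%R -> (`|t' - t| < e)%R ->
       `|f s - f t'|%:E <= \int[leb]_(x in `[s, t']) h x) ->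
  `|f a - f b|%:E <= \int[leb]_(x in `[a, b]) h x.
Proof.
move=> ab mh h0 loc.
apply: (@itv_induction a b (fun t => (t <= b)%R ->
  `|f a - f t|%:E <= \int[leb]_(x in `[a, t]) h x)) => //.
  by move=> _; rewrite subrr normr0; exact: integral_ge0.
move=> t tab; have [e e0 he] := loc t tab.
exists e => // s t' as_ st' t'b se t'e ih _.
rewrite (@ge0_integral_itv_split _ a s t')//; [|exact: ltW|]; last first.
  apply: measurable_funS mh => // x /=; rewrite !in_itv /= => /andP[-> xt'].
  exact: le_trans xt' t'b.
apply: (@le_trans _ _ (`|f a - f s|%:E + `|f s - f t'|%:E)).
  by rewrite -EFinD lee_fin -[X in `|X|%R](subrKA (f s)) ler_normD.
by apply: leeD; [apply: ih; lra|exact: he].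
Qed.

Lemma ge0_integral_abs_continuous (D : set R) (G : R -> \bar R) (e : R) :
  measurable D -> measurable_fun D G -> (forall x, 0 <= G x) ->
  \int[leb]_(x in D) G x < +oo -> (0 < e)%R ->
  exists2 dl : R, (0 < dl)%R & forall A, measurable A -> A `<=` D ->
    leb A < dl%:E -> \int[leb]_(x in A) G x <= e%:E.
Proof.
move=> mD mG G0 Goo e0.
have iG : leb.-integrable D G.
  apply/integrableP; split => //.
  by under eq_integral do rewrite gee0_abs//.
(* G is integrable, hence finite a.e. on D; the real-valued F lies below it everywhere and agrees
   with it a.e. on D. *)
pose F x : R := fine ((G \_ D) x).
have mGD : measurable_fun setT (G \_ D) by exact/(measurable_restrictT _ _).1.
have GD0 x : 0 <= (G \_ D) x by exact: erestrict_ge0.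
have FG x : (F x)%:E <= (G \_ D) x.
  rewrite /F; have := GD0 x.
  by case: (_ x) => //= r; rewrite leey.
have F0 x : (0 <= F x)%R by rewrite fine_ge0.
have mF : measurable_fun setT (EFin \o F).
  by apply/measurable_EFinP; apply: measurableT_comp => //; exact: measurable_fine.
have iF : leb.-integrable setT (EFin \o F).
  apply/integrableP; split => //.
  apply: (@le_lt_trans _ _ (\int[leb]_x (G \_ D) x)); last by rewrite -integral_mkcond.
  apply: ge0_le_integral => //; first exact: measurableT_comp.
  by move=> x _ /=; rewrite ger0_norm.
have [dl [dl0 hdl]] := integral_normr_continuous iF e0.
exists dl => // A mA AD Adl.
have iFA : leb.-integrable A (EFin \o F) by exact: integrableS iF.
apply: (@le_trans _ _ (\int[leb]_(x in A) (F x)%:E)).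
  apply: ae_ge0_le_integral => //; [exact: measurable_funS mG| |exact: measurable_funTS|].
    by move=> x _; rewrite lee_fin.
  have [|N [mN N0 sub]] := integrable_ae _ iG; first exact: mD.
  exists N; split => // x /= h; apply: sub => /= h'; apply: h => Ax.
  by rewrite /F patchE mem_set; [rewrite fineK//; apply: h'; exact: AD|exact: AD].
have := hdl A mA Adl; rewrite /Rintegral => h.
rewrite -(@fineK _ (\int[leb]_(x in A) (F x)%:E)).
  rewrite lee_fin ltW//; apply: le_lt_trans h.
  by under [X in (_ <= fine X)%R]eq_integral do rewrite ger0_norm//.
exact: integrable_fin_num.
Qed.

(** The set E where G1 <= G2 and its complement F are enclosed in open sets W1 and W2 so tightly
    that the integral of G1 over W1 and that of G2 over W2 exceed those over E and F by at most e /
    2. Every t lies in W1 or W2, and near t the sum h of the two restrictions dominates G1 or G2; so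
    the bound with h holds locally, hence on [a, b]. *)
Lemma le_itv_mine (f : R -> R) (G1 G2 : R -> \bar R) (a b : R) : (a <= b)%R ->
  measurable_fun `[a, b] G1 -> measurable_fun `[a, b] G2 ->
  (forall x, 0 <= G1 x) -> (forall x, 0 <= G2 x) ->
  \int[leb]_(x in `[a, b]) G1 x < +oo -> \int[leb]_(x in `[a, b]) G2 x < +oo ->
  (forall s t, (a <= s)%R -> (s < t)%R -> (t <= b)%R ->
    `|f s - f t|%:E <= \int[leb]_(x in `[s, t]) G1 x) ->
  (forall s t, (a <= s)%R -> (s < t)%R -> (t <= b)%R ->
    `|f s - f t|%:E <= \int[leb]_(x in `[s, t]) G2 x) ->
  `|f a - f b|%:E <= \int[leb]_(x in `[a, b]) mine (G1 x) (G2 x).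
Proof.
move=> ab mG1 mG2 G10 G20 G1oo G2oo f1 f2.
pose D := `[a, b]%classic : set R.
have mD : measurable D by exact: measurable_itv.
pose E := D `&` [set t | G1 t <= G2 t].
have mE : measurable E by exact: measurable_lee.
pose F := D `\` E; have mF : measurable F by exact: measurableD.
have Doo : leb D < +oo by rewrite lebesgue_measure_itv /=; case: ifP => // _; rewrite -EFinB ltry.
have subD A : measurable A -> A `<=` D -> leb A < +oo.
  by move=> mA AD; apply: le_lt_trans Doo; apply: le_measure; rewrite ?inE.
apply/lee_addgt0Pr => e e0; rewrite (splitr e) EFinD.
have e20 : (0 < e / 2)%R by rewrite divr_gt0.
have key (G : R -> \bar R) A : measurable_fun D G -> (forall x, 0 <= G x) ->
    \int[leb]_(x in D) G x < +oo -> measurable A -> A `<=` D ->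
    exists W : set R, [/\ open W, A `<=` W &
      \int[leb]_(x in D) (G \_ W) x <= \int[leb]_(x in A) G x + (e / 2)%:E].
  move=> mG G0 Goo mA AD.
  have [dl dl0 hdl] := ge0_integral_abs_continuous D G (e / 2) mD mG G0 Goo e20.
  have [W [oW AW WA]] := lebesgue_regularity_outer mA (subD _ mA AD) dl0.
  have mW : measurable W by exact: open_measurable.
  exists W; split => //; rewrite -integral_mkcondr.
  rewrite (_ : D `&` W = A `|` ((D `&` W) `\` A)); last first.
    apply/seteqP; split => x [].
    - by move=> Dx Ox; have [Ax|nAx] := pselect (A x); [left|right].
    - by move=> Ax; split; [exact: AD|exact: AW].
    - by move=> [].
  have mB : measurable ((D `&` W) `\` A).
    by apply: measurableD => //; exact: measurableI.
  have sB : (D `&` W) `\` A `<=` D by move=> x [[]].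
  rewrite ge0_integral_setU//; last 2 first.
  - by apply: measurable_funS mG => // x [/AD|/sB].
  - by rewrite disj_set2E setDIK.
  rewrite leeD2l// hdl//; apply: le_lt_trans WA; apply: le_measure; rewrite ?inE//.
    exact: measurableD.
  by move=> x [[]].
have sED : E `<=` D by move=> x [].
have sFD : F `<=` D by move=> x [].
have [W1 [oO1 EO1 h1]] := key G1 E mG1 G10 G1oo mE sED.
have [W2 [oO2 EO2 h2]] := key G2 F mG2 G20 G2oo mF sFD.
pose h x := (G1 \_ W1) x + (G2 \_ W2) x.
have mh1 : measurable_fun D (G1 \_ W1).
  apply/measurable_restrict => //; first exact: open_measurable.
  by apply: measurable_funS mG1 => // x [].
have mh2 : measurable_fun D (G2 \_ W2).
  apply/measurable_restrict => //; first exact: open_measurable.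
  by apply: measurable_funS mG2 => // x [].
have G1O1 x : 0 <= (G1 \_ W1) x by exact: erestrict_ge0.
have G2O2 x : 0 <= (G2 \_ W2) x by exact: erestrict_ge0.
apply: (@le_trans _ _ (\int[leb]_(x in D) h x)).
  apply: le_itv_of_local => //; first exact: emeasurable_funD.
    by move=> x; exact: adde_ge0.
  move=> t tab.
  have loc (W : set R) (G : R -> \bar R) : open W -> W t ->
    (forall s t, (a <= s)%R -> (s < t)%R -> (t <= b)%R ->
      `|f s - f t|%:E <= \int[leb]_(x in `[s, t]) G x) ->
    (forall x, W x -> G x <= h x) -> (forall x, 0 <= G x) ->
    exists2 e : R, (0 < e)%R & forall s t', (a <= s)%R -> (s < t')%R -> (t' <= b)%R ->
       (`|s - t| < e)%R -> (`|t' - t| < e)%R ->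
       `|f s - f t'|%:E <= \int[leb]_(x in `[s, t']) h x.
    move=> oW Wt fG Gh G0; have := open_nbhs_nbhs (conj oW Wt).
    move=> /nbhs_ballP[r /= r0 rW]; exists r => // s t' as_ st tb sr tr.
    apply: (le_trans (fG s t' as_ st tb)); apply: le_integral_ge0 => // x.
    rewrite /= in_itv /= => /andP[sx xt]; apply: Gh; apply: rW; rewrite /ball /=.
    by move: sr tr; rewrite !ltr_norml => /andP[? ?] /andP[? ?]; apply/andP; split; lra.
  have [Et|nEt] := pselect (E t).
    apply: (loc W1 G1) => //; first exact: EO1.
    by move=> x Ox; rewrite /h [X in _ <= X + _]patchE mem_set// leeDl// G2O2.
  apply: (loc W2 G2) => //; first by apply: EO2; split => //; rewrite /D /= in_itv.
  by move=> x Ox; rewrite /h [X in _ <= _ + X]patchE mem_set// leeDr// G1O1.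
rewrite ge0_integralD//; apply: (le_trans (leeD h1 h2)).
rewrite addeACA leeD2r//.
rewrite (_ : `[a, b]%classic = E `|` F); last by rewrite /F setDUK.
rewrite ge0_integral_setU//; last 3 first.
- by rewrite setDUK//; exact: measurable_mine.
- by move=> x _; rewrite le_min G10 G20.
- by rewrite disj_set2E setDIK.
apply: leeD; apply: le_integral_ge0 => // x.
  by move=> [_ /= le12]; rewrite min_l.
move=> [Dx nEx]; rewrite min_r// leNgt; apply/negP => lt; apply: nEx.
by split => //=; exact: ltW.
Qed.
End line.

(** * Borel functions *)

Section line_limit.
Context {R : realType}.

Lemma ge0_integral_ereal_inf_cvg {d} {T : measurableType d} (mu : {measure set T -> \bar R})
    (D : set T) (H : (T -> \bar R)^nat) : measurable D ->
  (forall n, measurable_fun D (H n)) -> (forall n x, 0 <= H n x) ->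
  (forall x, nonincreasing_seq (H ^~ x)) ->
  \int[mu]_(x in D) H 0%N x < +oo ->
  \int[mu]_(x in D) H n x @[n --> \oo] -->
    \int[mu]_(x in D) ereal_inf (range (H ^~ x)).
Proof.
move=> mD mH H0 nH Hoo.
have mi : measurable_fun D (fun x => ereal_inf (range (H ^~ x))).
  have := @measurable_fun_einfs _ _ R D H mH 0%N.
  congr measurable_fun; apply/funext => x; rewrite /einfs /=; congr ereal_inf.
  by apply/seteqP; split => y [n] => [_ <-|]; exists n.
have [|||||] := @dominated_convergence _ _ R mu D mD H
  (fun x => ereal_inf (range (H ^~ x))) (H 0%N) => //.
- by apply/aeW => x _; exact: ereal_nonincreasing_cvgn.
- apply/integrableP; split => //.
  by under eq_integral do rewrite gee0_abs//.
- by apply/aeW => x n _; rewrite gee0_abs//; exact: nH.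
Qed.

End line_limit.

Section borel_functions.
Context {d : measure_display} {R : realType} {X : metricMeasurableType d R}.

(** The sigma-algebra of X may be larger than the Borel one; on this copy of X, Borel functions are
    exactly the measurable functions. *)
Let bX := g_sigma_algebraType [set U : set X | open U].

Lemma borel_nonnegP (g : X -> \bar R) : borel_nonneg g <->
  (forall x, 0 <= g x) /\ measurable_fun setT (g : bX -> \bar R).
Proof.
split=> -[g0 mg]; split => //.
  by move=> _ Y mY; rewrite setTI; exact: mg.
by move=> Y mY; have := mg measurableT Y mY; rewrite setTI.
Qed.

Lemma borel_nonneg_cst (k : R) : (0 <= k)%R -> borel_nonneg ((fun=> k%:E) : X -> \bar R).
Proof. by move=> k0; apply/borel_nonnegP; split => // x; rewrite lee_fin. Qed.

Lemma borel_nonneg_mine (g h : X -> \bar R) : borel_nonneg g -> borel_nonneg h ->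
  borel_nonneg (fun x : X => mine (g x) (h x)).
Proof.
move=> /borel_nonnegP[g0 mg] /borel_nonnegP[h0 mh]; apply/borel_nonnegP; split.
  by move=> x; rewrite le_min g0 h0.
exact: measurable_mine.
Qed.

Lemma borel_nonneg_inf (h : (X -> \bar R)^nat) : (forall n, borel_nonneg (h n)) ->
  borel_nonneg (fun x : X => ereal_inf (range (h ^~ x))).
Proof.
move=> bh; apply/borel_nonnegP; split.
  by move=> x; apply: le_ereal_inf_tmp => _ [n _ <-]; have [] := bh n.
have mh n : measurable_fun setT (h n : bX -> \bar R) by have /borel_nonnegP[] := bh n.
have := @measurable_fun_einfs _ _ R setT (h : (bX -> \bar R)^nat) mh 0%N.
congr measurable_fun; apply/funext => x; rewrite /einfs /=; congr ereal_inf.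
by apply/seteqP; split => y [n] => [_ <-|]; exists n.
Qed.

Lemma borel_nonneg_patch (g : X -> \bar R) (U : set X) : borel_nonneg g -> open U ->
  borel_nonneg (g \_ U).
Proof.
move=> /borel_nonnegP[g0 mg] oU; apply/borel_nonnegP; split.
  by move=> x; exact: erestrict_ge0.
have mU : measurable (U : set bX) by exact: sub_sigma_algebra.
have mgU : measurable_fun (U : set bX) (g : bX -> \bar R) by exact: measurable_funTS.
exact: (measurable_restrictT _ mU).1 mgU.
Qed.

Lemma borel_nonneg_sup (h : (X -> \bar R)^nat) : (forall n, borel_nonneg (h n)) ->
  borel_nonneg (fun x : X => ereal_sup (range (h ^~ x))).
Proof.
move=> bh; have mh n : measurable_fun setT (h n : bX -> \bar R) by have /borel_nonnegP[] := bh n.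
apply/borel_nonnegP; split.
  move=> x; apply: (@le_trans _ _ (h 0%N x)); first by have [] := bh 0%N.
  by apply: ereal_sup_ubound; exists 0%N.
have := @measurable_fun_esups _ _ R setT (h : (bX -> \bar R)^nat) mh 0%N.
congr measurable_fun; apply/funext => x; rewrite /esups /=; congr ereal_sup.
by apply/seteqP; split => y [n] => [_ <-|]; exists n.
Qed.

Lemma borel_nonneg_measurable (openm : forall U : set X, open U -> measurable U)
  (g : X -> \bar R) : borel_nonneg g -> measurable_fun setT g.
Proof.
move=> [g0 mg] _ Y mY; rewrite setTI; move: (mg Y mY).
rewrite /borel; apply: smallest_sub => //.
split => //; [by move=> A mA; rewrite setTD; exact: measurableC|
  move=> F mF; exact: bigcupT_measurable].
Qed.

End borel_functions.

(** * Curves *)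

Section curves.
Context {d : measure_display} {R : realType} {X : metricMeasurableType d R}.
Local Notation leb := (@lebesgue_measure R).

(** The one-point partition of [s, t] already contributes mdist (c s) (c t) to the length, which is
    t - s. *)
Lemma curve_lipschitz (c : curve X) (s t : R) : (0 <= s)%R -> (s <= t)%R ->
  (t <= curve_end c)%R -> (mdist (c s) (c t) <= t - s)%R.
Proof.
move=> s0 st tl; have [<-|neq] := eqVneq s t; first by rewrite mdistxx subrr.
rewrite -lee_fin -(curve_arc_length s0 st tl) /curve_length.
apply: ereal_sup_ubound; exists [:: t].
  by apply: itv_partition1; rewrite lt_neqAle neq.
by rewrite big_ord_recl big_ord0 addr0.
Qed.

Lemma curve_length_shift (f : R -> X) (a s t : R) :
  curve_length (fun x => f (x + a)%R) s t = curve_length f (s + a)%R (t + a)%R.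
Proof.
have part (b s' t' : R) p : itv_partition s' t' p ->
    itv_partition (s' + b)%R (t' + b)%R [seq (x + b)%R | x <- p].
  move=> [ps /eqP lt]; split; last by rewrite (last_map (fun x => x + b)%R) lt.
  rewrite -[(s' + b)%R]/((fun x => x + b)%R s') path_map.
  by apply: sub_path ps => x y /=; rewrite ltrD2r.
have sumE (b t' s' : R) (g : R -> X) p :
    (\sum_(i < size [seq (x + b)%R | x <- p])
      mdist (g (nth (t' + b) ((s' + b)%R :: [seq (x + b)%R | x <- p]) i))
            (g (nth (t' + b) [seq (x + b)%R | x <- p] i)))%R =
    (\sum_(i < size p) mdist (g (nth t' (s' :: p) i + b)) (g (nth t' p i + b)))%R.
  rewrite size_map; apply: eq_bigr => i _.
  rewrite -(map_cons (fun x => x + b)%R) !(nth_map t')//=.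
  by rewrite ltnS ltnW.
rewrite /curve_length; congr ereal_sup; apply/seteqP; split => _ [p hp <-].
  by exists [seq (x + a)%R | x <- p]; [exact: part|rewrite sumE].
exists [seq (x + - a)%R | x <- p].
  by have := part (- a)%R _ _ _ hp; rewrite !addrK.
rewrite -[in LHS](addrK a s) -[in LHS](addrK a t)
  (sumE (- a)%R (t + a)%R (s + a)%R (fun x => f (x + a)%R)).
by congr (_%:E); apply: eq_bigr => i _; rewrite !subrK.
Qed.

Lemma subcurve_arc_length (c : curve X) (s t : R) : (0 <= s)%R -> (t <= curve_end c)%R ->
  forall a b : R, (0 <= a)%R -> (a <= b)%R -> (b <= t - s)%R ->
    curve_length (fun x => c (x + s)%R) a b = (b - a)%:E.
Proof.
move=> s0 tl a b a0 ab bts; rewrite curve_length_shift curve_arc_length; [|lra..].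
by congr (_%:E); lra.
Qed.

Definition subcurve (c : curve X) (s t : R) (s0 : (0 <= s)%R) (st : (s < t)%R)
    (tl : (t <= curve_end c)%R) : curve X :=
  @Curve R X (t - s)%R (fun x => c (x + s)%R)
    (etrans (subr_gt0 s t) st) (subcurve_arc_length c s t s0 tl).

(** A curve takes junk values outside [0, l]; composed with this retraction it becomes 1-Lipschitz
    on the whole line, so preimages of open sets are open. *)
Definition clamp (l x : R) : R := Num.min (Num.max x 0%R) l.

Lemma clamp_lipschitz (l x y : R) : (x <= y)%R -> (0 <= l)%R ->
  [/\ 0 <= clamp l x, clamp l x <= clamp l y, clamp l y <= l &
      clamp l y - clamp l x <= y - x]%R.
Proof.
move=> xy l0; rewrite /clamp /Order.min /Order.max.
by case: (ltP x 0%R); case: (ltP y 0%R); case: (ltP 0%R l); case: (ltP x l);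
  case: (ltP y l) => *; split; lra.
Qed.

Lemma open_preimage_curve (c : curve X) (U : set X) : open U ->
  open [set x | U (c (clamp (curve_end c) x))].
Proof.
have l0 := ltW (curve_end_gt0 c).
have lip x y : (x <= y)%R ->
    (mdist (c (clamp (curve_end c) x)) (c (clamp (curve_end c) y)) <= y - x)%R.
  move=> xy; have [h1 h2 h3 h4] := clamp_lipschitz _ _ _ xy l0.
  exact: le_trans (curve_lipschitz _ _ _ h1 h2 h3) h4.
rewrite !openE => oU x /= /oU /nbhs_ballP[e /= e0 eU].
apply/nbhs_ballP; exists e => // y; rewrite /ball /= => xy.
apply: eU; rewrite ballEmdist /=; apply: le_lt_trans xy.
case: (leP x y) => xy; last rewrite metric_sym.
  by rewrite distrC ger0_norm ?subr_ge0// lip.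
by rewrite ger0_norm ?subr_ge0 ?lip// ltW.
Qed.

Lemma measurable_curve_comp (c : curve X) (g : X -> \bar R) : borel_nonneg g ->
  measurable_fun `[0%R, curve_end c] (g \o c).
Proof.
move=> [g0 mg].
have mB B : borel B -> measurable [set x | B (c (clamp (curve_end c) x))].
  rewrite /borel; move: B; apply: smallest_sub.
    split; first by rewrite (_ : mkset _ = set0).
    - move=> A mA; rewrite setTD; exact: measurableC.
    - by move=> F mF; exact: bigcupT_measurable.
  by move=> U oU /=; apply: open_measurable; exact: open_preimage_curve.
move=> _ Y mY.
rewrite (_ : _ `&` _ = `[0%R, curve_end c]%classic `&`
   [set x | (g @^-1` Y) (c (clamp (curve_end c) x))]).
  by apply: measurableI => //; apply: mB; exact: mg.
apply/seteqP; split => x /=; rewrite in_itv /= => -[/andP[x0 xl] h];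
  move: h; rewrite /clamp max_l// min_l// => h; split => //; exact/andP.
Qed.

Lemma ge0_measurable_curve_itv (c : curve X) (g : X -> \bar R) (s t : R) :
  borel_nonneg g -> (0 <= s)%R -> (t <= curve_end c)%R ->
  measurable_fun `[s, t] (fun x => g (c x)).
Proof.
move=> bg s0 tl; apply: measurable_funS (measurable_curve_comp c _ bg) => //.
by move=> x /=; rewrite !in_itv /= => /andP[sx xt]; rewrite (le_trans s0)// (le_trans xt).
Qed.

Lemma line_integral_subcurve (c : curve X) (g : X -> \bar R) (s t : R)
    (s0 : (0 <= s)%R) (st : (s < t)%R) (tl : (t <= curve_end c)%R) :
  borel_nonneg g ->
  line_integral (subcurve c s t s0 st tl) g = \int[leb]_(x in `[s, t]) g (c x).
Proof.
move=> bg; rewrite /line_integral /=.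
rewrite -(@ge0_integral_itv_shift _ (fun x => g (c x)) s 0%R (t - s)%R).
- by rewrite add0r subrK.
- by rewrite add0r subrK; exact: ge0_measurable_curve_itv.
- by move=> x; have [] := bg.
Qed.

Lemma itv_integral_le_line (c : curve X) (g : X -> \bar R) (s t : R) :
  (0 <= s)%R -> (t <= curve_end c)%R -> borel_nonneg g ->
  \int[leb]_(x in `[s, t]) g (c x) <= line_integral c g.
Proof.
move=> s0 tl bg; apply: ge0_subset_integral => //=.
- exact: measurable_curve_comp.
- by move=> x _; have [] := bg.
- by move=> x /=; rewrite !in_itv /= => /andP[sx xt]; rewrite (le_trans s0)// (le_trans xt).
Qed.

Lemma le_line_integral (c : curve X) (g h : X -> \bar R) : borel_nonneg g ->
  (forall x, curve_image c x -> g x <= h x) -> line_integral c g <= line_integral c h.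
Proof.
move=> [g0 _] gh; apply: le_integral_ge0 => // x xl; apply: gh.
by exists x.
Qed.

(** The upper gradient inequality on every subarc. Unlike the one at the endpoints, it can be
    localized, and on curves with finite line integrals it passes to minima and infima. *)
Definition subcurve_ineq (u : X -> R) (g : X -> \bar R) (c : curve X) : Prop :=
  forall s t, (0 <= s)%R -> (s < t)%R -> (t <= curve_end c)%R ->
    `|u (c s) - u (c t)|%:E <= \int[leb]_(x in `[s, t]) g (c x).

Lemma subcurve_ineq_upper_gradient (u : X -> R) (g : X -> \bar R) (c : curve X) :
  subcurve_ineq u g c -> upper_gradient_ineq u g c.
Proof. by move=> h; apply: h => //; exact: curve_end_gt0. Qed.

Lemma subcurve_ineq_mine (u : X -> R) (g h : X -> \bar R) (c : curve X) :
  borel_nonneg g -> borel_nonneg h ->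
  line_integral c g < +oo -> line_integral c h < +oo ->
  subcurve_ineq u g c -> subcurve_ineq u h c ->
  subcurve_ineq u (fun x => mine (g x) (h x)) c.
Proof.
move=> bg bh goo hoo ug uh s t s0 st tl.
have [g0 _] := bg; have [h0 _] := bh.
apply: (@le_itv_mine _ (fun x => u (c x)) (fun x => g (c x)) (fun x => h (c x))).
- exact: ltW.
- exact: ge0_measurable_curve_itv.
- exact: ge0_measurable_curve_itv.
- by move=> x.
- by move=> x.
- by apply: le_lt_trans goo; exact: itv_integral_le_line.
- by apply: le_lt_trans hoo; exact: itv_integral_le_line.
- by move=> a b sa ab bt; apply: ug => //; [exact: le_trans sa|exact: le_trans tl].
- by move=> a b sa ab bt; apply: uh => //; [exact: le_trans sa|exact: le_trans tl].
Qed.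

(** Replaces a sequence by a nonincreasing one with the same infimum, so that dominated convergence
    applies along a curve. *)
Fixpoint running_min (h : (X -> \bar R)^nat) (n : nat) : X -> \bar R :=
  if n is m.+1 then fun x => mine (running_min h m x) (h m.+1 x) else h 0%N.

Lemma running_min_borel h n : (forall n, borel_nonneg (h n)) ->
  borel_nonneg (running_min h n).
Proof.
by move=> bh; elim: n => [|n ih]; [exact: bh|exact: borel_nonneg_mine].
Qed.

Lemma running_min_le h n x : running_min h n x <= h n x.
Proof. by case: n => //= n; rewrite ge_min lexx orbT. Qed.

Lemma running_min_noninc h x : nonincreasing_seq (running_min h ^~ x).
Proof. by apply/nonincreasing_seqP => n /=; rewrite ge_min lexx. Qed.

Lemma running_min_inf h x :
  ereal_inf (range (running_min h ^~ x)) = ereal_inf (range (h ^~ x)).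
Proof.
apply/eqP; rewrite eq_le; apply/andP; split.
  apply: le_ereal_inf_tmp => _ [n _ <-]; apply: ge_ereal_inf.
  by exists (running_min h n x); [exists n|exact: running_min_le].
apply: le_ereal_inf_tmp => _ [n _ <-].
elim: n => [|n ih] /=; first by apply: ereal_inf_lbound; exists 0%N.
by rewrite le_min ih; apply: ereal_inf_lbound; exists n.+1.
Qed.

Lemma subcurve_ineq_inf (u : X -> R) (h : (X -> \bar R)^nat) (c : curve X) :
  (forall n, borel_nonneg (h n)) -> (forall n, line_integral c (h n) < +oo) ->
  (forall n, subcurve_ineq u (h n) c) ->
  subcurve_ineq u (fun x => ereal_inf (range (h ^~ x))) c.
Proof.
move=> bh hoo uh s t s0 st tl.
have bm n : borel_nonneg (running_min h n) by exact: running_min_borel.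
have moo n : line_integral c (running_min h n) < +oo.
  apply: le_lt_trans (hoo n); apply: le_line_integral => // x _.
  exact: running_min_le.
have um n : subcurve_ineq u (running_min h n) c.
  elim: n => [|n ih]; first exact: uh.
  by apply: subcurve_ineq_mine.
under eq_integral do rewrite -running_min_inf.
have H := @ge0_integral_ereal_inf_cvg R _ _ leb `[s, t] (fun n x => running_min h n (c x)).
have {}H := H (measurable_itv _) (fun n => ge0_measurable_curve_itv c _ s t (bm n) s0 tl).
have {}H := H (fun n x => (bm n).1 (c x)) (fun x => running_min_noninc h (c x)).
have {}H := H (le_lt_trans (itv_integral_le_line c _ s t s0 tl (bm 0%N)) (moo 0%N)).
rewrite -(cvg_lim _ H)//; apply: lime_ge; first by apply/cvg_ex; eexists; exact: H.
apply: nearW => n.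
exact: um.
Qed.

End curves.

(** * Modulus and locality *)

Section locality.
Context {d : measure_display} {R : realType} {X : metricMeasurableType d R}.
Local Notation leb := (@lebesgue_measure R).

(* u vanishes at the first and at the last exit time of c from U, so only the
   two end pieces of c count, and these lie in U. *)
Lemma upper_gradient_ineq_patch (u : X -> R) (g : X -> \bar R) (U : set X) (c : curve X) :
  borel_nonneg g -> open U -> (forall x, ~ U x -> u x = 0%R) ->
  subcurve_ineq u g c -> upper_gradient_ineq u (g \_ U) c.
Proof.
move=> bg oU u0 ug; set l := curve_end c.
have l0 : (0 < l)%R by exact: curve_end_gt0.
have [g0 _] := bg.
have bgU := borel_nonneg_patch _ _ bg oU.
(* The endpoints may lie outside U, where the restricted function vanishes; they form a null set, so
   the open interval suffices. *)
have gE s t : (0 <= s)%R -> (t <= l)%R -> (forall x, (s < x < t)%R -> U (c x)) ->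
    \int[leb]_(x in `[s, t]) g (c x) = \int[leb]_(x in `]s, t[) (g \_ U) (c x).
  move=> s0 tl sU.
  have mg : measurable_fun `]s, t[ (fun x => g (c x)).
    apply: measurable_funS (ge0_measurable_curve_itv c _ s t bg s0 tl) => //.
    by move=> x /=; rewrite !in_itv /= => /andP[/ltW -> /ltW ->].
  rewrite (integral_itv_bndoo _ _ mg); apply: eq_integral => x.
  by rewrite inE /= in_itv /= => /sU Ux; rewrite patchE mem_set.
(* The times spent outside U. [clamp] makes this a closed subset of the line, so it is compact and
   its extreme points t0 and t1 are attained. *)
pose Z := `[0%R, l]%classic `&` ~` [set x | U (c (clamp l x))].
have ZP t : Z t <-> (0 <= t <= l)%R /\ ~ U (c t).
  rewrite /Z /= in_itv /=; split => -[/andP[t0 tl]];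
    by rewrite /clamp max_l// min_l// t0 tl.
have cZ : compact Z.
  apply: (@subclosed_compact _ _ `[0%R, l]%classic); [|exact: segment_compact|by move=> x []].
  apply: closedI; first exact: interval_closed.
  by rewrite closedC; exact: open_preimage_curve.
have [Z0|Zne] := pselect (Z !=set0); last first.
  have UZ x : (0 < x < l)%R -> U (c x).
    move=> /andP[x0 xl]; apply: contrapT => nU; apply: Zne; exists x; apply/ZP.
    by split => //; rewrite (ltW x0) (ltW xl).
  have := ug 0%R l (lexx _) l0 (lexx _); rewrite gE// => /le_trans; apply.
  apply: ge0_subset_integral => //.
  - exact: measurable_curve_comp.
  - by move=> x _; have [] := bgU.
  - by move=> x /=; rewrite !in_itv /= => /andP[/ltW -> /ltW ->].
have cid : {within Z, continuous (idfun : R -> R)}.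
  by apply: continuous_subspaceT => x; exact: cvg_id.
have [t0 /set_mem/ZP[/andP[t00 t0l] nU0] t0min] := compact_EVT_min Z0 cZ cid.
have [t1 /set_mem/ZP[/andP[t10 t1l] nU1] t1max] := compact_EVT_max Z0 cZ cid.
have t01 : (t0 <= t1)%R.
  by apply: t0min; apply/mem_set/ZP; rewrite t10 t1l.
have left_end : `|u (c 0%R)|%:E <= \int[leb]_(x in `]0%R, t0[) (g \_ U) (c x).
  have [t0E|t0n] := eqVneq t0 0%R.
    rewrite u0 ?normr0; first by apply: integral_ge0 => x _; have [] := bgU.
    by rewrite -t0E.
  have t0p : (0 < t0)%R by rewrite lt_neqAle eq_sym t0n.
  have := ug 0%R t0 (lexx _) t0p t0l; rewrite (u0 _ nU0) subr0 gE//.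
  move=> x /andP[x0 xt]; apply: contrapT => nU.
  have /= := t0min x; rewrite leNgt xt => h; have // : false; apply: h.
  by apply/mem_set/ZP; rewrite (ltW x0) (le_trans (ltW xt)).
have right_end : `|u (c l)|%:E <= \int[leb]_(x in `]t1, l[) (g \_ U) (c x).
  have [t1E|t1n] := eqVneq t1 l.
    rewrite u0 ?normr0; first by apply: integral_ge0 => x _; have [] := bgU.
    by rewrite -t1E.
  have t1p : (t1 < l)%R by rewrite lt_neqAle t1n.
  have := ug t1 l t10 t1p (lexx _); rewrite (u0 _ nU1) sub0r normrN gE//.
  move=> x /andP[x0 xt]; apply: contrapT => nU.
  have /= := t1max x; rewrite leNgt x0 => h; have // : false; apply: h.
  by apply/mem_set/ZP; rewrite (ltW xt) (le_trans _ (ltW x0)).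
apply: (@le_trans _ _ (`|u (c 0%R)|%:E + `|u (c l)|%:E)).
  by rewrite -EFinD lee_fin ler_normB.
apply: (le_trans (leeD left_end right_end)).
rewrite -ge0_integral_setU//=.
- apply: ge0_subset_integral => //=.
  + exact: measurableU.
  + exact: measurable_curve_comp.
  + by move=> x _; have [] := bgU.
  + move=> x [] /=; rewrite !in_itv /= => /andP[a b]; apply/andP; split.
    * exact: ltW.
    * exact: le_trans (ltW b) t0l.
    * exact: le_trans t10 (ltW a).
    * exact: ltW.
- apply: measurable_funS (measurable_curve_comp c _ bgU) => //.
  move=> x [] /=; rewrite !in_itv /= => /andP[a b]; apply/andP; split.
  + exact: ltW.
  + exact: le_trans (ltW b) t0l.
  + exact: le_trans t10 (ltW a).
  + exact: ltW.
- by move=> x _; have [] := bgU.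
- by apply/disj_setPS => x /= []; rewrite !in_itv/= => /andP[_ xb] /andP[+ _]; lra.
Qed.

End locality.

Section weak.
Context {d : measure_display} {R : realType} {X : metricMeasurableType d R}.
Context (omega : {measure set X -> \bar R}).
Context (openm : forall U : set X, open U -> measurable U).

Lemma modulus2_ge0 (Gamma : set (curve X)) : 0 <= modulus2 omega Gamma.
Proof.
apply: le_ereal_inf_tmp => _ [rho [[r0 _] _] <-]; apply: integral_ge0 => x _.
by rewrite expe_ge0.
Qed.

Lemma modulus2_eq0P (Gamma : set (curve X)) : modulus2 omega Gamma = 0 <->
  forall e : R, (0 < e)%R -> exists rho : X -> \bar R, [/\ borel_nonneg rho,
    forall c, Gamma c -> 1 <= line_integral c rho &
    \int[omega]_x (rho x) ^+ 2 <= e%:E].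
Proof.
split=> [m0 e e0|h].
  have : modulus2 omega Gamma < e%:E by rewrite m0 lte_fin.
  move=> /ereal_inf_lt[_ [rho [br ar] <-] /ltW re].
  by exists rho.
apply/eqP; rewrite eq_le modulus2_ge0 andbT.
apply/lee_addgt0Pr => e e0; rewrite add0e; have [rho [br ar re]] := h e e0.
by apply: ge_ereal_inf; exists (\int[omega]_x (rho x) ^+ 2) => //; exists rho.
Qed.

(** A density admissible for the curves c' is admissible for the curves c above them; typically c'
    is a subcurve of c. *)
Lemma modulus2_le0 (Gamma Gamma' : set (curve X)) : modulus2 omega Gamma' = 0 ->
  (forall c, Gamma c -> exists2 c', Gamma' c' &
     forall rho, borel_nonneg rho -> line_integral c' rho <= line_integral c rho) ->
  modulus2 omega Gamma = 0.
Proof.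
move=> /modulus2_eq0P h sub; apply/modulus2_eq0P => e e0.
have [rho [br ar re]] := h e e0; exists rho; split => // c /sub[c' Gc' hc'].
exact: le_trans (ar _ Gc') (hc' _ br).
Qed.

Lemma modulus2_subset0 (Gamma Gamma' : set (curve X)) : Gamma `<=` Gamma' ->
  modulus2 omega Gamma' = 0 -> modulus2 omega Gamma = 0.
Proof. by move=> sub m0; apply: (modulus2_le0 _ _ m0) => c /sub Gc; exists c. Qed.

Lemma borel_nonneg_sqr (g : X -> \bar R) : borel_nonneg g ->
  measurable_fun setT (fun x => (g x) ^+ 2).
Proof.
move=> bg; have mg := borel_nonneg_measurable openm _ bg.
by under eq_fun do rewrite expe2; exact: emeasurable_funM.
Qed.

(** The supremum of the chosen densities is admissible for every family at once, and its square is
    at most the sum of their squares, whose integrals are bounded by a geometric series. *)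
Lemma modulus2_bigcup0 (Gamma : (set (curve X))^nat) :
  (forall n, modulus2 omega (Gamma n) = 0) ->
  modulus2 omega (\bigcup_n Gamma n) = 0.
Proof.
move=> h; apply/modulus2_eq0P => e e0.
have H n : exists rho : X -> \bar R, [/\ borel_nonneg rho,
    forall c, Gamma n c -> 1 <= line_integral c rho &
    \int[omega]_x (rho x) ^+ 2 <= (e / (2 ^ n.+1)%:R)%:E].
  by apply: (modulus2_eq0P _).1 => //; rewrite divr_gt0// ltr0n expn_gt0.
have [rho hrho] := boolp.choice H.
have brho n : borel_nonneg (rho n) by have [] := hrho n.
have rho0 n x : 0 <= rho n x by have [] := brho n.
exists (fun x => ereal_sup (range (rho ^~ x))); split.
- exact: borel_nonneg_sup.
- move=> c [n _ Gc]; have [_ /(_ c Gc) h1 _] := hrho n.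
  apply: (le_trans h1); apply: le_line_integral => // x _.
  by apply: ereal_sup_ubound; exists n.
apply: (@le_trans _ _ (\int[omega]_x (\sum_(n <oo) (rho n x) ^+ 2))).
  apply: le_integral_ge0 => x _; first by
    rewrite expe_ge0//; apply: (le_trans (rho0 0%N x)); apply: ereal_sup_ubound; exists 0%N.
  set S := \sum_(_ <oo) _.
  have S0 : 0 <= S by apply: nneseries_ge0 => n _ _; rewrite expe_ge0.
  (* With S written as the square of its root, it remains to bound each term of the supremum by that
     root. *)
  rewrite -(sqr_sqrte S0) lee_sqr ?nnegrE ?sqrte_ge0//; last first.
    by apply: (le_trans (rho0 0%N x)); apply: ereal_sup_ubound; exists 0%N.
  apply: ge_ereal_sup => _ [n _ <-].
  rewrite -(gee0_abs (rho0 n x)) -sqrte_sqr lee_sqrt//.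
  rewrite /S (@nneseriesD1 _ _ n)//; last by move=> k _; rewrite expe_ge0.
  by rewrite leeDl//; apply: nneseries_ge0 => k _ _; rewrite expe_ge0.
rewrite integral_nneseries//; last 2 first.
- by move=> n; exact: borel_nonneg_sqr.
- by move=> n x _; rewrite expe_ge0.
apply: (@le_trans _ _ (\sum_(n <oo) (e / (2 ^ n.+1)%:R)%:E)).
  apply: lee_nneseries => n _; last by have [] := hrho n.
  by move=> _; apply: integral_ge0 => x _; rewrite expe_ge0.
have := @epsilon_trick R (fun=> 0) e xpredT (fun=> lexx _) (ltW e0).
rewrite [X in _ <= X + _ -> _]eseries0// add0e.
by under eq_eseriesr do rewrite add0e.
Qed.

End weak.

(** * Weak upper gradients *)

Section weak_upper_gradients.
Context {d : measure_display} {R : realType} {X : metricMeasurableType d R}.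
Context (omega : {measure set X -> \bar R}).
Context (openm : forall U : set X, open U -> measurable U).
Context (ball_L2 : forall g : X -> \bar R, borel_nonneg g -> loc_L2 omega g ->
  forall x r, \int[omega]_(y in ball x r) (g y) ^+ 2 < +oo).

Lemma borel_nonneg_scale (a : R) (g : X -> \bar R) : (0 <= a)%R -> borel_nonneg g ->
  borel_nonneg (fun x => a%:E * g x).
Proof.
move=> a0 /borel_nonnegP[g0 mg]; apply/borel_nonnegP; split.
  by move=> x; rewrite mule_ge0.
by apply: emeasurable_funM => //; exact: measurable_cst.
Qed.

(** The square of g has finite integral on balls only. Every curve is bounded, hence lies in a ball
    B of a countable exhaustion, and any positive multiple of g restricted to B is admissible for
    the curves in B along which g has infinite integral. *)
Lemma modulus2_integral_pinfty (g : X -> \bar R) : borel_nonneg g -> loc_L2 omega g ->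
  modulus2 omega [set c : curve X | line_integral c g = +oo] = 0.
Proof.
move=> bg Lg; have [g0 _] := bg.
have [[x0]|nX] := pselect (inhabited X); last first.
  apply/modulus2_eq0P => e e0; exists (cst 0); split.
  - exact: (borel_nonneg_cst 0%R (lexx _)).
  - by move=> c _; exfalso; apply: nX; exact: inhabits (c 0%R).
  - by under eq_integral do rewrite expe2 mule0; rewrite integral0 lee_fin ltW.
apply: (@modulus2_subset0 _ _ _ _ _ (\bigcup_n
  [set c : curve X | curve_image c `<=` ball x0 n%:R /\ line_integral c g = +oo])).
  move=> c /= coo; pose n := (Num.truncn (mdist x0 (c 0%R) + curve_end c)).+1.
  exists n => //; split => // _ [t /= tl <-].
  rewrite in_itv /= in tl; case/andP: tl => t0 tl; rewrite ballEmdist /=.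
  apply: (le_lt_trans (metric_triangle _ (c 0%R) _)).
  apply: le_lt_trans (truncnS_gt _); rewrite lerD2l.
  by apply: (le_trans (curve_lipschitz c _ _ (lexx _) t0 tl)); rewrite subr0.
apply: modulus2_bigcup0 => // n; apply/modulus2_eq0P => e e0.
set B := ball x0 n%:R; have oB : open B by exact: open_ball.
have mB : measurable B by exact: openm.
have := ball_L2 g bg Lg x0 n%:R; rewrite -/B.
set I := \int[omega]_(y in B) (g y) ^+ 2 => Ioo.
have I0 : 0 <= I by apply: integral_ge0 => x _; rewrite expe_ge0.
have IE : I = (fine I)%:E by rewrite fineK// ge0_fin_numE.
have fI0 : (0 <= fine I)%R by exact: fine_ge0.
(* Small enough that a ^ 2 times the energy of g on B is at most e, even if that energy is 0. *)
pose a : R := Num.min 1%R (e / (fine I + 1))%R.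
have a0 : (0 < a)%R by rewrite lt_min ltr01 divr_gt0// ltr_wpDl.
have aI : (a ^+ 2 * fine I <= e)%R.
  apply: (@le_trans _ _ (a * (fine I + 1))%R).
    rewrite expr2 -mulrA ler_pM2l// (@le_trans _ _ (fine I))// ?lerDl//.
    by rewrite ler_piMl// ge_min lexx.
  by rewrite -ler_pdivlMr ?ltr_wpDl// ge_min lexx orbT.
have bgB := borel_nonneg_patch _ _ bg oB.
exists (fun x => a%:E * (g \_ B) x); split.
- exact: borel_nonneg_scale (ltW a0) bgB.
- move=> c [cB coo]; rewrite /line_integral ge0_integralZl//=.
  + have -> : \int[lebesgue_measure]_(t in `[0%R, curve_end c]) (g \_ B) (c t) = +oo.
    rewrite -coo /line_integral; apply: eq_integral => t; rewrite inE => tl.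
    by rewrite patchE mem_set//; apply: cB; exists t.
    by rewrite gt0_muley// leey.
  + exact: measurable_curve_comp.
  + by move=> x _; have [] := bgB.
  + by rewrite lee_fin ltW.
- rewrite (_ : \int[omega]_x _ = (a ^+ 2)%:E * I); first by rewrite IE -EFinM lee_fin.
  rewrite /I [in RHS]integral_mkcond -ge0_integralZl//.
  + apply: eq_integral => x _; rewrite !patchE; case: ifPn => _.
      by rewrite !expe2 muleACA -EFinM expr2.
    by rewrite !expe2 !mule0.
  + by apply/(measurable_restrictT _ _).1 => //; apply: measurable_funTS; exact: borel_nonneg_sqr.
  + by move=> x _; apply: erestrict_ge0 => y _; rewrite expe_ge0.
  + by rewrite lee_fin exprn_ge0// ltW.
Qed.

(** A subarc on which the inequality fails is itself an exceptional curve; these form a null family,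
    and so do the curves containing one. *)
Lemma weak_upper_gradient_subcurve (u : X -> R) (g : X -> \bar R) :
  weak_upper_gradient omega u g ->
  modulus2 omega [set c : curve X | ~ subcurve_ineq u g c] = 0.
Proof.
move=> [bg m0]; apply: (modulus2_le0 _ _ _ m0) => c /= nc.
have [s [t [s0 st tl nst]]] : exists s t, [/\ (0 <= s)%R, (s < t)%R,
    (t <= curve_end c)%R &
    ~ `|u (c s) - u (c t)|%:E <= \int[lebesgue_measure]_(x in `[s, t]) g (c x)].
  apply: contrapT => h; apply: nc => s t s0 st tl; apply: contrapT => h'.
  by apply: h; exists s, t.
exists (subcurve c s t s0 st tl).
  rewrite /= /upper_gradient_ineq line_integral_subcurve//=.
  by rewrite add0r subrK.
move=> rho br; rewrite line_integral_subcurve//; exact: itv_integral_le_line.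
Qed.

Lemma weak_upper_gradient_patch (u : X -> R) (g : X -> \bar R) (U : set X) : open U ->
  (forall x, ~ U x -> u x = 0%R) -> weak_upper_gradient omega u g ->
  weak_upper_gradient omega u (g \_ U).
Proof.
move=> oU u0 wg; have [bg _] := wg; split; first exact: borel_nonneg_patch.
apply: modulus2_subset0 (weak_upper_gradient_subcurve _ _ wg) => c /= nc sc.
by apply: nc; exact: upper_gradient_ineq_patch.
Qed.

(** Four null families are discarded: a bad subarc for g or for h, and an infinite line integral of
    g or of h, as the argument on a single curve takes both integrals finite. *)
Lemma weak_upper_gradient_mine (u : X -> R) (g h : X -> \bar R) :
  loc_L2 omega g -> loc_L2 omega h ->
  weak_upper_gradient omega u g -> weak_upper_gradient omega u h ->
  weak_upper_gradient omega u (fun x => mine (g x) (h x)).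
Proof.
move=> Lg Lh wg wh; have [bg _] := wg; have [bh _] := wh.
split; first exact: borel_nonneg_mine.
pose Gam n : set (curve X) := if n is 0%N then [set c | ~ subcurve_ineq u g c]
  else if n is 1%N then [set c | ~ subcurve_ineq u h c]
  else if n is 2%N then [set c | line_integral c g = +oo]
  else [set c | line_integral c h = +oo].
apply: (@modulus2_subset0 _ _ _ _ _ (\bigcup_n Gam n)); last first.
  apply: modulus2_bigcup0 => // -[|[|[|n]]]; rewrite /Gam.
  - exact: weak_upper_gradient_subcurve.
  - exact: weak_upper_gradient_subcurve.
  - exact: modulus2_integral_pinfty.
  - exact: modulus2_integral_pinfty.
move=> c /= nc; apply: contrapT => hc; apply: nc.
apply: subcurve_ineq_upper_gradient; apply: subcurve_ineq_mine => //.
- by rewrite ltey; apply/eqP => coo; apply: hc; exists 2%N.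
- by rewrite ltey; apply/eqP => coo; apply: hc; exists 3%N.
- by apply: contrapT => coo; apply: hc; exists 0%N.
- by apply: contrapT => coo; apply: hc; exists 1%N.
Qed.

Lemma weak_upper_gradient_inf (u : X -> R) (h : (X -> \bar R)^nat) :
  (forall n, loc_L2 omega (h n)) -> (forall n, weak_upper_gradient omega u (h n)) ->
  weak_upper_gradient omega u (fun x => ereal_inf (range (h ^~ x))).
Proof.
move=> Lh wh; have bh n : borel_nonneg (h n) by have [] := wh n.
split; first exact: borel_nonneg_inf.
apply: (@modulus2_subset0 _ _ _ _ _ ((\bigcup_n [set c | ~ subcurve_ineq u (h n) c])
   `|` (\bigcup_n [set c | line_integral c (h n) = +oo]))).
  move=> c /= nc; apply: contrapT => hc; apply: nc.
  apply: subcurve_ineq_upper_gradient; apply: subcurve_ineq_inf => // n.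
  - by rewrite ltey; apply/eqP => coo; apply: hc; right; exists n.
  - by apply: contrapT => coo; apply: hc; left; exists n.
rewrite -bigcup2E; apply: modulus2_bigcup0 => // -[|[|n]]; rewrite /bigcup2 /=.
- by apply: modulus2_bigcup0 => // n; exact: weak_upper_gradient_subcurve.
- by apply: modulus2_bigcup0 => // n; exact: modulus2_integral_pinfty.
- by apply/modulus2_subset0: (modulus2_integral_pinfty _ (bh 0%N) (Lh 0%N)) => c [].
Qed.

Lemma L2_loc_L2 (g : X -> \bar R) : borel_nonneg g ->
  \int[omega]_x (g x) ^+ 2 < +oo -> loc_L2 omega g.
Proof.
move=> bg goo x; exists 1%R => //; apply: le_lt_trans goo.
apply: ge0_subset_integral => //; first exact/openm/open_ball.
- exact: borel_nonneg_sqr.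
- by move=> y _; rewrite expe_ge0//; have [] := bg.
Qed.

Lemma exists_minimal_weak_upper_gradient (u : X -> R) (g0 : X -> \bar R) :
  weak_upper_gradient omega u g0 -> \int[omega]_x (g0 x) ^+ 2 < +oo ->
  exists g, minimal_weak_upper_gradient omega u g.
Proof.
move=> wg0 g0oo.
pose S := [set \int[omega]_x (h x) ^+ 2 | h in [set h | weak_upper_gradient omega u h]].
pose m := ereal_inf S.
have sq0 (h : X -> \bar R) : borel_nonneg h -> 0 <= \int[omega]_x (h x) ^+ 2.
  by move=> [h0 _]; apply: integral_ge0 => x _; rewrite expe_ge0.
have m0 : 0 <= m by apply: le_ereal_inf_tmp => _ [h [bh _] <-]; exact: sq0.
have moo : m < +oo by apply: le_lt_trans g0oo; apply: ereal_inf_lbound; exists g0.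
have mf : m \is a fin_num by rewrite ge0_fin_numE.
have H (n : nat) : exists h, weak_upper_gradient omega u h /\
    \int[omega]_x (h x) ^+ 2 < m + (n.+1%:R^-1)%:E.
  have /ereal_inf_lt[_ [h wh <-] lt] : m < m + (n.+1%:R^-1)%:E.
    by rewrite lteDl// lte_fin invr_gt0.
  by exists h.
have [h hh] := boolp.choice H.
have wh n : weak_upper_gradient omega u (h n) by have [] := hh n.
have bh n : borel_nonneg (h n) by have [] := wh n.
have hlt n : \int[omega]_x (h n x) ^+ 2 < m + (n.+1%:R^-1)%:E by have [] := hh n.
have hoo n : \int[omega]_x (h n x) ^+ 2 < +oo.
  by apply: lt_trans (hlt n) _; rewrite -(fineK mf) -EFinD ltry.
pose g x := ereal_inf (range (h ^~ x)).
have wg : weak_upper_gradient omega u g.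
  by apply: weak_upper_gradient_inf => // n; exact: L2_loc_L2.
have [bg _] := wg; have [g_0 _] := bg.
have gm : \int[omega]_x (g x) ^+ 2 <= m.
  apply/lee_addgt0Pr => e e0.
  have [n ne] : exists n : nat, (n.+1%:R^-1 < e)%R.
    exists (Num.truncn e^-1); rewrite invf_plt ?posrE//; exact: truncnS_gt.
  apply: (le_trans _ (ltW (lt_le_trans (hlt n) _))); last first.
    by rewrite leeD2l// lee_fin ltW.
  apply: le_integral_ge0 => x _; first by rewrite expe_ge0.
  rewrite lee_sqr//; last by have [] := bh n.
  by apply: ereal_inf_lbound; exists n.
have goo : \int[omega]_x (g x) ^+ 2 < +oo by exact: le_lt_trans gm moo.
have Lg : loc_L2 omega g by exact: L2_loc_L2.
exists g; split => // g' wg' Lg'; have [bg' _] := wg'; have [g'0 _] := bg'.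
(* The competitor may have infinite energy, but w <= g has not. As a weak upper gradient w has
   energy at least m, hence the same energy as g, which forces w = g a.e. *)
pose w x := mine (g x) (g' x).
have ww : weak_upper_gradient omega u w by exact: weak_upper_gradient_mine.
have [bw _] := ww; have [w0 _] := bw.
have wle x : (w x) ^+ 2 <= (g x) ^+ 2 by rewrite lee_sqr// ge_min lexx.
have mg2 := borel_nonneg_sqr openm _ bg; have mw2 := borel_nonneg_sqr openm _ bw.
have gw : \int[omega]_x (g x) ^+ 2 <= \int[omega]_x (w x) ^+ 2.
  by apply: (le_trans gm); apply: ereal_inf_lbound; exists w.
have ig : omega.-integrable setT (fun x => (g x) ^+ 2).
  apply/integrableP; split => //.
  by under eq_integral do rewrite gee0_abs ?expe_ge0//.
have split_int E (f : X -> \bar R) : measurable E -> measurable_fun setT f ->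
    (forall x, 0 <= f x) ->
    \int[omega]_x f x = \int[omega]_(x in E) f x + \int[omega]_(x in ~` E) f x.
  move=> mE mf' f0; rewrite -ge0_integral_setU ?setUv//; first exact: measurableC.
  by rewrite disj_set2E setICr.
(* Since w <= g, equality of the total energies localizes to every measurable set: the finite
   contribution of the complement is cancelled. *)
have eqE E : measurable E ->
    \int[omega]_(x in E) (g x) ^+ 2 = \int[omega]_(x in E) (w x) ^+ 2.
  move=> mE; apply/eqP; rewrite eq_le; apply/andP; split; last first.
    by apply: le_integral_ge0 => x _; rewrite ?expe_ge0.
  move: gw goo; rewrite !(split_int E)//; [|by move=> x; rewrite expe_ge0..].
  have : \int[omega]_(x in ~` E) (w x) ^+ 2 <= \int[omega]_(x in ~` E) (g x) ^+ 2.
    by apply: le_integral_ge0 => x _; rewrite ?expe_ge0.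
  set y := \int[omega]_(x in ~` E) (w x) ^+ 2; set q := \int[omega]_(x in ~` E) (g x) ^+ 2.
  set p := \int[omega]_(x in E) (g x) ^+ 2 => yq pq pqoo.
  have y0 : 0 <= y by apply: integral_ge0 => x _; rewrite expe_ge0.
  have p0 : 0 <= p by apply: integral_ge0 => x _; rewrite expe_ge0.
  have yf : y \is a fin_num.
    rewrite ge0_fin_numE//; apply: (le_lt_trans yq); apply: le_lt_trans pqoo.
    by rewrite leeDr.
  by rewrite -(leeD2rE _ _ yf) (le_trans _ pq)// leeD2l.
have ae : ae_eq omega setT (fun x => (g x) ^+ 2) (fun x => (w x) ^+ 2).
  apply: integral_ae_eq => //; first by move=> E _ mE; exact: eqE.
apply: filterS ae => x /(_ I) gwx0; have gwx : (g x) ^+ 2 = (w x) ^+ 2 := gwx0.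
have : g x <= w x by rewrite -lee_sqr// gwx.
by rewrite le_min => /andP[].
Qed.

End weak_upper_gradients.

(** * Weighted integrals *)

Import HBNNSimple.

(** Applied to a normalized function, this passes from the exponent q' of Young's inequality to
    kappa at the cost of an additive 1. *)
Lemma powR_le1D {R : realType} (t a b : R) : (0 <= t)%R -> (0 < a)%R -> (a <= b)%R ->
  (t `^ a <= 1 + t `^ b)%R.
Proof.
move=> t0 a0 ab; case: (leP 1%R t) => t1.
  by rewrite (le_trans (ler_powR t1 ab))// lerDr.
rewrite (@le_trans _ _ 1%R)// ?lerDl ?powR_ge0//.
have E : (1 `^ a = 1 :> R)%R by rewrite powR1.
rewrite -[leRHS]E; apply: ge0_ler_powR; rewrite ?nnegrE//; exact: ltW.
Qed.

Lemma measurable_fun_powR {d} {T : measurableType d} {R : realType} (D : set T)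
    (f : T -> R) (k : R) : measurable_fun D f ->
  measurable_fun D (fun x => ((f x) `^ k)%:E).
Proof.
move=> mf; apply/measurable_EFinP.
by have := @measurableT_comp _ _ _ _ _ _ (fun t : R => (t `^ k)%R) D f (measurable_powR _) mf.
Qed.

Section weighted_young.
Context {d : measure_display} {T : measurableType d} {R : realType}.
Context (mu : {measure set T -> \bar R}) (D : set T) (mD : measurable D).
Context (v : R) (vE : mu D = v%:E) (f V : T -> R) (f0 : forall x, (0 <= f x)%R)
  (V0 : forall x, (0 <= V x)%R) (mf : measurable_fun D f) (mV : measurable_fun D V).
Context (kappa q q' : R) (q1 : (1 < q)%R) (qq' : (q^-1 + q'^-1 = 1)%R)
  (q'k : (q' <= kappa)%R).

Lemma conjugate_gt1 : (1 < q')%R.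
Proof.
have q1_ := q1; have qq'_ := qq'.
have q0 : (0 < q)%R by lra.
have h : (0 < q'^-1)%R.
  have : (q^-1 < 1)%R by rewrite invf_lt1. lra.
have h1 : (q'^-1 < 1)%R.
  have : (0 < q^-1)%R by rewrite invr_gt0. lra.
by move: h1; rewrite invf_lt1// -invr_gt0.
Qed.

(* Young's inequality replaces Hoelder's: the constant 3 is immaterial and
   only upper bounds on the two integrals are needed. *)
Lemma le_integral_mul_gt0 (Q P : R) : (0 < Q)%R -> (0 < P)%R ->
  \int[mu]_(x in D) ((f x) `^ kappa)%:E <= (v * Q `^ kappa)%:E ->
  \int[mu]_(x in D) ((V x) `^ q)%:E <= (v * P `^ q)%:E ->
  \int[mu]_(x in D) (f x * V x)%:E <= (3 * v * Q * P)%:E.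
Proof.
move=> Q0 P0 hf hV.
have q1_ := q1; have qq'_ := qq'; have q'k_ := q'k; have q'1 := conjugate_gt1.
have mfk : measurable_fun D (fun x => ((f x) `^ kappa)%:E).
  exact: measurable_fun_powR.
have mVq : measurable_fun D (fun x => ((V x) `^ q)%:E).
  exact: measurable_fun_powR.
have q0 : (0 < q)%R by lra.
have k0 : (0 < kappa)%R by lra.
(* Young's inequality is applied to f / Q and V / P; the weights a and b undo this normalization.
   Each of the three terms then integrates to at most v * Q * P, whence the constant 3. *)
set a := (Q * P * (Q^-1) `^ kappa)%R; set b := (Q * P * (P^-1) `^ q)%R.
have a0 : (0 <= a)%R by rewrite !mulr_ge0 ?powR_ge0// ltW.
have b0 : (0 <= b)%R by rewrite !mulr_ge0 ?powR_ge0// ltW.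
apply: (@le_trans _ _ (\int[mu]_(x in D) ((Q * P)%:E +
    (a%:E * ((f x) `^ kappa)%:E + b%:E * ((V x) `^ q)%:E)))).
  apply: le_integral_ge0 => x _; first by rewrite lee_fin mulr_ge0.
  rewrite -!EFinM -!EFinD lee_fin.
  have Qi0 : (0 <= Q^-1)%R by rewrite invr_ge0 ltW.
  have Pi0 : (0 <= P^-1)%R by rewrite invr_ge0 ltW.
  have fQ : (0 <= f x * Q^-1)%R by rewrite mulr_ge0.
  have VP : (0 <= V x * P^-1)%R by rewrite mulr_ge0.
  have q'0 : (0 < q')%R by lra.
  have qqC : (q'^-1 + q^-1 = 1)%R by rewrite addrC.
  have := @conjugate_powR R _ _ q' q fQ VP q'0 q0 qqC.
  have h1 := powR_le1D (f x * Q^-1)%R q' kappa fQ q'0 q'k.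
  have h2 : ((f x * Q^-1) `^ q' / q' <= (f x * Q^-1) `^ q')%R.
    by rewrite ler_pdivrMr; [rewrite ler_peMr ?powR_ge0//; lra|lra].
  have h3 : ((V x * P^-1) `^ q / q <= (V x * P^-1) `^ q)%R.
    by rewrite ler_pdivrMr// ler_peMr ?powR_ge0//; lra.
  move=> h4.
  have h5 : (f x * Q^-1 * (V x * P^-1) <= 1 + ((f x * Q^-1) `^ kappa + (V x * P^-1) `^ q))%R.
    by lra.
  have QP : (0 < Q * P)%R by rewrite mulr_gt0.
  rewrite (_ : f x * V x = (Q * P) * (f x * Q^-1 * (V x * P^-1)))%R; last first.
    by field; rewrite !gt_eqF.
  apply: (le_trans (ler_wpM2l (ltW QP) h5)).
  by rewrite !powRM// /a /b le_eqVlt; apply/orP; left; apply/eqP; ring.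
rewrite ge0_integralD//; last 3 first.
- by move=> x _; rewrite lee_fin mulr_ge0// ltW.
- by move=> x _; rewrite adde_ge0// -EFinM lee_fin mulr_ge0// powR_ge0.
- by apply: emeasurable_funD; apply: emeasurable_funM.
rewrite integral_cst// vE ge0_integralD//; last 4 first.
- by move=> x _; rewrite -EFinM lee_fin mulr_ge0// powR_ge0.
- exact: emeasurable_funM.
- by move=> x _; rewrite -EFinM lee_fin mulr_ge0// powR_ge0.
- exact: emeasurable_funM.
rewrite !ge0_integralZl//; try by move=> x _; rewrite lee_fin powR_ge0.
apply: (@le_trans _ _ ((Q * P)%:E * v%:E + (a%:E * (v * Q `^ kappa)%:E + b%:E * (v * P `^ q)%:E))).
  by rewrite leeD2l// leeD// lee_wpmul2l.
rewrite -!EFinM -!EFinD lee_fin.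
have e1 (c t : R) : (0 < c)%R -> (c^-1 `^ t * c `^ t = 1)%R.
  by move=> c0; rewrite -powRM ?invr_ge0 ?(ltW c0)// mulVf ?gt_eqF// powR1.
have -> : (a * (v * Q `^ kappa) = Q * P * v * (Q^-1 `^ kappa * Q `^ kappa))%R by rewrite /a; ring.
have -> : (b * (v * P `^ q) = Q * P * v * (P^-1 `^ q * P `^ q))%R by rewrite /b; ring.
by rewrite !e1// le_eqVlt; apply/orP; left; apply/eqP; ring.
Qed.

(** Q or P may vanish, for instance when the gradient has zero energy; both are increased by a small
    e' before normalizing. *)
Lemma le_integral_mul (Q P : R) : (0 <= v)%R -> (0 <= Q)%R -> (0 <= P)%R ->
  \int[mu]_(x in D) ((f x) `^ kappa)%:E <= (v * Q `^ kappa)%:E ->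
  \int[mu]_(x in D) ((V x) `^ q)%:E <= (v * P `^ q)%:E ->
  \int[mu]_(x in D) (f x * V x)%:E <= (3 * v * Q * P)%:E.
Proof.
move=> v0 Q0 P0 hf hV; apply/lee_addgt0Pr => e e0.
have q1_ := q1; have qq'_ := qq'; have q'k_ := q'k; have q'1 := conjugate_gt1.
(* Since e' <= 1, the increase of 3 * v * Q * P is at most e' * M. *)
pose M : R := (3 * v * (Q + P + 1) + 1)%R.
have M0 : (0 < M)%R by rewrite ltr_wpDl// !mulr_ge0// !addr_ge0.
pose e' : R := Num.min 1%R (e / M)%R.
have e'0 : (0 < e')%R by rewrite lt_min ltr01 divr_gt0.
have e'1 : (e' <= 1)%R by rewrite ge_min lexx.
have e'e : (e' * M <= e)%R by rewrite -ler_pdivlMr// ge_min lexx orbT.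
apply: (@le_trans _ _ (3 * v * (Q + e') * (P + e'))%:E).
  apply: le_integral_mul_gt0; [lra|lra| |].
    apply: (le_trans hf); rewrite lee_fin ler_wpM2l// ge0_ler_powR ?nnegrE//; lra.
  apply: (le_trans hV); rewrite lee_fin ler_wpM2l// ge0_ler_powR ?nnegrE//; lra.
rewrite -EFinD lee_fin.
have h : (v * e' * e' <= v * e')%R by rewrite ler_piMr// mulr_ge0// ltW.
have : (e' * M = 3 * (v * e' * Q) + 3 * (v * e' * P) + 3 * (v * e') + e')%R by rewrite /M; ring.
have -> : (3 * v * (Q + e') * (P + e') =
  3 * v * Q * P + 3 * (v * e' * Q) + 3 * (v * e' * P) + 3 * (v * e' * e'))%R by ring.
lra.
Qed.
End weighted_young.

(* Both sides are lower integrals, so f need not be measurable. *)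
Lemma integral_density_le {d} {T : measurableType d} {R : realType}
    (mu pi : {measure set T -> \bar R}) (V : T -> R) (D : set T) (f : T -> \bar R) :
  (forall x, (0 <= V x)%R) -> measurable_fun setT V -> measurable D ->
  (forall A, measurable A -> pi A = \int[mu]_(x in A) (V x)%:E) ->
  (forall x, D x -> 0 <= f x) ->
  \int[pi]_(x in D) f x <= \int[mu]_(x in D) (f x * (V x)%:E).
Proof.
move=> V0 mV mD piE f0; rewrite (ge0_integralE _ f0).
apply: ge_ereal_sup => _ [h hf <-].
rewrite sintegralE.
(* The pi-integral of a simple function, summed over its level sets, is the mu-integral of h * V;
   moreover h <= f on D, and h = 0 off D. *)
suff E : \sum_(r \in range h) (r%:E * pi (h @^-1` [set r])) = \int[mu]_x ((h x)%:E * (V x)%:E).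
  rewrite [leLHS]E.
  rewrite [leRHS]integral_mkcond; apply: le_integral_ge0 => x _.
    by rewrite -EFinM lee_fin mulr_ge0.
  have := hf x; rewrite !patchE; case: ifPn => _ hx; first by rewrite lee_wpmul2r// lee_fin.
  have -> : h x = 0%R by apply/eqP; rewrite eq_le -lee_fin hx/=.
  by rewrite mul0e.
pose F r x := r%:E * ((V x)%:E * (\1_(h @^-1` [set r]) x)%:E).
have F0 r x : 0 <= F r x.
  rewrite /F indicE; case: (boolP (x \in _)) => [|_]; last by rewrite !mule0.
  by rewrite inE /= => <-; rewrite mule1 -EFinM lee_fin mulr_ge0.
have mA r : measurable (h @^-1` [set r]) by [].
have mVE : measurable_fun setT (EFin \o V) by exact/measurable_EFinP.
have mF0 r : measurable_fun setT (fun x => (V x)%:E * (\1_(h @^-1` [set r]) x)%:E).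
  by apply: emeasurable_funM => //; apply/measurable_EFinP; exact: measurable_indic.
transitivity (\sum_(r \in range h) \int[mu]_x F r x).
  apply: eq_fsbigr => r /set_mem [t _ rE].
  rewrite piE// /F ge0_integralZl//; last 2 first.
  - by move=> x _; rewrite -EFinM lee_fin mulr_ge0.
  - by rewrite -rE lee_fin.
  congr (_ * _); rewrite integral_mkcond; apply: eq_integral => x _.
  by rewrite patchE indicE; case: ifPn => _; rewrite ?mule1 ?mule0.
rewrite -ge0_integral_fsum//; last by move=> r; apply: emeasurable_funM.
apply: eq_integral => x _; rewrite [in RHS]fimfunE -fsumEFin//.
rewrite muleC ge0_mule_fsumr//; last first.
  move=> r; rewrite lee_fin indicE; case: (boolP (x \in _)) => [|_]; last by rewrite mulr0.
  by rewrite inE /= => <-; rewrite mulr1.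
by apply: eq_fsbigr => r _; rewrite /F muleCA EFinM.
Qed.

(** * Sobolev-Poincare inequalities *)

Lemma poweR_inv_le {R : realType} (a : \bar R) (b t : R) : (0 < t)%R -> 0 <= a ->
  (0 <= b)%R -> a `^ (t^-1) <= b%:E -> a <= (b `^ t)%:E.
Proof.
move=> t0 a0 b0 h.
have -> : a = (a `^ (t^-1)) `^ t by rewrite -poweRrM mulVf ?gt_eqF// poweRe1.
rewrite -poweR_EFin; apply: gt0_ler_poweR; rewrite ?in_itv/= ?poweR_ge0 ?leey ?lee_fin ?b0//.
exact: ltW.
Qed.

Lemma powR_sqr_norm {R : realType} (a k : R) :
  (`|a| `^ (2 * k) = (a ^+ 2) `^ k)%R.
Proof. by rewrite powRrM powR_mulrn// real_normK// num_real. Qed.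

(** The square of a + b is at most 4 times the larger of the two squares; convexity of the power is
    not involved. *)
Lemma sqr_le_powR {R : realType} (k a b : R) : (0 <= k)%R ->
  (((a + b) ^+ 2) `^ k <= 4 `^ k * ((a ^+ 2) `^ k + (b ^+ 2) `^ k))%R.
Proof.
move=> k0.
have key (s t : R) : (t ^+ 2 <= s ^+ 2)%R ->
    (((s + t) ^+ 2) `^ k <= 4 `^ k * ((s ^+ 2) `^ k))%R.
  move=> ts; rewrite -powRM ?sqr_ge0//.
  apply: ge0_ler_powR => //; rewrite ?nnegrE;
    [exact: sqr_ge0|by rewrite mulr_ge0 ?sqr_ge0|].
  have h : (0 <= (s - t) ^+ 2)%R by exact: sqr_ge0.
  rewrite (_ : (s + t) ^+ 2 = 2 * (s ^+ 2 + t ^+ 2) - (s - t) ^+ 2)%R; last by ring.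
  lra.
rewrite mulrDr; case: (leP (b ^+ 2)%R (a ^+ 2)%R) => h.
  by rewrite (le_trans (key _ _ h))// lerDl mulr_ge0 ?powR_ge0.
by rewrite addrC (le_trans (key _ _ (ltW h)))// lerDr mulr_ge0 ?powR_ge0.
Qed.

Section estimates.
Context {d : measure_display} {R : realType} {X : metricMeasurableType d R}.
Context (omega : {measure set X -> \bar R}).
Context (openm : forall U : set X, open U -> measurable U).
Context (CD : R) (dbl : forall (x : X) (r : R), (0 < r)%R ->
    [/\ 0 < omega (ball x (2 * r)%R),
        omega (ball x (2 * r)%R) <= CD%:E * omega (ball x r) &
        CD%:E * omega (ball x r) < +oo]).
Context (complete_X : metric_complete X).
Local Notation vol := (ball_volume omega).

Let voE (x : X) (r : R) : (0 < r)%R -> omega (ball x r) = (vol x r)%:E.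
Proof. exact: (volE _ CD dbl). Qed.
Let vo0 (x : X) (r : R) : (0 < r)%R -> (0 < vol x r)%R.
Proof. exact: (vol_gt0 _ CD dbl). Qed.

Lemma eavg_ball (x : X) (r : R) (f : X -> \bar R) : (0 < r)%R ->
  eavg omega (ball x r) f = ((vol x r)^-1)%:E * \int[omega]_(y in ball x r) f y.
Proof. by move=> r0; rewrite /eavg voE// inver gt_eqF// vo0. Qed.

Lemma integral_le_eavg (x : X) (r b : R) (f : X -> \bar R) : (0 < r)%R ->
  eavg omega (ball x r) f <= b%:E ->
  \int[omega]_(y in ball x r) f y <= (vol x r * b)%:E.
Proof.
by move=> r0; rewrite eavg_ball// lee_pdivrMl ?vo0// EFinM.
Qed.

Lemma newtonian_loc_measurable (u : X -> R) : newtonian_loc omega u ->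
  measurable_fun setT u.
Proof.
move=> nu; apply: (measurable_fun_local omega openm CD dbl complete_X) => x.
by have [r r0 [mr _ _]] := nu x; exists r.
Qed.

Lemma loc_L2_ball (g : X -> \bar R) : borel_nonneg g -> loc_L2 omega g ->
  forall x r, \int[omega]_(y in ball x r) (g y) ^+ 2 < +oo.
Proof.
move=> bg Lg; apply: (integral_ball_lty omega openm CD dbl complete_X) => //.
- exact: borel_nonneg_sqr.
- by move=> x; rewrite expe_ge0//; have [] := bg.
Qed.

Lemma integral_sqr_ball (g : X -> \bar R) (x : X) (r : R) :
  borel_nonneg g -> loc_L2 omega g ->
  exists2 J : R, (0 <= J)%R & \int[omega]_(y in ball x r) (g y) ^+ 2 = J%:E.
Proof.
move=> bg Lg; have h := loc_L2_ball g bg Lg x r.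
have h0 : 0 <= \int[omega]_(y in ball x r) (g y) ^+ 2.
  by apply: integral_ge0 => y _; rewrite expe_ge0//; have [] := bg.
exists (fine (\int[omega]_(y in ball x r) (g y) ^+ 2)); first exact: fine_ge0.
by rewrite fineK// ge0_fin_numE.
Qed.

Lemma integral_sqr_subset (g : X -> \bar R) (A B : set X) : borel_nonneg g ->
  measurable A -> measurable B -> A `<=` B ->
  \int[omega]_(y in A) (g y) ^+ 2 <= \int[omega]_(y in B) (g y) ^+ 2.
Proof.
move=> bg mA mB AB; apply: ge0_subset_integral => //.
  by apply: measurable_funTS; exact: borel_nonneg_sqr.
by move=> y _; rewrite expe_ge0//; have [] := bg.
Qed.

(** The Sobolev-Poincare inequality raised to the power 2 * kappa and freed of the average: the form
    in which the squared oscillation enters Young's inequality. *)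
Lemma sobolev_poincare_integral (kappa CS lambdaS : R) : (0 < kappa)%R -> (0 <= CS)%R ->
  (1 <= lambdaS)%R -> sobolev_poincare omega kappa CS lambdaS ->
  forall (x : X) (r J : R) u g, (0 < r)%R -> (0 <= J)%R ->
    newtonian_loc omega u -> minimal_weak_upper_gradient omega u g ->
    \int[omega]_(y in ball x (lambdaS * r)%R) (g y) ^+ 2 <= J%:E ->
    \int[omega]_(y in ball x r) (((u y - mean omega (ball x r) u) ^+ 2) `^ kappa)%:E <=
    (vol x r * ((CS * r) ^+ 2 * (J / vol x (lambdaS * r))) `^ kappa)%:E.
Proof.
move=> k0 CS0 l1 sob x r J u g r0 J0 nu mg hJ.
have lr0 : (0 < lambdaS * r)%R by rewrite mulr_gt0//; lra.
have vl0 := vo0 x _ lr0.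
apply: integral_le_eavg => //.
have h := sob x r u g r0 nu mg.
have -> : (((CS * r) ^+ 2 * (J / vol x (lambdaS * r))) `^ kappa =
    ((CS * r) * (J / vol x (lambdaS * r)) `^ (2^-1)) `^ (2 * kappa))%R.
  rewrite -[in RHS](ger0_norm (x := (_ * _)%R)); last by rewrite !mulr_ge0 ?powR_ge0// ltW.
  have J0v : (0 <= J / vol x (lambdaS * r))%R by rewrite divr_ge0// ltW.
  by rewrite powR_sqr_norm [in RHS]exprMn powR12_sqrt ?sqr_sqrtr.
apply: poweR_inv_le.
- by rewrite mulr_gt0.
- by rewrite eavg_ball// mule_ge0 ?lee_fin ?invr_ge0 ?(ltW (vo0 _ _ r0))//;
    apply: integral_ge0 => y _; rewrite lee_fin powR_ge0.
- by rewrite !mulr_ge0 ?powR_ge0// ltW.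
rewrite (_ : (fun y => _) =
    (fun y => (`|u y - mean omega (ball x r) u| `^ (2 * kappa))%:E)); last first.
  by apply/funext => y; rewrite powR_sqr_norm.
apply: (le_trans h); rewrite [leRHS]EFinM lee_wpmul2l//.
  by rewrite lee_fin mulr_ge0// ltW.
rewrite -poweR_EFin; apply: gt0_ler_poweR.
- by [].
- rewrite in_itv/= leey andbT eavg_ball// mule_ge0 ?lee_fin ?invr_ge0 ?(ltW vl0)//.
  by apply: integral_ge0 => y _; apply: mule_ge0; have [[[]]] := mg.
- by rewrite in_itv/= leey andbT lee_fin divr_ge0// ltW.
rewrite eavg_ball// [(J / _)%R]mulrC [leRHS]EFinM lee_wpmul2l//.
by rewrite lee_fin invr_ge0 ltW.
Qed.
End estimates.

(** * The weighted estimate *)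

Section weighted.
Context {d : measure_display} {R : realType} {X : metricMeasurableType d R}.
Context (omega : {measure set X -> \bar R}).
Context (openm : forall U : set X, open U -> measurable U).
Context (CD : R) (dbl : forall (x : X) (r : R), (0 < r)%R ->
    [/\ 0 < omega (ball x (2 * r)%R),
        omega (ball x (2 * r)%R) <= CD%:E * omega (ball x r) &
        CD%:E * omega (ball x r) < +oo]).
Context (complete_X : metric_complete X).
Context (omega_complete : measure_is_complete omega).
Context (kappa q q' : R) (q1 : (1 < q)%R) (qq' : (q^-1 + q'^-1 = 1)%R)
  (q'k : (q' <= kappa)%R).
Context (V : X -> R) (RH : reverse_holder omega q V) (pi : {measure set X -> \bar R})
  (piE : forall A : set X, measurable A -> pi A = \int[omega]_(x in A) (V x)%:E).
Local Notation vol := (ball_volume omega).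

Let voE (x : X) (r : R) : (0 < r)%R -> omega (ball x r) = (vol x r)%:E.
Proof. exact: (volE _ CD dbl). Qed.
Let vo0 (x : X) (r : R) : (0 < r)%R -> (0 < vol x r)%R.
Proof. exact: (vol_gt0 _ CD dbl). Qed.
Let mball (x : X) (r : R) : measurable (ball x r).
Proof. exact: ball_measurable. Qed.

Let V0 x : (0 <= V x)%R. Proof. by have [] := RH. Qed.

Lemma weight_measurable : measurable_fun setT V.
Proof.
have [_ locV _] := RH.
apply: (measurable_fun_local omega openm CD dbl complete_X) => x.
by have [r r0 /measurable_int/measurable_EFinP mV] := locV x; exists r.
Qed.

Lemma weight_ball (x : X) (r : R) : exists2 p : R, (0 <= p)%R & pi (ball x r) = p%:E.
Proof.
have [_ locV _] := RH.
have h : \int[omega]_(y in ball x r) (V y)%:E < +oo.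
  apply: (integral_ball_lty omega openm CD dbl complete_X (fun y => (V y)%:E)).
  - exact/measurable_EFinP/weight_measurable.
  - by move=> y; rewrite lee_fin.
  - move=> y; have [s s0 /integrableP[_ hs]] := locV y; exists s => //.
    apply: le_lt_trans hs; apply: le_integral_ge0 => z _; first by rewrite lee_fin.
    exact: lee_abs.
have h0 : 0 <= pi (ball x r) by [].
have f : pi (ball x r) \is a fin_num by rewrite ge0_fin_numE// piE.
by exists (fine (pi (ball x r))); [exact: fine_ge0|rewrite fineK].
Qed.

Lemma weighted_integral_le : exists2 C : R, (0 < C)%R &
  forall (x : X) (r p Q : R) (f : X -> R), (0 < r)%R -> (0 <= Q)%R ->
    pi (ball x r) = p%:E -> measurable_fun setT f -> (forall y, (0 <= f y)%R) ->
    \int[omega]_(y in ball x r) ((f y) `^ kappa)%:E <= (vol x r * Q `^ kappa)%:E ->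
    \int[omega]_(y in ball x r) (f y * V y)%:E <= (C * Q * p)%:E.
Proof.
have [_ _ [C0 hC]] := RH.
(* The reverse Hoelder constant comes without a sign. *)
pose C := (`|C0| + 1)%R; have C_gt0 : (0 < C)%R by rewrite ltr_wpDl.
exists (3 * C)%R; first by rewrite mulr_gt0.
move=> x r p Q f r0 Q0 pE mf f0 hf.
have p0 : (0 <= p)%R by rewrite -lee_fin -pE.
have v0 := vo0 x r r0.
have q0 : (0 < q)%R by exact: lt_trans ltr01 q1.
(* By the reverse Hoelder condition P bounds the normalized L^q norm of V on the ball, and vol x r *
   P = C * p brings in the pi-measure. *)
pose P := (C * (p / vol x r))%R.
have P0 : (0 <= P)%R by rewrite mulr_ge0 ?divr_ge0// ltW.
have hV : \int[omega]_(y in ball x r) ((V y) `^ q)%:E <= (vol x r * P `^ q)%:E.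
  apply: (integral_le_eavg omega CD dbl) => //; apply: poweR_inv_le => //.
    rewrite (eavg_ball omega CD dbl)// mule_ge0 ?lee_fin ?invr_ge0 ?(ltW v0)//.
    by apply: integral_ge0 => y _; rewrite lee_fin powR_ge0.
  apply: (le_trans (hC x r r0)); rewrite (eavg_ball omega CD dbl)// -piE// pE -!EFinM.
  rewrite lee_fin /P [(p / _)%R]mulrC; apply: ler_wpM2r.
    by rewrite mulr_ge0// invr_ge0 ltW.
  by rewrite /C (le_trans (ler_norm _))// lerDl.
have mV : measurable_fun (ball x r) V by apply: measurable_funTS; exact: weight_measurable.
have mfB : measurable_fun (ball x r) f by exact: measurable_funTS.
have := @le_integral_mul _ _ _ omega _ (mball x r) _ (voE _ _ r0) f V f0 V0 mfB mV
  kappa q q' q1 qq' q'k Q P (ltW v0) Q0 P0 hf hV.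
move=> /le_trans; apply; rewrite lee_fin /P le_eqVlt; apply/orP; left; apply/eqP.
by field; rewrite gt_eqF.
Qed.

(** The representative is only known to equal u a.e.; completeness of omega makes it measurable. *)
Lemma representative_measurable (u ut : X -> R) : measurable_fun setT u ->
  quasicontinuous_representative omega u ut -> measurable_fun setT ut.
Proof.
move=> mu [_ ae]; apply/measurable_EFinP.
apply: (ae_measurable_fun omega_complete (f := EFin \o u)); last exact/measurable_EFinP.
by apply: filterS ae => x /= + _ => ->.
Qed.

(** Formulated with the density V, so that the a.e. equality with respect to omega applies
    directly. *)
Lemma integral_representative_le (u ut : X -> R) (c : R) (D : set X) : measurable D ->
  measurable_fun setT u -> quasicontinuous_representative omega u ut ->
  \int[omega]_(y in D) ((ut y - c) ^+ 2 * V y)%:E =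
  \int[omega]_(y in D) ((u y - c) ^+ 2 * V y)%:E.
Proof.
move=> mD mu rep; have mut := representative_measurable _ _ mu rep.
have [_ ae] := rep; have mV := weight_measurable.
have mm (w : X -> R) : measurable_fun setT w ->
    measurable_fun D (fun y => ((w y - c) ^+ 2 * V y)%:E).
  move=> mw; apply: measurable_funTS; apply/measurable_EFinP.
  by apply: measurable_funM => //; apply: measurable_funX; apply: measurable_funB.
apply: ge0_ae_eq_integral => //; [exact: mm|exact: mm| | |].
- by move=> y _; rewrite lee_fin mulr_ge0 ?sqr_ge0.
- by move=> y _; rewrite lee_fin mulr_ge0 ?sqr_ge0.
- by apply: filterS ae => y /= -> _.
Qed.

Lemma integral_pi_le (D : set X) (f : X -> R) : measurable D -> (forall y, (0 <= f y)%R) ->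
  \int[pi]_(y in D) (f y)%:E <= \int[omega]_(y in D) (f y * V y)%:E.
Proof.
move=> mD f0; have := @integral_density_le _ _ _ omega pi V D (EFin \o f) V0
  weight_measurable mD piE (fun x _ => f0 x).
by under [X in _ <= X -> _]eq_integral do rewrite -EFinM.
Qed.

Lemma weighted_poincare (CS lambdaS : R) : (0 < CS)%R -> (1 <= lambdaS)%R ->
  sobolev_poincare omega kappa CS lambdaS ->
  exists2 C : R, (0 < C)%R &
    forall (x : X) (r : R) (u ut : X -> R) (g : X -> \bar R),
      (0 < r)%R -> newtonian_loc omega u ->
      quasicontinuous_representative omega u ut ->
      minimal_weak_upper_gradient omega u g ->
      \int[pi]_(y in ball x r) ((ut y - mean omega (ball x r) u) ^+ 2)%:E
      <= C%:E * ((r ^+ 2)%:E * pi (ball x r) / omega (ball x r)) *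
         \int[omega]_(y in ball x (lambdaS * r)%R) (g y) ^+ 2.
Proof.
move=> CS0 l1 sob; have [C C0 hC] := weighted_integral_le.
exists (C * CS ^+ 2)%R; first by rewrite mulr_gt0// exprn_gt0.
move=> x r u ut g r0 nu rep mg.
have k0 : (0 < kappa)%R by exact: lt_trans ltr01 (lt_le_trans (conjugate_gt1 q q' q1 qq') q'k).
have mu := newtonian_loc_measurable omega openm CD dbl complete_X u nu.
have [[bg _] Lg _] := mg.
have [J J0 JE] := integral_sqr_ball omega openm CD dbl complete_X g x (lambdaS * r) bg Lg.
have [p p0 pE] := weight_ball x r.
have lr0 : (r <= lambdaS * r)%R by rewrite ler_peMl// ltW.
have v0 := vo0 x r r0.
have vl : (vol x r <= vol x (lambdaS * r))%R.
  by apply: (le_vol omega openm CD dbl) => //; rewrite mdistxx add0r.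
have := @sobolev_poincare_integral _ _ _ omega CD dbl kappa CS lambdaS k0 (ltW CS0) l1 sob
  x r J u g r0 J0 nu mg.
rewrite JE => /(_ (lexx _)) hS.
set c := mean omega (ball x r) u.
apply: (le_trans (integral_pi_le _ (fun y => ((ut y - c) ^+ 2)%R) (mball x r) _)).
  by move=> y; exact: sqr_ge0.
rewrite (integral_representative_le u)//.
(* The volume of the dilated ball is replaced by the smaller one of the ball itself, which is the
   omega(B) of the conclusion. *)
pose Q := ((CS * r) ^+ 2 * (J / vol x r))%R.
apply: (le_trans (hC x r p Q (fun y => ((u y - c) ^+ 2)%R) r0 _ pE _ _ _)).
- by rewrite /Q mulr_ge0 ?sqr_ge0// divr_ge0// ltW.
- by apply: measurable_funX; apply: measurable_funB.
- by move=> y; exact: sqr_ge0.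
- apply: (le_trans hS); rewrite lee_fin ler_wpM2l ?(ltW v0)//.
  have vl0 : (0 < vol x (lambdaS * r))%R by exact: lt_le_trans v0 vl.
  apply: ge0_ler_powR; rewrite ?nnegrE; first exact: ltW.
  - by apply: mulr_ge0; [exact: sqr_ge0|rewrite divr_ge0// ltW].
  - by apply: mulr_ge0; [exact: sqr_ge0|rewrite divr_ge0// ltW].
  - by rewrite ler_wpM2l ?sqr_ge0// ler_wpM2l// lef_pV2 ?posrE.
rewrite pE voE// inver gt_eqF// -!EFinM lee_fin /Q le_eqVlt; apply/orP; left; apply/eqP.
by field; rewrite gt_eqF.
Qed.

End weighted.

(** * The mixed estimate *)

Section dilation.
Context {d : measure_display} {R : realType} {X : metricMeasurableType d R}.
Context (omega : {measure set X -> \bar R}).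
Context (openm : forall U : set X, open U -> measurable U).
Context (CD : R) (dbl : forall (x : X) (r : R), (0 < r)%R ->
    [/\ 0 < omega (ball x (2 * r)%R),
        omega (ball x (2 * r)%R) <= CD%:E * omega (ball x r) &
        CD%:E * omega (ball x r) < +oo]).
Context (complete_X : metric_complete X).
Local Notation vol := (ball_volume omega).

Let voE (x : X) (r : R) : (0 < r)%R -> omega (ball x r) = (vol x r)%:E.
Proof. exact: (volE _ CD dbl). Qed.
Let vo0 (x : X) (r : R) : (0 < r)%R -> (0 < vol x r)%R.
Proof. exact: (vol_gt0 _ CD dbl). Qed.
Let mball (x : X) (r : R) : measurable (ball x r).
Proof. exact: ball_measurable. Qed.

Lemma integral_bigsetU_le (h : X -> \bar R) (s : seq X) (F : X -> set X) (M : R) :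
  measurable_fun setT h -> (forall y, 0 <= h y) -> (forall p, measurable (F p)) ->
  (0 <= M)%R -> (forall p, p \in s -> \int[omega]_(y in F p) h y <= M%:E) ->
  \int[omega]_(y in \big[setU/set0]_(p <- s) F p) h y <= ((size s)%:R * M)%:E.
Proof.
move=> mh h0 mF M0; elim: s => [_|p s ih hs].
  by rewrite big_nil integral_set0 mul0r.
rewrite big_cons.
have mU : measurable (\big[setU/set0]_(p <- s) F p) by apply: bigsetU_measurable => p0 _.
apply: (le_trans (ge0_integral_setU_le omega _ _ _ (mF p) mU mh h0)).
rewrite -natr1 mulrDl mul1r EFinD addeC; apply: leeD; last first.
  by apply: hs; rewrite inE eqxx.
by apply: ih => q qs; apply: hs; rewrite inE qs orbT.
Qed.

(** Two constants close to u in mean square on B are close to each other; this compares the mean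
    over a small ball with the one over the doubled ball. *)
Lemma integral_sqr_mean_diff (B : set X) (v a b ci c : R) (u : X -> R) :
  measurable B -> measurable_fun setT u -> omega B = v%:E ->
  \int[omega]_(y in B) ((u y - ci) ^+ 2)%:E <= a%:E ->
  \int[omega]_(y in B) ((u y - c) ^+ 2)%:E <= b%:E ->
  ((ci - c) ^+ 2 * v <= 2 * a + 2 * b)%R.
Proof.
move=> mB mu vE ha hb; rewrite -lee_fin.
have mm (k : R) : measurable_fun B (fun y => ((u y - k) ^+ 2)%:E).
  apply: measurable_funTS; apply/measurable_EFinP; apply: measurable_funX.
  exact: measurable_funB.
have -> : ((ci - c) ^+ 2 * v)%:E = \int[omega]_(y in B) ((ci - c) ^+ 2)%:E.
  by rewrite integral_cst// vE.
apply: (@le_trans _ _ (\int[omega]_(y in B)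
   (2%:E * ((u y - ci) ^+ 2)%:E + 2%:E * ((u y - c) ^+ 2)%:E))).
  apply: le_integral_ge0 => y _; first by rewrite lee_fin sqr_ge0.
  rewrite -!EFinM -EFinD lee_fin.
  have h : (0 <= (2 * u y - ci - c) ^+ 2)%R by exact: sqr_ge0.
  rewrite (_ : (ci - c) ^+ 2 = 2 * (u y - ci) ^+ 2 + 2 * (u y - c) ^+ 2
    - (2 * u y - ci - c) ^+ 2)%R; last by ring.
  lra.
rewrite ge0_integralD//; last 4 first.
- by move=> y _; rewrite -EFinM lee_fin mulr_ge0// sqr_ge0.
- by apply: emeasurable_funM.
- by move=> y _; rewrite -EFinM lee_fin mulr_ge0// sqr_ge0.
- by apply: emeasurable_funM.
rewrite !ge0_integralZl//; [|by move=> y _; rewrite lee_fin sqr_ge0..].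
by rewrite [leRHS]EFinD; apply: leeD; rewrite [leRHS]EFinM lee_wpmul2l//.
Qed.

(* Covering a ball by balls of radius r / lambdaS trades the dilation lambdaS of
   the Sobolev-Poincare inequality for that of the (2,2)-Poincare inequality. *)
Lemma oscillation_small_dilation (kappa CS lambdaS lambda2 C2 Lambda : R) :
  (0 < kappa)%R -> (0 < CS)%R -> (1 <= lambdaS)%R ->
  sobolev_poincare omega kappa CS lambdaS ->
  (1 <= lambda2)%R -> (0 < C2)%R -> poincare22 omega C2 lambda2 ->
  (8 * lambda2 + 8 <= Lambda)%R ->
  exists2 K : R, (0 < K)%R & forall (x : X) (r J : R) (u : X -> R) (g : X -> \bar R),
    (0 < r)%R -> (0 <= J)%R -> newtonian_loc omega u ->
    minimal_weak_upper_gradient omega u g ->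
    \int[omega]_(y in ball x (Lambda * r)%R) (g y) ^+ 2 <= J%:E ->
    exists c : R,
      \int[omega]_(y in ball x r) (((u y - c) ^+ 2) `^ kappa)%:E <=
        (vol x r * (K * (r ^+ 2 * (J / vol x r))) `^ kappa)%:E /\
      \int[omega]_(y in ball x r) ((u y - c) ^+ 2)%:E <= (K * (r ^+ 2 * J))%:E.
Proof.
move=> k0 CS0 l1 sob l21 C20 poi La.
(* A small ball dilated by [lambdaS] then has radius exactly r, so it stays within ball x (2 *
   r). *)
pose rho : R := (lambdaS^-1)%R.
have lS0 : (0 < lambdaS)%R by lra.
have rho0 : (0 < rho)%R by rewrite invr_gt0.
have rho1 : (rho <= 1)%R by rewrite invf_le1.
have [N hN] := ball_cover omega openm CD dbl rho rho0 rho1.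
have [K1 K10 hK1] := vol_compare omega openm CD dbl 2%R.
have [K2 K20 hK2] := vol_compare omega openm CD dbl (2 / rho)%R.
(* The first entry is for the oscillation on a small ball, the second for the squared difference of
   means: 10 = 2 * 1 + 2 * 4, where 4 comes from the radius 2 * r. *)
pose Kp : R := Num.max (CS ^+ 2 * K1)%R (10 * C2 * K2)%R.
have Kp0 : (0 < Kp)%R by rewrite lt_max mulr_gt0// exprn_gt0.
(* The number of balls, their volume relative to ball x r, and the loss in splitting u - c into two
   terms with the same bound. *)
pose A : R := (N.+1%:R * K1 * (4 `^ kappa * 2))%R.
have A0 : (0 < A)%R by rewrite !mulr_gt0// powR_gt0.
(* The root lets A move inside the power kappa; the second entry serves the mean-square bound. *)
pose K : R := Num.max (A `^ (kappa^-1) * Kp)%R (4 * C2)%R.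
have K0 : (0 < K)%R by rewrite lt_max mulr_gt0 ?powR_gt0.
exists K => // x r J u g r0 J0 nu mg hJ.
have [[bg _] Lg _] := mg.
have mu := newtonian_loc_measurable omega openm CD dbl complete_X u nu.
have v0 := vo0 x r r0.
have r20 : (0 < 2 * r)%R by rewrite mulr_gt0.
(* The doubled ball is used because the small balls covering ball x r may stick out of it. *)
pose c := mean omega (ball x (2 * r)%R) u.
have gsub p s : (0 < s)%R -> (mdist x p + s <= Lambda * r)%R ->
    \int[omega]_(y in ball p s) (g y) ^+ 2 <= J%:E.
  move=> s0 h; apply: le_trans hJ; apply: integral_sqr_subset => //.
  exact: subset_ball.
have Lr : ((8 * lambda2 + 8) * r <= Lambda * r)%R by rewrite ler_wpM2r// ltW.
have l2r : (r <= lambda2 * r)%R by rewrite ler_peMl// ltW.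
have h2B : \int[omega]_(y in ball x (2 * r)%R) ((u y - c) ^+ 2)%:E <= (4 * C2 * (r ^+ 2 * J))%:E.
  apply: (le_trans (poi x (2 * r)%R u g r20 nu mg)).
  have -> : (4 * C2 * (r ^+ 2 * J))%:E = (C2 * (2 * r) ^+ 2)%:E * J%:E.
    by rewrite -EFinM; congr (_%:E); ring.
  apply: lee_wpmul2l; first by rewrite lee_fin mulr_ge0 ?sqr_ge0// ltW.
  by apply: gsub; [rewrite !mulr_gt0//; lra|rewrite mdistxx; lra].
have msq (k : R) : measurable_fun setT (fun y => ((u y - k) ^+ 2)%R).
  by apply: measurable_funX; exact: measurable_funB.
have mE (k : R) D : measurable_fun D (fun y => ((u y - k) ^+ 2)%:E).
  by apply: measurable_funTS; apply/measurable_EFinP.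
have mK (k : R) D : measurable_fun D (fun y => (((u y - k) ^+ 2) `^ kappa)%:E).
  by apply: measurable_funTS; exact: measurable_fun_powR.
pose Q : R := (Kp * (r ^+ 2 * (J / vol x r)))%R.
have Q0 : (0 <= Q)%R by rewrite /Q !mulr_ge0 ?invr_ge0 ?sqr_ge0// ltW.
have rr0 : (0 < rho * r)%R by rewrite mulr_gt0.
have rrr : (rho * r <= r)%R by rewrite ler_piMl// ltW.
have piece p : (mdist x p < r)%R ->
    \int[omega]_(y in ball p (rho * r)%R) (((u y - c) ^+ 2) `^ kappa)%:E <=
    (K1 * vol x r * (4 `^ kappa * 2) * Q `^ kappa)%:E.
  move=> xp.
  have vi0 := vo0 p _ rr0.
  pose ci := mean omega (ball p (rho * r)%R) u.
  have lrr : (lambdaS * (rho * r) = r)%R by rewrite mulrA divff ?mul1r// gt_eqF.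
  have vp0 := vo0 p r r0.
  have e1 : (vol x r <= K1 * vol p r)%R.
    by apply: hK1 => //; rewrite (metric_sym p); lra.
  have e2 : (vol x r <= K2 * vol p (rho * r))%R.
    apply: hK2 => //; rewrite mulrA divfK ?gt_eqF// (metric_sym p); lra.
  have e3 : (vol p (rho * r) <= K1 * vol x r)%R.
    by apply: hK1 => //; lra.
  have i1 : \int[omega]_(y in ball p (rho * r)%R) (((u y - ci) ^+ 2) `^ kappa)%:E <=
      (vol p (rho * r) * Q `^ kappa)%:E.
    have := @sobolev_poincare_integral _ _ _ omega CD dbl kappa CS lambdaS k0 (ltW CS0) l1 sob
      p (rho * r)%R J u g rr0 J0 nu mg.
    rewrite lrr => h; apply: le_trans (h _) _; first by apply: gsub => //; lra.
    rewrite lee_fin ler_wpM2l ?(ltW vi0)//; 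
      apply: ge0_ler_powR; rewrite ?nnegrE//; first exact: ltW.
      by apply: mulr_ge0; [exact: sqr_ge0|rewrite divr_ge0// ltW].
    apply: (@le_trans _ _ ((CS ^+ 2 * K1) * (r ^+ 2 * (J / vol x r)))%R); last first.
      apply: ler_wpM2r; last by rewrite le_max lexx.
      by rewrite !mulr_ge0 ?invr_ge0 ?sqr_ge0// ltW.
    have h1 : ((CS * (rho * r)) ^+ 2 <= CS ^+ 2 * r ^+ 2)%R.
      by rewrite -exprMn ler_sqr ?nnegrE ?ler_wpM2l ?mulr_ge0// ltW.
    have h2 : (J / vol p r <= K1 * (J / vol x r))%R.
      rewrite mulrCA ler_wpM2l// ler_pdivlMr// mulrC ler_pdivrMr//.
    apply: (le_trans (ler_pM _ _ h1 h2)); [exact: sqr_ge0|by rewrite divr_ge0// ltW|].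
    by rewrite le_eqVlt; apply/orP; left; apply/eqP; ring.
  have i2 : ((ci - c) ^+ 2 <= Q)%R.
    have := @integral_sqr_mean_diff (ball p (rho * r)%R) (vol p (rho * r)) (C2 * (r ^+ 2 * J))
      (4 * C2 * (r ^+ 2 * J)) ci c u (mball _ _) mu (voE _ _ rr0).
    move=> h; have {}h : ((ci - c) ^+ 2 * vol p (rho * r) <=
        2 * (C2 * (r ^+ 2 * J)) + 2 * (4 * C2 * (r ^+ 2 * J)))%R.
      apply: h.
        apply: (le_trans (poi p (rho * r)%R u g rr0 nu mg)).
        apply: (@le_trans _ _ ((C2 * (rho * r) ^+ 2)%:E * J%:E)).
          apply: lee_wpmul2l; first by rewrite lee_fin mulr_ge0 ?sqr_ge0// ltW.
          apply: gsub; first by rewrite mulr_gt0//; lra.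
          have : (lambda2 * (rho * r) <= lambda2 * r)%R by rewrite ler_wpM2l//; lra.
          lra.
        rewrite -EFinM lee_fin -mulrA ler_wpM2l ?(ltW C20)// ler_wpM2r//.
        by rewrite ler_sqr ?nnegrE// ltW.
      apply: le_trans h2B; apply: ge0_subset_integral => //.
        by move=> y _; rewrite lee_fin sqr_ge0.
      by apply: subset_ball; lra.
    apply: (@le_trans _ _ ((10 * C2 * K2) * (r ^+ 2 * (J / vol x r)))%R); last first.
      apply: ler_wpM2r; last by rewrite le_max lexx orbT.
      by rewrite !mulr_ge0 ?invr_ge0 ?sqr_ge0// ltW.
    rewrite -(ler_pM2r vi0); apply: (le_trans h).
    apply: (@le_trans _ _ ((10 * C2 * (r ^+ 2 * (J / vol x r))) * vol x r)%R).
      by rewrite le_eqVlt; apply/orP; left; apply/eqP; field; rewrite gt_eqF.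
    apply: (@le_trans _ _ ((10 * C2 * (r ^+ 2 * (J / vol x r))) * (K2 * vol p (rho * r)))%R).
      by rewrite ler_wpM2l// !mulr_ge0 ?invr_ge0 ?sqr_ge0// ltW.
    by rewrite le_eqVlt; apply/orP; left; apply/eqP; ring.
  apply: (@le_trans _ _ (\int[omega]_(y in ball p (rho * r)%R)
     ((4 `^ kappa)%:E * ((((u y - ci) ^+ 2) `^ kappa)%:E + (((ci - c) ^+ 2) `^ kappa)%:E)))).
    apply: le_integral_ge0 => y _; first by rewrite lee_fin powR_ge0.
    rewrite -EFinD -EFinM lee_fin.
    have := sqr_le_powR kappa (u y - ci)%R (ci - c)%R (ltW k0).
    by rewrite subrKA.
  rewrite ge0_integralZl ?lee_fin ?powR_ge0//; last 2 first.
  - exact: emeasurable_funD.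
  - by move=> y _; rewrite -EFinD lee_fin addr_ge0 ?powR_ge0.
  rewrite ge0_integralD//; last 2 first.
  - by move=> y _; rewrite lee_fin powR_ge0.
  - by move=> y _; rewrite lee_fin powR_ge0.
  rewrite integral_cst// voE//.
  apply: (@le_trans _ _ ((4 `^ kappa)%:E * ((vol p (rho * r) * Q `^ kappa)%:E +
     (Q `^ kappa * vol p (rho * r))%:E))).
    apply: lee_wpmul2l; first by rewrite lee_fin powR_ge0.
    apply: leeD => //; rewrite -EFinM lee_fin ler_wpM2r ?(ltW vi0)//.
    by apply: ge0_ler_powR; rewrite ?nnegrE ?sqr_ge0 ?(ltW k0).
  rewrite -EFinD -EFinM lee_fin.
  rewrite [leLHS](_ : _ = vol p (rho * r) * (4 `^ kappa * 2) * Q `^ kappa)%R; last by ring.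
  by rewrite !ler_wpM2r ?mulr_ge0 ?powR_ge0.
exists c; split.
  have [s [sN sx sc]] := hN x r r0.
  apply: (@le_trans _ _ (\int[omega]_(y in \big[setU/set0]_(p <- [seq p <- s | (mdist x p < r)%R])
      ball p (rho * r)%R)
    (((u y - c) ^+ 2) `^ kappa)%:E)).
    apply: ge0_subset_integral => //.
    - by apply: bigsetU_measurable.
    - by move=> y _; rewrite lee_fin powR_ge0.
    - move=> y /sc[p ps py]; rewrite -bigcup_seq; exists p => //=.
      by rewrite mem_filter ps andbT; exact: (allP sx).
  have M0 : (0 <= K1 * vol x r * (4 `^ kappa * 2) * Q `^ kappa)%R.
    by rewrite !mulr_ge0 ?powR_ge0// ltW.
  apply: (le_trans (integral_bigsetU_le _ _ _ _ (mK c setT) _ _ M0 _)).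
  - by move=> y; rewrite lee_fin powR_ge0.
  - by [].
  - by move=> p; rewrite mem_filter => /andP[xp _]; exact: piece.
  rewrite lee_fin.
  have sz : (size [seq p <- s | (mdist x p < r)%R] <= N.+1)%N.
    by rewrite size_filter (leq_trans (count_size _ _))// ltnW.
  apply: (@le_trans _ _ (vol x r * (A * Q `^ kappa))%R).
    rewrite (_ : vol x r * (A * Q `^ kappa) =
      N.+1%:R * (K1 * vol x r * (4 `^ kappa * 2) * Q `^ kappa))%R; last by rewrite /A; ring.
    by rewrite ler_wpM2r// ler_nat.
  rewrite ler_wpM2l ?(ltW v0)//.
  have -> : (A * Q `^ kappa = (A `^ (kappa^-1) * Q) `^ kappa)%R.
    by rewrite powRM ?powR_ge0// -powRrM mulVf ?gt_eqF// powRr1// ltW.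
  have rJ0 : (0 <= r ^+ 2 * (J / vol x r))%R by rewrite mulr_ge0 ?sqr_ge0// divr_ge0// ltW.
  apply: ge0_ler_powR; rewrite ?nnegrE; first exact: ltW.
  - by rewrite mulr_ge0 ?powR_ge0.
  - by rewrite mulr_ge0// ltW.
  rewrite /Q mulrA; apply: ler_wpM2r; last by rewrite le_max lexx.
  by rewrite !mulr_ge0 ?invr_ge0 ?sqr_ge0// ltW.
apply: (@le_trans _ _ (4 * C2 * (r ^+ 2 * J))%:E); last first.
  by rewrite lee_fin; apply: ler_wpM2r; [rewrite mulr_ge0 ?sqr_ge0|rewrite /K le_max lexx orbT].
apply: le_trans h2B; apply: ge0_subset_integral => //.
  by move=> y _; rewrite lee_fin sqr_ge0.
by apply: subset_ball; rewrite mdistxx; lra.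
Qed.

End dilation.

Section mixed.
Context {d : measure_display} {R : realType} {X : metricMeasurableType d R}.
Context (omega : {measure set X -> \bar R}).
Context (openm : forall U : set X, open U -> measurable U).
Context (CD : R) (dbl : forall (x : X) (r : R), (0 < r)%R ->
    [/\ 0 < omega (ball x (2 * r)%R),
        omega (ball x (2 * r)%R) <= CD%:E * omega (ball x r) &
        CD%:E * omega (ball x r) < +oo]).
Context (complete_X : metric_complete X).
Context (omega_complete : measure_is_complete omega).
Context (kappa q q' : R) (q1 : (1 < q)%R) (qq' : (q^-1 + q'^-1 = 1)%R)
  (q'k : (q' <= kappa)%R).
Context (V : X -> R) (RH : reverse_holder omega q V) (pi : {measure set X -> \bar R})
  (piE : forall A : set X, measurable A -> pi A = \int[omega]_(x in A) (V x)%:E).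
Local Notation vol := (ball_volume omega).

Let voE (x : X) (r : R) : (0 < r)%R -> omega (ball x r) = (vol x r)%:E.
Proof. exact: (volE _ CD dbl). Qed.
Let vo0 (x : X) (r : R) : (0 < r)%R -> (0 < vol x r)%R.
Proof. exact: (vol_gt0 _ CD dbl). Qed.
Let mball (x : X) (r : R) : measurable (ball x r).
Proof. exact: ball_measurable. Qed.


Let V0 x : (0 <= V x)%R. Proof. by have [] := RH. Qed.

Lemma mixed_poincare (CS lambdaS lambda2 C2 Lambda : R) :
  (0 < CS)%R -> (1 <= lambdaS)%R -> sobolev_poincare omega kappa CS lambdaS ->
  (1 <= lambda2)%R -> (0 < C2)%R -> poincare22 omega C2 lambda2 ->
  (8 * lambda2 + 8 <= Lambda)%R ->
  exists2 C : R, (0 < C)%R & forall (x : X) (r : R) (u ut : X -> R) (g : X -> \bar R),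
    (0 < r)%R -> newtonian_loc omega u -> quasicontinuous_representative omega u ut ->
    minimal_weak_upper_gradient omega u g ->
    \int[pi]_(y in ball x r) \int[omega]_(z in ball x r) ((u z - ut y) ^+ 2)%:E
    <= C%:E * (r ^+ 2)%:E * pi (ball x r) *
       \int[omega]_(z in ball x (Lambda * r)%R) (g z) ^+ 2.
Proof.
move=> CS0 l1 sob l21 C20 poi La.
have k0 : (0 < kappa)%R by exact: lt_trans ltr01 (lt_le_trans (conjugate_gt1 q q' q1 qq') q'k).
have [C C0 hC] := weighted_integral_le omega openm CD dbl complete_X
  kappa q q' q1 qq' q'k V RH pi piE.
have [K K0 hK] := oscillation_small_dilation omega openm CD dbl complete_X
  kappa CS lambdaS lambda2 C2 Lambda k0 CS0 l1 sob l21 C20 poi La.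
(* The first term comes from u z - c, integrated over omega and multiplied by pi(B); the second from
   ut y - c through the weighted bound. *)
exists (2 * K + 2 * (C * K))%R; first by rewrite addr_gt0 ?mulr_gt0.
move=> x r u ut g r0 nu rep mg.
have mu := newtonian_loc_measurable omega openm CD dbl complete_X u nu.
have mut := representative_measurable omega omega_complete u ut mu rep.
have mV := weight_measurable omega openm CD dbl complete_X q V RH.
have [[bg _] Lg _] := mg.
have [J J0 JE] := integral_sqr_ball omega openm CD dbl complete_X g x (Lambda * r) bg Lg.
have [p p0 pE] := weight_ball omega openm CD dbl complete_X q V RH pi piE x r.
have v0 := vo0 x r r0.
have := hK x r J u g r0 J0 nu mg; rewrite JE => /(_ (lexx _))[c [c1 c2]].
have sqm (w : X -> R) (k : R) : measurable_fun setT w ->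
    measurable_fun setT (fun y => ((w y - k) ^+ 2)%R).
  by move=> mw; apply: measurable_funX; exact: measurable_funB.
pose a := (K * (r ^+ 2 * J))%R.
have a0 : (0 <= a)%R by rewrite /a !mulr_ge0 ?sqr_ge0// ltW.
(* A bound for the inner integral at y, where ut y - c is a constant in z. *)
pose F y := (2 * a + 2 * vol x r * (ut y - c) ^+ 2)%R.
have v0w := ltW v0.
have F0 y : (0 <= F y)%R.
  by apply: addr_ge0; [exact: mulr_ge0|apply: mulr_ge0; [exact: mulr_ge0|exact: sqr_ge0]].
apply: (@le_trans _ _ (\int[pi]_(y in ball x r) (F y)%:E)).
  apply: le_integral_ge0 => y _.
    by apply: integral_ge0 => z _; rewrite lee_fin sqr_ge0.
  apply: (@le_trans _ _ (\int[omega]_(z in ball x r)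
     (2%:E * ((u z - c) ^+ 2)%:E + (2 * (ut y - c) ^+ 2)%:E))).
    apply: le_integral_ge0 => z _; first by rewrite lee_fin sqr_ge0.
    rewrite -EFinM -EFinD lee_fin.
    have h : (0 <= (u z + ut y - 2 * c) ^+ 2)%R by exact: sqr_ge0.
    rewrite (_ : (u z - ut y) ^+ 2 = 2 * (u z - c) ^+ 2 + 2 * (ut y - c) ^+ 2
      - (u z + ut y - 2 * c) ^+ 2)%R; last by ring.
    lra.
  have m1 : measurable_fun (ball x r) (fun z => ((u z - c) ^+ 2)%:E).
    by apply: measurable_funTS; apply/measurable_EFinP; exact: sqm.
  rewrite ge0_integralD//; last 3 first.
  - by move=> z _; rewrite -EFinM lee_fin mulr_ge0// sqr_ge0.
  - exact: emeasurable_funM.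
  - by move=> z _; rewrite lee_fin mulr_ge0// sqr_ge0.
  rewrite ge0_integralZl//; last by move=> z _; rewrite lee_fin sqr_ge0.
  rewrite integral_cst// voE// /F [leRHS]EFinD; apply: leeD.
    by rewrite [leRHS]EFinM lee_wpmul2l.
  by rewrite -EFinM lee_fin le_eqVlt; apply/orP; left; apply/eqP; ring.
apply: (le_trans (integral_pi_le omega openm CD dbl complete_X q V RH pi piE _ _ (mball x r) F0)).
have -> : \int[omega]_(y in ball x r) (F y * V y)%:E =
    (2 * a)%:E * pi (ball x r) +
    (2 * vol x r)%:E * \int[omega]_(y in ball x r) ((ut y - c) ^+ 2 * V y)%:E.
  under eq_integral do rewrite /F mulrDl -[X in (_ + X)%R]mulrA EFinD EFinM [X in _ + X]EFinM.
  have mVE D : measurable_fun D (fun y => (V y)%:E).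
    by apply: measurable_funTS; exact/measurable_EFinP.
  have m2 D : measurable_fun D (fun y => ((ut y - c) ^+ 2 * V y)%:E).
    apply: measurable_funTS; apply/measurable_EFinP; apply: measurable_funM => //.
    exact: sqm.
  rewrite ge0_integralD//; last 4 first.
  - by move=> z _; rewrite -EFinM lee_fin; apply: mulr_ge0 => //; exact: mulr_ge0.
  - exact: emeasurable_funM.
  - move=> z _; rewrite -EFinM lee_fin; apply: mulr_ge0; first exact: mulr_ge0.
    by apply: mulr_ge0 => //; exact: sqr_ge0.
  - exact: emeasurable_funM.
  have a20 : (0 <= 2 * a)%R by exact: mulr_ge0.
  have v20 : (0 <= 2 * vol x r)%R by exact: mulr_ge0.
  rewrite !ge0_integralZl ?lee_fin//; first by rewrite -piE.
  - by move=> y _; rewrite lee_fin mulr_ge0 ?sqr_ge0.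
  - by move=> y _; rewrite lee_fin.
rewrite (integral_representative_le omega openm CD dbl complete_X omega_complete q V RH u)//.
have h := hC x r p (K * (r ^+ 2 * (J / vol x r)))%R (fun y => ((u y - c) ^+ 2)%R) r0 _ pE
  (sqm u c mu) (fun y => sqr_ge0 _) c1.
have {}h := h ltac:(by rewrite !mulr_ge0 ?sqr_ge0 ?invr_ge0// ltW).
rewrite pE; apply: (@le_trans _ _ ((2 * a)%:E * p%:E +
   (2 * vol x r)%:E * (C * (K * (r ^+ 2 * (J / vol x r))) * p)%:E)).
  by rewrite leeD2l// lee_wpmul2l// lee_fin mulr_ge0// ltW.
rewrite -!EFinM -EFinD lee_fin /a le_eqVlt; apply/orP; left; apply/eqP.
by field; rewrite gt_eqF.
Qed.

End mixed.

(** * Zero boundary values *)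

Section zero_boundary.
Context {d : measure_display} {R : realType} {X : metricMeasurableType d R}.
Context (omega : {measure set X -> \bar R}).
Context (openm : forall U : set X, open U -> measurable U).
Context (CD : R) (dbl : forall (x : X) (r : R), (0 < r)%R ->
    [/\ 0 < omega (ball x (2 * r)%R),
        omega (ball x (2 * r)%R) <= CD%:E * omega (ball x r) &
        CD%:E * omega (ball x r) < +oo]).
Local Notation vol := (ball_volume omega).

Let voE (x : X) (r : R) : (0 < r)%R -> omega (ball x r) = (vol x r)%:E.
Proof. exact: (volE _ CD dbl). Qed.
Let vo0 (x : X) (r : R) : (0 < r)%R -> (0 < vol x r)%R.
Proof. exact: (vol_gt0 _ CD dbl). Qed.


Let mball (x : X) (r : R) : measurable (ball x r).
Proof. exact: ball_measurable. Qed.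

Context (unbounded_X : metric_unbounded X) (CP lambdaP : R)
  (poinc : poincare12 omega CP lambdaP).

(** Times within r / 2 of a common time differ by less than r, and along an arc-length
    parametrization this is too little to cross a gap of width r. *)
Lemma curve_indic_eq (x : X) (r : R) (c : curve X) : (0 < r)%R ->
  (forall y, (mdist x y < r)%R \/ (2 * r <= mdist x y)%R) ->
  (\1_(ball x r) (c (curve_end c)) = \1_(ball x r) (c 0%R) :> R)%R.
Proof.
move=> r0 gap; have l0 := ltW (curve_end_gt0 c).
apply: (@itv_induction R 0%R (curve_end c)
  (fun t => \1_(ball x r) (c t) = \1_(ball x r) (c 0%R) :> R)%R) => // t _.
exists (r / 2)%R; first by rewrite divr_gt0.
move=> s t' s0 st' t'l; rewrite !ltr_norml => /andP[a1 a2] /andP[b1 b2] <-.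
have lip : (mdist (c s) (c t') < r)%R.
  by apply: le_lt_trans (curve_lipschitz c _ _ s0 (ltW st') t'l) _; lra.
have t1 := metric_triangle x (c s) (c t').
have t2 := metric_triangle x (c t') (c s); rewrite (metric_sym (c t')) in t2.
rewrite !indicE; congr (_%:R); congr nat_of_bool.
apply/idP/idP; rewrite !inE !ballEmdist /=; have := gap (c s); have := gap (c t'); lra.
Qed.

(* Were an annulus empty, the indicator of the inner ball would have upper
   gradient 0, against the Poincare inequality on a large ball. *)
Lemma annulus_nonempty (x : X) (r : R) : (0 < r)%R ->
  exists y, (r <= mdist x y)%R /\ (mdist x y < 2 * r)%R.
Proof.
move=> r0; apply: contrapT => h.
have gap y : (mdist x y < r)%R \/ (2 * r <= mdist x y)%R.
  have [?|ry] := ltP (mdist x y) r; first by left.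
  by right; rewrite leNgt; apply/negP => yr; apply: h; exists y.
have [y xy] : exists y, (2 * r <= mdist x y)%R.
  have [a [b ab]] := unbounded_X (4 * r)%R.
  have tr := metric_triangle a x b; rewrite (metric_sym a x) in tr.
  have [?|xb] := leP (2 * r)%R (mdist x a); first by exists a.
  by exists b; lra.
pose u : X -> R := \1_(ball x r).
have mu : measurable_fun setT u by exact: measurable_indic.
have wu : weak_upper_gradient omega u (fun=> 0%:E).
  split; first exact: (borel_nonneg_cst 0%R (lexx _)).
  apply/modulus2_eq0P => e e0; exists (fun=> 0%:E); split.
  - exact: (borel_nonneg_cst 0%R (lexx _)).
  - move=> c; rewrite /= /upper_gradient_ineq /u curve_indic_eq// subrr normr0.
    by move=> h'; exfalso; apply: h'; apply: integral_ge0.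
  - by rewrite integral0_eq ?lee_fin ?ltW// => z _; rewrite expe2 mule0.
have lu : loc_integrable omega u.
  move=> z; exists 1%R => //; apply: measurable_bounded_integrable => //.
  - by rewrite voE// ltry.
  - exact: measurable_funTS.
  - exists 1%R; split => // M M1 w _ /=; rewrite /u indicE.
    by case: (_ \in _); rewrite /= ?normr1 ?normr0 ltW// (lt_trans ltr01).
(* The ball of this radius contains ball x r and ball y r, on which the indicator is 1 and 0. *)
pose s := (mdist x y + r)%R.
have s0 : (0 < s)%R by rewrite ltr_wpDl// mdist_ge0.
pose m := mean omega (ball x s) u.
have I0 : \int[omega]_(z in ball x s) `|u z - m|%:E <= 0.
  have := integral_le_eavg omega CD dbl x s 0%R (fun z => `|u z - m|%:E) s0.
  rewrite mulr0; apply; apply: (le_trans (poinc x s u _ s0 lu wu)).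
  rewrite [X in _ * X `^ _](_ : _ = 0) ?poweR0r ?mule0//.
  by rewrite /eavg integral0_eq ?mule0// => z _; rewrite expe2 mule0.
(* The mean oscillation vanishes, so m is the value of u on any ball inside ball x s where u is
   constant. *)
have piece (p : X) (t k : R) : (0 < t)%R -> ball p t `<=` ball x s ->
    (forall z, ball p t z -> u z = k) -> k = m.
  move=> t0 sub uk; have vt := vo0 p t t0.
  have : `|k - m|%:E * omega (ball p t) <= 0.
    rewrite -integral_cst//; apply: le_trans I0.
    apply: (@le_trans _ _ (\int[omega]_(z in ball p t) `|u z - m|%:E)).
      by apply: le_integral_ge0 => z pz; rewrite ?lee_fin// uk.
    apply: ge0_subset_integral => //.
    - apply: measurable_funTS; apply/measurable_EFinP; apply: measurableT_comp => //.
      exact: measurable_funB.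
  rewrite voE// -EFinM lee_fin pmulr_lle0// => km.
  by apply/eqP; rewrite -subr_eq0 -normr_le0.
have e1 : (1 = m)%R.
  apply: (piece x r) => //.
    by apply: subset_ball; rewrite mdistxx /s; have := mdist_ge0 x y; lra.
  by move=> z xz; rewrite /u indicE mem_set.
have e0 : (0 = m)%R.
  apply: (piece y r) => //; first by apply: subset_ball.
  move=> z; rewrite ballEmdist /= => yz; rewrite /u indicE memNset// ballEmdist /=.
  apply/negP; rewrite -leNgt.
  have tr := metric_triangle x z y; rewrite (metric_sym z y) in tr; lra.
have := oner_neq0 R; by rewrite e1 -e0 eqxx.
Qed.

Lemma newtonian_setT_loc (v : X -> R) : newtonian omega setT v -> newtonian_loc omega v.
Proof.
move=> [mv v2 [g [bg ug] g2]] x; exists 1%R => //; split.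
- exact: measurable_funTS.
- apply: le_lt_trans v2; apply: ge0_subset_integral => //.
  + by apply/measurable_EFinP; exact: measurable_funX.
  + by move=> y _; rewrite lee_fin sqr_ge0.
- exists g; first by split => // c _; exact: ug.
  by apply: le_lt_trans g2; exact: integral_sqr_subset.
Qed.

(** By minimality g is a.e. at most its restriction to U; so the energy on any D, in particular on a
    ball dilated by [lambdaS], is controlled by the energy on U. *)
Lemma integral_zero_boundary_gradient (U D : set X) (v : X -> R) (g : X -> \bar R) :
  open U -> newtonian0 omega U v -> minimal_weak_upper_gradient omega v g ->
  measurable D ->
  \int[omega]_(y in D) (g y) ^+ 2 <= \int[omega]_(y in U) (g y) ^+ 2.
Proof.
move=> oU [_ v0] [wg Lg gmin] mD; have [bg _] := wg; have [g0 _] := bg.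
have wgU := weak_upper_gradient_patch omega v g U oU v0 wg.
have [bgU _] := wgU; have [gU0 _] := bgU.
have sqE y : ((g \_ U) y) ^+ 2 = ((fun z => (g z) ^+ 2) \_ U) y.
  by rewrite !patchE; case: ifPn => // _; rewrite expe2 mul0e.
have LgU : loc_L2 omega (g \_ U).
  move=> y; have [r r0 h] := Lg y; exists r => //; apply: le_lt_trans h.
  apply: le_integral_ge0 => z _; first by rewrite expe_ge0.
  by rewrite lee_sqr// patchE; case: ifPn.
apply: (@le_trans _ _ (\int[omega]_y ((g \_ U) y) ^+ 2)); last first.
  by under eq_integral do rewrite sqE; rewrite -integral_mkcond.
apply: (@le_trans _ _ (\int[omega]_(y in D) ((g \_ U) y) ^+ 2)); last first.
  exact: integral_sqr_subset.
apply: ae_ge0_le_integral => //.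
- by move=> y _; rewrite expe_ge0.
- by apply: measurable_funTS; exact: borel_nonneg_sqr.
- by move=> y _; rewrite expe_ge0.
- by apply: measurable_funTS; exact: borel_nonneg_sqr.
apply: filterS (gmin _ wgU LgU) => y gy _; by rewrite lee_sqr.
Qed.

Lemma sobolev_zero_boundary (kappa CS lambdaS : R) : (0 < kappa)%R -> (0 < CS)%R ->
  (1 <= lambdaS)%R -> sobolev_poincare omega kappa CS lambdaS ->
  exists2 K : R, (0 < K)%R & forall (x : X) (r J : R) (v : X -> R) (g : X -> \bar R),
    (0 < r)%R -> (0 <= J)%R -> newtonian0 omega (ball x r) v ->
    minimal_weak_upper_gradient omega v g ->
    \int[omega]_(y in ball x r) (g y) ^+ 2 <= J%:E ->
    \int[omega]_(y in ball x r) (((v y) ^+ 2) `^ kappa)%:E <=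
      (vol x r * (K * (r ^+ 2 * (J / vol x r))) `^ kappa)%:E.
Proof.
move=> k0 CS0 l1 sob.
have [K1 K10 hK1] := vol_compare omega openm CD dbl 5%R.
(* One K1 compares the ball of radius 5 * r with ball x r; in 1 + K1 the terms stand for v - m and
   for m, the latter estimated on ball y r. *)
pose A : R := (4 `^ kappa * (K1 * (1 + K1)))%R.
have A0 : (0 < A)%R by rewrite !mulr_gt0 ?addr_gt0 ?powR_gt0.
exists (A `^ (kappa^-1) * (25 * CS ^+ 2))%R; first by rewrite !mulr_gt0 ?powR_gt0 ?exprn_gt0.
move=> x r J v g r0 J0 nv mg hJ.
have [nvT v0] := nv; have nvl := newtonian_setT_loc v nvT.
have mv : measurable_fun setT v by have [] := nvT.
have vx0 := vo0 x r r0.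
(* As 2 * r <= mdist x y < 4 * r, ball y r misses ball x r and lies in ball x (5 * r). *)
have [y [xy1 xy2]] := annulus_nonempty x (2 * r) ltac:(lra).
have vy0 := vo0 y r r0.
have r50 : (0 < 5 * r)%R by lra.
have lr0 : (0 < lambdaS * (5 * r))%R by rewrite mulr_gt0//; lra.
have lr5 : (5 * r <= lambdaS * (5 * r))%R by rewrite ler_peMl// ltW.
pose m := mean omega (ball x (5 * r)%R) v.
pose Q : R := (25 * CS ^+ 2 * (r ^+ 2 * (J / vol x r)))%R.
have Q0 : (0 <= Q)%R.
  by rewrite /Q mulr_ge0 ?(mulr_ge0 _ (sqr_ge0 _))// mulr_ge0 ?sqr_ge0// divr_ge0// ltW.
have e1 : (vol x (5 * r) <= K1 * vol x r)%R by apply: hK1 => //; rewrite mdistxx add0r.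
have e2 : (vol x r <= K1 * vol y r)%R.
  by apply: hK1 => //; rewrite (metric_sym y); lra.
pose I0 : R := (K1 * vol x r * Q `^ kappa)%R.
have I00 : (0 <= I0)%R by rewrite /I0 !mulr_ge0 ?powR_ge0// ltW.
have hI : \int[omega]_(z in ball x (5 * r)%R) (((v z - m) ^+ 2) `^ kappa)%:E <= I0%:E.
  apply: le_trans (@sobolev_poincare_integral _ _ _ omega CD dbl kappa CS lambdaS k0 (ltW CS0)
    l1 sob x (5 * r)%R J v g r50 J0 nvl mg _) _.
    apply: le_trans hJ; apply: (integral_zero_boundary_gradient _ _ v) => //.
    exact: open_ball.
  rewrite lee_fin /I0; apply: ler_pM => //; first exact/ltW/vo0.
    exact: powR_ge0.
  have vl : (vol x r <= vol x (lambdaS * (5 * r)))%R.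
    by apply: (le_vol omega openm CD dbl) => //; rewrite mdistxx add0r; lra.
  have vl0 : (0 < vol x (lambdaS * (5 * r)))%R by exact: lt_le_trans vx0 vl.
  apply: ge0_ler_powR; rewrite ?nnegrE//; first exact: ltW.
    by apply: mulr_ge0; [exact: sqr_ge0|rewrite divr_ge0// ltW].
  rewrite /Q (_ : 25 * CS ^+ 2 * _ = (CS * (5 * r)) ^+ 2 * (J / vol x r))%R; last by ring.
  by rewrite ler_wpM2l ?sqr_ge0// ler_wpM2l// lef_pV2 ?posrE.
have mm : measurable_fun setT (fun z => (((v z - m) ^+ 2) `^ kappa)%:E).
  by apply: measurable_fun_powR; apply: measurable_funX; exact: measurable_funB.
(* On ball y r the function v is 0, so the oscillation integrand is constant there and its integral
   bounds m. *)
have hm : ((m ^+ 2) `^ kappa * vol y r <= I0)%R.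
  rewrite -lee_fin; apply: le_trans hI.
  apply: (@le_trans _ _ (\int[omega]_(z in ball y r) (((v z - m) ^+ 2) `^ kappa)%:E)); last first.
    apply: ge0_subset_integral => //; first exact: measurable_funTS.
      by move=> z _; rewrite lee_fin powR_ge0.
    by apply: subset_ball; lra.
  rewrite EFinM -voE// -integral_cst//; apply: le_integral_ge0 => z yz.
    by rewrite lee_fin powR_ge0.
  rewrite v0 ?sub0r ?sqrrN//; rewrite ballEmdist /=; apply/negP; rewrite -leNgt.
  move: yz; rewrite ballEmdist /= => yz.
  have tr := metric_triangle x z y; rewrite (metric_sym z y) in tr; lra.
apply: (@le_trans _ _ (\int[omega]_(z in ball x r)
    ((4 `^ kappa)%:E * ((((v z - m) ^+ 2) `^ kappa)%:E + ((m ^+ 2) `^ kappa)%:E)))).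
  apply: le_integral_ge0 => z _; first by rewrite lee_fin powR_ge0.
  rewrite -EFinD -EFinM lee_fin.
  by have := sqr_le_powR kappa (v z - m)%R m (ltW k0); rewrite subrK.
rewrite ge0_integralZl ?lee_fin ?powR_ge0//; last 2 first.
- by apply: emeasurable_funD => //; exact: measurable_funTS.
- by move=> z _; rewrite -EFinD lee_fin addr_ge0 ?powR_ge0.
rewrite ge0_integralD//; last 3 first.
- by move=> z _; rewrite lee_fin powR_ge0.
- exact: measurable_funTS.
- by move=> z _; rewrite lee_fin powR_ge0.
rewrite integral_cst// voE//.
apply: (@le_trans _ _ ((4 `^ kappa)%:E * (I0%:E + (K1 * I0)%:E))).
  apply: lee_wpmul2l; first by rewrite lee_fin powR_ge0.
  apply: leeD.
    apply: le_trans hI; apply: ge0_subset_integral => //; first exact: measurable_funTS.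
      by move=> z _; rewrite lee_fin powR_ge0.
    by apply: subset_ball; rewrite mdistxx; lra.
  rewrite -EFinM lee_fin; apply: (@le_trans _ _ ((m ^+ 2) `^ kappa * (K1 * vol y r))%R).
    by rewrite ler_wpM2l// powR_ge0.
  by rewrite mulrCA ler_wpM2l// ltW.
rewrite -EFinD -EFinM lee_fin.
rewrite (_ : A `^ (kappa^-1) * (25 * CS ^+ 2) * (r ^+ 2 * (J / vol x r)) =
  A `^ (kappa^-1) * Q)%R; last by rewrite /Q; ring.
rewrite [in leRHS]powRM ?powR_ge0// -powRrM mulVf ?gt_eqF// powRr1 ?(ltW A0)// /A /I0.
by rewrite le_eqVlt; apply/orP; left; apply/eqP; ring.
Qed.

End zero_boundary.

(** * Capacity *)

Section capacity_estimate.
Context {d : measure_display} {R : realType} {X : metricMeasurableType d R}.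
Context (omega : {measure set X -> \bar R}).
Context (openm : forall U : set X, open U -> measurable U).
Context (CD : R) (dbl : forall (x : X) (r : R), (0 < r)%R ->
    [/\ 0 < omega (ball x (2 * r)%R),
        omega (ball x (2 * r)%R) <= CD%:E * omega (ball x r) &
        CD%:E * omega (ball x r) < +oo]).
Context (complete_X : metric_complete X).
Context (kappa q q' : R) (q1 : (1 < q)%R) (qq' : (q^-1 + q'^-1 = 1)%R)
  (q'k : (q' <= kappa)%R).
Context (V : X -> R) (RH : reverse_holder omega q V) (pi : {measure set X -> \bar R})
  (piE : forall A : set X, measurable A -> pi A = \int[omega]_(x in A) (V x)%:E).
Local Notation vol := (ball_volume omega).

Let voE (x : X) (r : R) : (0 < r)%R -> omega (ball x r) = (vol x r)%:E.
Proof. exact: (volE _ CD dbl). Qed.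
Let vo0 (x : X) (r : R) : (0 < r)%R -> (0 < vol x r)%R.
Proof. exact: (vol_gt0 _ CD dbl). Qed.
Let mball (x : X) (r : R) : measurable (ball x r).
Proof. exact: ball_measurable. Qed.


Let V0 x : (0 <= V x)%R. Proof. by have [] := RH. Qed.

Context (unbounded_X : metric_unbounded X) (CP lambdaP : R)
  (poinc : poincare12 omega CP lambdaP).

(** E itself may fail to be measurable; it lies in the superlevel sets of the test functions, whose
    measures tend to 0 by Chebyshev's inequality. *)
Lemma sobolev_capacity0_negligible (E : set X) : sobolev_capacity omega E = 0 ->
  omega.-negligible E.
Proof.
move=> E0.
have H (n : nat) : exists v : X -> R, [/\ measurable_fun setT v,
    (forall x, E x -> (1 <= v x)%R) &
    \int[omega]_x ((v x) ^+ 2)%:E < (n.+1%:R^-1)%:E].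
  have : sobolev_capacity omega E < (n.+1%:R^-1)%:E by rewrite E0 lte_fin invr_gt0.
  move=> /ereal_inf_lt[_ [v [g [[mv _ _] vE [bg _] ->]]] lt].
  exists v; split => //; apply: le_lt_trans lt; rewrite leeDl//.
  by apply: integral_ge0 => x _; rewrite expe_ge0//; have [] := bg.
have [v hv] := boolp.choice H.
have mA n : measurable [set x | (1 <= v n x)%R].
  have [mv _ _] := hv n; rewrite -[X in measurable X]setTI.
  exact: measurable_fun_le.
exists (\bigcap_n [set x | (1 <= v n x)%R]); split.
- exact: bigcapT_measurable.
- apply/eqP; rewrite eq_le measure_ge0 andbT; apply/lee_addgt0Pr => e e0; rewrite add0e.
  have [n ne] : exists n : nat, (n.+1%:R^-1 < e)%R.
    by exists (Num.truncn e^-1); rewrite invf_plt ?posrE//; exact: truncnS_gt.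
  have [mv _ lt] := hv n.
  apply: (le_trans _ (ltW (lt_trans lt _))); last by rewrite lte_fin.
  apply: (@le_trans _ _ (omega [set x | (1 <= v n x)%R])).
    apply: le_measure; rewrite ?inE//; first exact: bigcapT_measurable.
    by move=> x; exact.
  rewrite -[leLHS]mul1e -integral_cst// integral_mkcond.
  apply: le_integral_ge0 => x _; rewrite patchE; case: ifPn => //; rewrite ?lee_fin ?sqr_ge0//.
  by rewrite inE /= => h; rewrite -[leLHS](expr1n _ 2) lerXn2r ?nnegrE//; exact: le_trans h.
- by move=> x Ex n _; have [_ /(_ x Ex)] := hv n.
Qed.

Lemma compact_measurable (K : set X) : compact K -> measurable K.
Proof.
move=> cK; rewrite -[K]setCK; apply: measurableC; apply: openm; rewrite openC.
exact: compact_closed (@metric_hausdorff _ X) cK.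
Qed.

Lemma capacity_estimate (CS lambdaS Lambda : R) : (0 < CS)%R -> (1 <= lambdaS)%R ->
  sobolev_poincare omega kappa CS lambdaS -> (1 <= Lambda)%R ->
  exists2 C : R, (0 < C)%R &
    forall (x : X) (r : R) (K : set X), (0 < r)%R -> compact K -> K `<=` ball x r ->
      pi K <= C%:E * ((r ^+ 2)%:E * pi (ball x (Lambda * r)%R)
                / omega (ball x (Lambda * r)%R)) *
        capacity omega K (ball x (Lambda * r)%R).
Proof.
move=> CS0 l1 sob La1.
have k0 : (0 < kappa)%R by exact: lt_trans ltr01 (lt_le_trans (conjugate_gt1 q q' q1 qq') q'k).
have La0 : (0 < Lambda)%R by exact: lt_le_trans ltr01 La1.
have [C C0 hC] := weighted_integral_le omega openm CD dbl complete_X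
  kappa q q' q1 qq' q'k V RH pi piE.
have [Z Z0 hZ] := sobolev_zero_boundary omega openm CD dbl unbounded_X
  CP lambdaP poinc kappa CS lambdaS k0 CS0 l1 sob.
(* The zero-boundary inequality is used at radius Lambda * r, whence the square of [Lambda]. *)
exists (C * Z * Lambda ^+ 2)%R; first by rewrite !mulr_gt0 ?exprn_gt0.
move=> x r K r0 cK Kr.
have R0 : (0 < Lambda * r)%R by rewrite mulr_gt0.
have rR : (r <= Lambda * r)%R by rewrite ler_peMl// ltW.
set U := ball x (Lambda * r)%R.
have mK := compact_measurable K cK.
have KU : K `<=` U by apply: subset_trans Kr _; apply: subset_ball; rewrite mdistxx add0r.
have [p p0 pE] := weight_ball omega openm CD dbl complete_X q V RH pi piE x (Lambda * r).
have v0 := vo0 x _ R0.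
have mV := weight_measurable omega openm CD dbl complete_X q V RH.
rewrite [pi U]pE [omega U]voE// inver gt_eqF// -!EFinM.
set a := (C * Z * Lambda ^+ 2 * (r ^+ 2 * p / vol x (Lambda * r)))%R.
have a0 : (0 <= a)%R.
  rewrite /a mulr_ge0//; first by rewrite !mulr_ge0 ?sqr_ge0// ltW.
  by rewrite divr_ge0 ?(ltW v0)// mulr_ge0 ?sqr_ge0.
(* The factor a is divided out to pass to the infimum; it vanishes when pi(U) = 0, and then pi(K) =
   0 as well. *)
have [p0E|pn0] := eqVneq p 0%R.
  apply: (@le_trans _ _ 0).
    by rewrite -[leRHS]/(0%:E) -p0E -pE; apply: le_measure; rewrite ?inE//; exact: mball.
  rewrite mule_ge0 ?lee_fin//; apply: le_ereal_inf_tmp => _ [v [vt [g [_ _ _ mg ->]]]].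
  by apply: integral_ge0 => y _; rewrite expe_ge0//; have [[[]]] := mg.
have {}a0 : (0 < a)%R.
  by rewrite /a !mulr_gt0 ?exprn_gt0 ?invr_gt0// lt_neqAle eq_sym pn0.
rewrite -lee_pdivrMl//; apply: le_ereal_inf_tmp => _ [v [vt [g [nv rep cap0 mg ->]]]].
rewrite lee_pdivrMl//.
have [[bg _] Lg _] := mg.
have [J J0 JE] := integral_sqr_ball omega openm CD dbl complete_X g x (Lambda * r) bg Lg.
have mv : measurable_fun setT v by have [[]] := nv.
have hS := hZ x (Lambda * r)%R J v g R0 J0 nv mg; rewrite JE in hS.
have {}hS := hS (lexx _).
have rJ0 : (0 <= (Lambda * r) ^+ 2 * (J / vol x (Lambda * r)))%R.
  by rewrite mulr_ge0 ?sqr_ge0// divr_ge0// ltW.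
have mVE (D : set X) : measurable_fun D (fun y => (V y)%:E).
  by apply: measurable_funTS; exact/measurable_EFinP.
have mvV (D : set X) : measurable_fun D (fun y => ((v y) ^+ 2 * V y)%:E).
  apply: measurable_funTS; apply/measurable_EFinP; apply: measurable_funM => //.
  exact: measurable_funX.
apply: (@le_trans _ _ (\int[omega]_(y in K) ((v y) ^+ 2 * V y)%:E)).
  rewrite piE//; apply: ae_ge0_le_integral => //.
  - by move=> y _; rewrite lee_fin.
  - by move=> y _; rewrite lee_fin mulr_ge0 ?sqr_ge0.
  (* Sets of zero Sobolev capacity are null and vt = v a.e., so v >= 1 a.e. on K. *)
  have [_ vtv] := rep.
  have nE : {ae omega, forall y, ~ (K y /\ (vt y < 1)%R)}.
    apply: negligibleS (sobolev_capacity0_negligible _ cap0) => y /=.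
    by rewrite notK.
  apply: filterS2 vtv nE => y vy ny Ky; rewrite lee_fin ler_peMl//.
  have v1 : (1 <= v y)%R by rewrite -vy leNgt; apply/negP => lt; exact: ny (conj Ky lt).
  by rewrite -(expr1n _ 2) lerXn2r ?nnegrE// (le_trans ler01).
apply: (@le_trans _ _ (\int[omega]_(y in U) ((v y) ^+ 2 * V y)%:E)).
  apply: ge0_subset_integral => //; first exact: mball.
  by move=> y _; rewrite lee_fin mulr_ge0 ?sqr_ge0.
apply: (le_trans (hC x (Lambda * r)%R p (Z * ((Lambda * r) ^+ 2 * (J / vol x (Lambda * r))))%R
  (fun y => ((v y) ^+ 2)%R) R0 _ pE _ _ hS)).
- by rewrite mulr_ge0// ltW.
- exact: measurable_funX.
- by move=> y; exact: sqr_ge0.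
rewrite JE -EFinM lee_fin /a le_eqVlt; apply/orP; left; apply/eqP.
by field; rewrite gt_eqF.
Qed.

End capacity_estimate.

(** * Lipschitz cutoffs and the necessity of the ratio bound *)

Section cutoff.
Context {d : measure_display} {R : realType} {X : metricMeasurableType d R}.
Context (openm : forall U : set X, open U -> measurable U).

Lemma measurable_mdist (x : X) : measurable_fun setT (mdist x).
Proof.
apply: (measurability _ (RGenInftyO.measurableE R)) => // _ [_ [a ->] <-].
rewrite setTI (_ : _ @^-1` _ = ball x a); first exact: ball_measurable.
by apply/seteqP; split => y; rewrite ballEmdist /= in_itv.
Qed.

(** For rho > 0: equal to 1 within distance rho of x, to 0 from distance 2 * rho on, and Lipschitz
    with constant 1 / rho. *)
Definition cutoff (x : X) (rho : R) (y : X) : R :=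
  Num.max 0%R (Num.min 1%R (2 - mdist x y / rho)%R).

Lemma cutoff_lipschitz (x : X) (rho : R) (y z : X) : (0 < rho)%R ->
  (`|cutoff x rho y - cutoff x rho z| <= rho^-1 * mdist y z)%R.
Proof.
move=> rho0.
have t1 := metric_triangle x y z; have t2 := metric_triangle x z y.
rewrite (metric_sym z y) in t2.
have ri : (0 < rho^-1)%R by rewrite invr_gt0.
have h1 : (mdist x z / rho <= mdist x y / rho + rho^-1 * mdist y z)%R.
  by rewrite -(mulrC (mdist y z)) -mulrDl ler_wpM2r// ltW.
have h2 : (mdist x y / rho <= mdist x z / rho + rho^-1 * mdist y z)%R.
  by rewrite -(mulrC (mdist y z)) -mulrDl ler_wpM2r// ltW.
have h3 : (0 <= rho^-1 * mdist y z)%R by rewrite mulr_ge0 ?mdist_ge0// ltW.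
move: h1 h2 h3; rewrite /cutoff /Order.max /Order.min.
set s := (mdist x y / rho)%R; set t := (mdist x z / rho)%R; set e := (rho^-1 * _)%R.
move=> h1 h2 h3; rewrite ler_norml.
by case: (ltP 1%R (2 - s)%R) => h4; case: (ltP 1%R (2 - t)%R) => h5;
  rewrite ?ltr01; repeat case: ifPn => [?|/negbTE/negbT]; rewrite -?leNgt;
  move=> *; apply/andP; split; lra.
Qed.

End cutoff.

Section cutoff_capacity.
Context {d : measure_display} {R : realType} {X : metricMeasurableType d R}.
Context (omega : {measure set X -> \bar R}).
Context (openm : forall U : set X, open U -> measurable U).
Context (CD : R) (dbl : forall (x : X) (r : R), (0 < r)%R ->
    [/\ 0 < omega (ball x (2 * r)%R),
        omega (ball x (2 * r)%R) <= CD%:E * omega (ball x r) &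
        CD%:E * omega (ball x r) < +oo]).
Context (complete_X : metric_complete X).
Local Notation vol := (ball_volume omega).

Let voE (x : X) (r : R) : (0 < r)%R -> omega (ball x r) = (vol x r)%:E.
Proof. exact: (volE _ CD dbl). Qed.
Let vo0 (x : X) (r : R) : (0 < r)%R -> (0 < vol x r)%R.
Proof. exact: (vol_gt0 _ CD dbl). Qed.
Let mball (x : X) (r : R) : measurable (ball x r).
Proof. exact: ball_measurable. Qed.


Lemma cutoff_itv (x : X) (rho : R) (y : X) : (0 <= cutoff x rho y <= 1)%R.
Proof. by rewrite /cutoff le_max lexx/= ge_max ler01 ge_min lexx. Qed.

Lemma cutoff_eq0 (x : X) (rho : R) (y : X) : (0 < rho)%R ->
  ~ ball x (2 * rho)%R y -> cutoff x rho y = 0%R.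
Proof.
move=> rho0; rewrite ballEmdist /= => /negP; rewrite -leNgt => h.
have h' : (2 <= mdist x y / rho)%R by rewrite ler_pdivlMr.
by rewrite /cutoff max_l// ge_min; apply/orP; right; lra.
Qed.

Lemma cutoff_eq1 (x : X) (rho : R) (y : X) : (0 < rho)%R ->
  (mdist x y <= rho)%R -> cutoff x rho y = 1%R.
Proof.
move=> rho0 h; have h' : (mdist x y / rho <= 1)%R by rewrite ler_pdivrMr// mul1r.
by rewrite /cutoff min_l ?max_r//; lra.
Qed.

Lemma cutoff_continuous (x : X) (rho : R) : (0 < rho)%R -> continuous (cutoff x rho).
Proof.
move=> rho0 y; apply/cvgrPdist_lt => e e0.
apply/nbhs_ballP; exists (e * rho)%R; first by rewrite /= mulr_gt0.
move=> z; rewrite ballEmdist /= => yz.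
apply: le_lt_trans (cutoff_lipschitz x rho y z rho0) _.
by rewrite mulrC ltr_pdivrMr.
Qed.

Lemma cutoff_measurable (x : X) (rho : R) : measurable_fun setT (cutoff x rho).
Proof.
apply: measurable_maxr => //; apply: measurable_minr => //.
apply: measurable_funB => //; apply: measurable_funM => //.
exact: measurable_mdist.
Qed.

(** For the exceptional sets of the cutoff, which are empty: it is continuous everywhere and equals
    1 on the whole closed ball. *)
Lemma sobolev_capacity_set0 : sobolev_capacity omega set0 = 0.
Proof.
apply/eqP; rewrite eq_le; apply/andP; split.
  have i0 : \int[omega]_(y in setT) (((fun=> 0%:E) : X -> \bar R) y) ^+ 2 = 0.
    by rewrite integral0_eq// => y _; rewrite expe2 mule0.
  have ug0 : upper_gradient setT (fun=> 0%R : R) ((fun=> 0%:E) : X -> \bar R).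
    split; first exact: (borel_nonneg_cst 0%R (lexx _)).
    by move=> c _; rewrite /upper_gradient_ineq subrr normr0; apply: integral_ge0.
  have j0 : \int[omega]_(y in setT) (((fun=> 0%R) : X -> R) y ^+ 2)%:E = 0.
    by rewrite integral0_eq// => y _; rewrite expr0n.
  apply: ge_ereal_inf; exists 0 => //; exists (fun=> 0%R), (fun=> 0%:E); split => //.
    split => //; first by rewrite j0.
    by exists (fun=> 0%:E) => //; rewrite i0.
  by rewrite !i0 adde0.
apply: le_ereal_inf_tmp => _ [v [g [_ _ [[g0 _] _] ->]]]; apply: adde_ge0.
  by apply: integral_ge0 => y _; rewrite lee_fin sqr_ge0.
by apply: integral_ge0 => y _; rewrite expe_ge0.
Qed.

(** Along arc-length parametrizations a Lipschitz constant is an upper gradient; since the cutoff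
    vanishes off the larger ball, the constant may be restricted to it. *)
Lemma cutoff_upper_gradient (x : X) (rho : R) : (0 < rho)%R ->
  upper_gradient setT (cutoff x rho) (((fun=> (rho^-1)%:E) : X -> \bar R) \_ (ball x (2 * rho)%R)).
Proof.
move=> rho0; have ri : (0 <= rho^-1)%R by rewrite invr_ge0 ltW.
have bc := borel_nonneg_cst (X := X) _ ri.
split; first by apply: borel_nonneg_patch => //; exact: open_ball.
move=> c _; apply: upper_gradient_ineq_patch => //; first exact: open_ball.
  by move=> y; exact: cutoff_eq0.
move=> s t s0 st tl; rewrite integral_cst//= lebesgue_measure_itv/= lte_fin st
  -EFinB -EFinM lee_fin.
apply: (le_trans (cutoff_lipschitz x rho _ _ rho0)); rewrite ler_wpM2l//.
by apply: curve_lipschitz => //; exact: ltW.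
Qed.

Lemma capacity_closed_ball_le (x : X) (rho s : R) : (0 < rho)%R -> (2 * rho <= s)%R ->
  capacity omega [set y | (mdist x y <= rho)%R] (ball x s) <=
  ((rho^-1) ^+ 2 * vol x (2 * rho))%:E.
Proof.
move=> rho0 hs; have r20 : (0 < 2 * rho)%R by lra.
set v := cutoff x rho; set B := ball x (2 * rho)%R.
pose g0 : X -> \bar R := (fun=> (rho^-1)%:E) \_ B.
have ug := cutoff_upper_gradient x rho rho0.
have [bg0 ug0] := ug.
have mB : measurable B by exact: mball.
have g0i : \int[omega]_y (g0 y) ^+ 2 = ((rho^-1) ^+ 2 * vol x (2 * rho))%:E.
  transitivity (\int[omega]_(y in B) ((rho^-1) ^+ 2)%:E).
    rewrite [RHS]integral_mkcond; apply: eq_integral => y _; rewrite /g0 !patchE.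
    by case: ifPn => _; rewrite expe2 ?mul0e// -EFinM.
  by rewrite integral_cst// voE.
have nv : newtonian omega setT v.
  split; first exact: cutoff_measurable.
    apply: (@le_lt_trans _ _ (omega B)); last by rewrite voE// ltry.
    rewrite -[leRHS]mul1e -integral_cst// [leRHS]integral_mkcond.
    apply: le_integral_ge0 => y _; first by rewrite lee_fin sqr_ge0.
    rewrite patchE; case: ifPn => [_|]; rewrite lee_fin.
      by have /andP[v0 v1] := cutoff_itv x rho y; rewrite -(expr1n _ 2) lerXn2r ?nnegrE.
    by rewrite notin_setE => nB; rewrite /v cutoff_eq0// expr0n.
  by exists g0 => //; rewrite g0i ltry.
have wg0 : weak_upper_gradient omega v g0.
  split => //; apply/modulus2_eq0P => e e0; exists (fun=> 0%:E); split.
  - exact: (borel_nonneg_cst 0%R (lexx _)).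
  - by move=> c /=; have := ug0 c (@subsetT _ _) => h1 h2; exfalso; exact: h2 h1.
  - by rewrite integral0_eq ?lee_fin ?ltW// => z _; rewrite expe2 mule0.
have bL2 := loc_L2_ball omega openm CD dbl complete_X.
have g0oo : \int[omega]_y (g0 y) ^+ 2 < +oo by rewrite g0i ltry.
have [g mg] := exists_minimal_weak_upper_gradient omega openm bL2 v g0 wg0 g0oo.
have [[bg _] Lg gmin] := mg.
have Lg0 := L2_loc_L2 omega openm g0 bg0 g0oo.
(* The cutoff is admissible as its own quasicontinuous representative; minimality then bounds its
   energy by that of g0. *)
apply: (@le_trans _ _ (\int[omega]_(y in ball x s) (g y) ^+ 2)).
  apply: ge_ereal_inf; exists (\int[omega]_(y in ball x s) (g y) ^+ 2) => //.
  exists v, v, g; split => //.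
  - split => // y nB; apply: cutoff_eq0 => // h; apply: nB; move: y h.
    by apply: subset_ball; rewrite mdistxx add0r.
  - split; last exact/aeW.
    move=> e e0; exists set0; split; first exact: open0.
      by rewrite sobolev_capacity_set0 lte_fin.
    by apply: continuous_subspaceT; exact: cutoff_continuous.
  - rewrite (_ : mkset _ = set0) ?sobolev_capacity_set0//.
    by apply/seteqP; split => // y [/= /cutoff_eq1 h]; rewrite /v h// ltxx.
rewrite -g0i; apply: (@le_trans _ _ (\int[omega]_y (g y) ^+ 2)).
  by apply: integral_sqr_subset => //; exact: mball.
apply: ae_ge0_le_integral => //.
- by move=> y _; rewrite expe_ge0//; have [] := bg.
- exact: borel_nonneg_sqr.
- by move=> y _; rewrite expe_ge0//; have [] := bg0.
- exact: borel_nonneg_sqr.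
apply: filterS (gmin _ wg0 Lg0) => y gy _; rewrite lee_sqr//; [by have [] := bg|by have [] := bg0].
Qed.

(** The hypothesis is used at radius 2 * Lambda * r: the test set, the closed ball of radius Lambda
    * r, has to contain the ball whose pi-measure is wanted and still be a compact subset of the
    reference ball. *)
Lemma dilate_ratio_bounded (pi : {measure set X -> \bar R}) (Lambda : R) : (1 <= Lambda)%R ->
  (exists2 C : R, (0 < C)%R & forall (x : X) (r : R) (K : set X),
     (0 < r)%R -> compact K -> K `<=` ball x r ->
     pi K <= C%:E * capacity omega K (ball x (Lambda * r)%R)) ->
  exists M : R, forall (x : X) (r : R), (0 < r)%R ->
    (r ^+ 2)%:E * pi (ball x (Lambda * r)%R) / omega (ball x (Lambda * r)%R) <= M%:E.
Proof.
move=> La1 [C C0 hC]; have La0 : (0 < Lambda)%R by exact: lt_le_trans ltr01 La1.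
(* The cutoff at scale rho has energy at most CD * vol x rho / rho ^ 2, and r ^ 2 / rho ^ 2 = 1 /
   Lambda ^ 2. *)
exists (C * CD / Lambda ^+ 2)%R => x r r0.
set rho := (Lambda * r)%R; have rho0 : (0 < rho)%R by rewrite mulr_gt0.
have v0 := vo0 x rho rho0; have r20 : (0 < 2 * rho)%R by lra.
pose K := [set y : X | (mdist x y <= rho)%R].
have cK : compact K by exact: (compact_closed_ball_mdist omega openm CD dbl complete_X).
have KB : K `<=` ball x (2 * rho)%R 
  by move=> y h; rewrite ballEmdist /=; apply: (le_lt_trans h); rewrite ltr_pMl// ltr1n.
have h1 := hC x (2 * rho)%R K r20 cK KB.
have h2 : capacity omega K (ball x (Lambda * (2 * rho))%R) <= ((rho^-1) ^+ 2 * vol x (2 * rho))%:E.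
  by apply: capacity_closed_ball_le => //; rewrite ler_peMl// ltW.
have mK : measurable K by exact: compact_measurable.
have h3 : pi (ball x rho) <= (C * ((rho^-1) ^+ 2 * (CD * vol x rho)))%:E.
  apply: (@le_trans _ _ (pi K)).
    apply: le_measure; rewrite ?inE//.
    by move=> y; rewrite ballEmdist /= => /ltW.
  apply: (le_trans h1); rewrite EFinM lee_wpmul2l// ?lee_fin ?(ltW C0)//.
  apply: (le_trans h2); rewrite lee_fin ler_wpM2l ?sqr_ge0//.
  exact: vol_doubling.
rewrite voE// inver gt_eqF//.
apply: (@le_trans _ _ ((r ^+ 2)%:E * (C * ((rho^-1) ^+ 2 * (CD * vol x rho)))%:E *
  ((vol x rho)^-1)%:E)).
  rewrite lee_wpmul2r ?lee_fin ?invr_ge0 ?(ltW v0)//.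
  by rewrite lee_wpmul2l// lee_fin sqr_ge0.
rewrite -!EFinM lee_fin le_eqVlt; apply/orP; left; apply/eqP; rewrite /rho.
by field; rewrite !gt_eqF.
Qed.

End cutoff_capacity.

Theorem proposition5p13
  (d : measure_display) (R : realType) (X : metricMeasurableType d R)
  (omega : {measure set X -> \bar R})
  (regular_omega : borel_regular omega)
  (support_omega : full_support omega)
  (complete_X : metric_complete X)
  (unbounded_X : metric_unbounded X)
  (PI_omega : two_PI omega)
  (* Sobolev-Poincare exponent *)
  (kappa CS lambdaS : R)
  (kappa_gt1 : (1 < kappa)%R) (CS_gt0 : (0 < CS)%R)
  (lambdaS_ge1 : (1 <= lambdaS)%R)
  (sobolev : sobolev_poincare omega kappa CS lambdaS)
  (* structural dilation *)
  (lambda2 C2 Lambda0 tau Lambda : R)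
  (lambda2_ge1 : (1 <= lambda2)%R) (C2_gt0 : (0 < C2)%R)
  (poincare2 : poincare22 omega C2 lambda2)
  (Lambda0_gt : (8 * lambda2 + 8 < Lambda0)%R)
  (tau_gt1 : (1 < tau)%R) (tau_lt : (tau < Lambda0)%R)
  (Lambda_ge : (Num.max Lambda0 (lambda2 * tau) <= Lambda)%R)
  (* d pi = V d omega *)
  (q q' : R) (q_gt1 : (1 < q)%R) (qq' : (q^-1 + q'^-1 = 1)%R)
  (q'_le : (q' <= kappa)%R)
  (V : X -> R) (RH_V : reverse_holder omega q V)
  (pi : {measure set X -> \bar R})
  (piE : forall A : set X, measurable A ->
    pi A = \int[omega]_(x in A) (V x)%:E) :
  [/\ (* weighted Poincare estimate *)
      exists2 C : R, (0 < C)%R &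
        forall (x : X) (r : R) (u ut : X -> R) (g : X -> \bar R),
          (0 < r)%R -> newtonian_loc omega u ->
          quasicontinuous_representative omega u ut ->
          minimal_weak_upper_gradient omega u g ->
          \int[pi]_(y in ball x r) ((ut y - mean omega (ball x r) u) ^+ 2)%:E
          <= C%:E * ((r ^+ 2)%:E * pi (ball x r) / omega (ball x r)) *
             \int[omega]_(y in ball x (lambdaS * r)%R) (g y) ^+ 2,
      (* mixed Poincare estimate on normalized balls *)
      forall c : R, (1 <= c)%R -> exists2 C : R, (0 < C)%R &
        forall (x : X) (r : R), (0 < r)%R ->
          (c^-1)%:E * (omega (ball x r) / (r ^+ 2)%:E) <= pi (ball x r) ->
          pi (ball x r) <= c%:E * (omega (ball x r) / (r ^+ 2)%:E) ->
        forall (u ut : X -> R) (g : X -> \bar R),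
          newtonian_loc omega u ->
          quasicontinuous_representative omega u ut ->
          minimal_weak_upper_gradient omega u g ->
          \int[pi]_(y in ball x r) \int[omega]_(z in ball x r)
            ((u z - ut y) ^+ 2)%:E
          <= C%:E * (r ^+ 2)%:E * pi (ball x r) *
             \int[omega]_(z in ball x (Lambda * r)%R) (g z) ^+ 2,
      (* capacity estimate *)
      exists2 C : R, (0 < C)%R &
        forall (x : X) (r : R) (K : set X),
          (0 < r)%R -> compact K -> K `<=` ball x r ->
          pi K <=
          C%:E * ((r ^+ 2)%:E * pi (ball x (Lambda * r)%R)
                  / omega (ball x (Lambda * r)%R)) *
          capacity omega K (ball x (Lambda * r)%R),
      (* control of the dilate ratio gives the normalized capacity estimate *)
      forall M : R, exists2 C : R, (0 < C)%R &
        forall (x : X) (r : R), (0 < r)%R ->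
          (r ^+ 2)%:E * pi (ball x (Lambda * r)%R)
            / omega (ball x (Lambda * r)%R) <= M%:E ->
        forall K : set X, compact K -> K `<=` ball x r ->
          pi K <= C%:E * capacity omega K (ball x (Lambda * r)%R)
    & (* the normalized capacity estimate requires control of that ratio *)
      (exists2 C : R, (0 < C)%R &
        forall (x : X) (r : R) (K : set X),
          (0 < r)%R -> compact K -> K `<=` ball x r ->
          pi K <= C%:E * capacity omega K (ball x (Lambda * r)%R)) ->
      exists M : R, forall (x : X) (r : R), (0 < r)%R ->
        (r ^+ 2)%:E * pi (ball x (Lambda * r)%R)
          / omega (ball x (Lambda * r)%R) <= M%:E].


Proof.
have [[CD dbl] [CP [lambdaP [CP0 lP1 poinc]]]] := PI_omega.
have [openm _ omega_complete] := regular_omega.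
have La : (8 * lambda2 + 8 <= Lambda)%R.
  apply: (@le_trans _ _ Lambda0); first exact: ltW.
  by apply: le_trans Lambda_ge; rewrite le_max lexx.
have La1 : (1 <= Lambda)%R by lra.
have [Cc Cc0 hCc] := capacity_estimate omega openm CD dbl complete_X kappa q q'
  q_gt1 qq' q'_le V RH_V pi piE unbounded_X CP lambdaP poinc CS lambdaS Lambda CS_gt0
  lambdaS_ge1 sobolev La1.
split.
- exact: (weighted_poincare omega openm CD dbl complete_X omega_complete kappa q q'
    q_gt1 qq' q'_le V RH_V pi piE CS lambdaS CS_gt0 lambdaS_ge1 sobolev).
- move=> c _; have [C C0 hC] := mixed_poincare omega openm CD dbl complete_X omega_complete
    kappa q q' q_gt1 qq' q'_le V RH_V pi piE CS lambdaS lambda2 C2 Lambda CS_gt0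
    lambdaS_ge1 sobolev lambda2_ge1 C2_gt0 poincare2 La.
  by exists C => // x r r0 _ _ u ut g; exact: hC.
- by exists Cc.
(* M may be nonpositive, whereas the constant has to be positive. *)
- move=> M; exists (Cc * Num.max M 1)%R.
    by rewrite mulr_gt0// lt_max ltr01 orbT.
  move=> x r r0 hM K cK Kr; apply: (le_trans (hCc x r K r0 cK Kr)).
  apply: lee_wpmul2r.
    apply: le_ereal_inf_tmp => _ [v [vt [g [_ _ _ mg ->]]]].
    by apply: integral_ge0 => y _; rewrite expe_ge0//; have [[[]]] := mg.
  rewrite [leRHS]EFinM lee_wpmul2l ?lee_fin ?(ltW Cc0)// (le_trans hM)// lee_fin.
  by rewrite le_max lexx.
- exact: (dilate_ratio_bounded omega openm CD dbl complete_X pi Lambda La1).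
Qed.
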